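(* Let $n,k\ge1$ be integers and let $B\subset\mathbb{R}^k\times\mathbb{R}^n$ be a Borel set such that $\dim(\mathrm{proj}_{\mathbb{R}^k}B)=k$. Then there exists a Borel set $G\subset B$ such that the following hold: (1) for every Lipschitz map $f:\mathbb{R}^k\to\mathbb{R}^n$, $\mathcal{L}^k(\{t\in\mathbb{R}^k:(t,f(t))\in G\})=0$; (2) $\dim(B\setminus G)=k+\mathrm{ess}\text{-}\sup(\dim B_t)$, where $$\mathrm{ess}\text{-}\sup(\dim B_t)=\sup\{q\ge0:\mathcal{L}^k(\{t\in\mathbb{R}^k:\dim B_t>q\})>0\}.$$
   Context: $\dim$ denotes Hausdorff dimension, $\mathcal{L}^k$ is Lebesgue (outer) measure on $\mathbb{R}^k$, and $\mathrm{proj}_{\mathbb{R}^k}$ is the projection of $\mathbb{R}^k\times\mathbb{R}^n$ to the first factor. For $t\in\mathbb{R}^k$, $B_t=\{x\in\mathbb{R}^n:(t,x)\in B\}$. By convention $\sup\emptyset=0$. *)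

(* Defs.v *)
From HB Require Import structures.
From mathcomp Require Import all_boot all_order all_algebra.
From mathcomp Require Import all_classical all_reals all_analysis.

Set Implicit Arguments.
Unset Strict Implicit.
Unset Printing Implicit Defensive.

Import Order.TTheory GRing.Theory Num.Theory.
Import numFieldNormedType.Exports.

Local Open Scope classical_set_scope.
Local Open Scope ring_scope.

(* The library norms on ['rV[R]_m] and on pairs are sup norms; the distances
   below are the Euclidean ones (they induce the library topology). *)
Definition eucl_dist (R : realType) (m : nat) (x y : 'rV[R]_m) : R :=
  Num.sqrt (\sum_(i < m) (x 0 i - y 0 i) ^+ 2).

Definition eucl_dist_prod (R : realType) (k n : nat)
    (p q : 'rV[R]_k * 'rV[R]_n) : R :=
  Num.sqrt (eucl_dist p.1 q.1 ^+ 2 + eucl_dist p.2 q.2 ^+ 2).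

Definition eucl_lipschitz (R : realType) (k n : nat) (f : 'rV[R]_k -> 'rV[R]_n) :=
  exists L : R, forall s t, eucl_dist (f s) (f t) <= L * eucl_dist s t.

Definition borel_set (T : topologicalType) (A : set T) : Prop :=
  <<s [set U : set T | open U] >> A.

Local Open Scope ereal_scope.

(* The diameter of the empty set is [-oo]. *)
Definition diameter (R : realType) (T : Type) (d : T -> T -> R) (A : set T) :
    \bar R :=
  ereal_sup [set (d x y)%:E | x in A & y in A].

(* [diam(A)^s], with [0^0 = 1] for nonempty [A] (this is [poweR]'s convention),
   and [0] for empty [A], so that the case [s = 0] is the counting measure. *)
Definition diameter_pow (R : realType) (T : Type) (d : T -> T -> R) (s : R)
    (A : set T) : \bar R :=
  if A == set0 then 0 else poweR (diameter d A) s.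

Definition hausdorff_premeasure (R : realType) (T : Type) (d : T -> T -> R)
    (s delta : R) (A : set T) : \bar R :=
  ereal_inf [set \sum_(0 <= i <oo) diameter_pow d s (U i) |
    U in [set U : nat -> set T |
      A `<=` \bigcup_i U i /\ forall i, diameter d (U i) <= delta%:E]].

Definition hausdorff_measure (R : realType) (T : Type) (d : T -> T -> R)
    (s : R) (A : set T) : \bar R :=
  ereal_sup [set hausdorff_premeasure d s delta A |
    delta in [set delta : R | (0 < delta)%R]].

Definition hausdorff_dim (R : realType) (T : Type) (d : T -> T -> R)
    (A : set T) : \bar R :=
  ereal_inf [set s%:E |
    s in [set s : R | (0 <= s)%R /\ hausdorff_measure d s A = 0]].

Definition box (R : realType) (k : nat) (a b : 'rV[R]_k) : set 'rV[R]_k :=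
  [set x | forall i, (a 0%R i <= x 0%R i <= b 0%R i)%R].

Definition box_volume (R : realType) (k : nat) (a b : 'rV[R]_k) : R :=
  (\prod_(i < k) (b 0 i - a 0 i))%R.

Definition lebesgue_outer (R : realType) (k : nat) (A : set 'rV[R]_k) :
    \bar R :=
  ereal_inf [set \sum_(0 <= j <oo) (box_volume (c j).1 (c j).2)%:E |
    c in [set c : nat -> 'rV[R]_k * 'rV[R]_k |
      (forall j i, ((c j).1 0 i <= (c j).2 0 i)%R) /\
      A `<=` \bigcup_j box (c j).1 (c j).2]].

(* Supremum with the convention [sup set0 = 0] (whereas
   [ereal_sup set0 = -oo]). *)
Definition ereal_sup_or0 (R : realType) (S : set (\bar R)) : \bar R :=
  if S == set0 then 0 else ereal_sup S.

(* [h] need not be measurable, hence the outer measure. *)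
Definition lebesgue_ess_sup (R : realType) (k : nat) (h : 'rV[R]_k -> \bar R) :
    \bar R :=
  ereal_sup_or0 [set q%:E | q in [set q : R |
    (0 <= q)%R /\ 0 < lebesgue_outer [set t | q%:E < h t]]].

(* Main.v *)
(** Let d be the essential supremum of dim B_t. For s > d almost every slice B_t is null for the s-dimensional
    Hausdorff measure, and the coverings witnessing this can be chosen measurably in t: Choquet's capacitability
    theorem, applied to a content on R^k * R^n that weighs a product A * Q by |A| * side(Q)^s, shows that B has
    content zero, hence that it is covered infinitely often by products A_Q * Q of finite total weight, with Q
    dyadic. Cutting each A_Q into dyadic cells P of the size of Q, call (P, Q) heavy if A_Q fills a proportion of
    at least side(P)^eta of P. The points lying in infinitely many heavy products P * Q form a set of dimension
    at most k + s + eta by counting, and the remaining points of B meet every Lipschitz graph in a null set by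
    Borel-Cantelli. Intersecting over s -> d and eta -> 0 gives a Borel set N of dimension at most k + d. Since
    dim B >= k + d by slicing, B also contains a Borel set H of dimension exactly k + d (Besicovitch), and
    G = B \ (N U H) has both properties. *)

From HB Require Import structures.
Require Import Defs.
From mathcomp Require Import all_boot all_order all_algebra.
From mathcomp Require Import all_classical all_reals all_analysis.
From mathcomp Require Import measurable_realfun ring lra zify.

Set Implicit Arguments.
Unset Strict Implicit.
Unset Printing Implicit Defensive.

Import Order.TTheory GRing.Theory Num.Theory numFieldNormedType.Exports.

Local Open Scope classical_set_scope.
Local Open Scope ring_scope.

(** * Contents of dyadic trees *)

(** The obstacle is measurability: each slice has good coverings, but nothing selects them
    measurably in t. Over a compact set this disappears: a slice covered by open neighbourhoods of
    finitely many cubes stays covered for nearby parameters, and there are only countably many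
    finite families of cubes. Capacitability carries this over to Borel sets, provided the content
    of an increasing union is the limit of the contents. For this, points of R^n are replaced by
    paths in a tree of binary digits: nodes are nested or disjoint, so two covers can be exchanged
    for one by the shorter and one by the longer nodes without gaining weight. The gap between s and
    the target exponent e is halved, e = s + 2 eta: there are at most 2^(j (k + s + eta)) heavy
    pairs of generation j, which leaves a factor 2^(-j eta) both for the dimension of their limsup
    and for the light pairs over a graph. The set H is needed because the part of B in N may have
    dimension below k + d; taking H away as well only shrinks G and keeps (1). *)

Notation trunc y m := (mkseq y m).

Lemma take_trunc (T : Type) (y : nat -> T) i m :
  (i <= m)%N -> take i (trunc y m) = trunc y i.
Proof. by move=> im; rewrite /mkseq -map_take take_iota (minn_idPl im). Qed.

Lemma esum_interchange (R : realType) (I J : choiceType) (a : I -> J -> \bar R) :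
  (forall i j, 0 <= a i j)%E ->
  (\esum_(i in [set: I]) \esum_(j in [set: J]) a i j =
   \esum_(j in [set: J]) \esum_(i in [set: I]) a i j)%E.
Proof.
move=> a0; rewrite !esum_esum//.
rewrite (reindex_esum setT _ (fun x : J * I => (x.2, x.1)))//; last first.
  by split=> [[]//|[x1 x2] [y1 y2] _ _ [-> ->]//|[i j] _]; exists (j, i).
rewrite [RHS](_ : _ = \esum_(x in [set: J * I]) a x.2 x.1)%E//.
by congr esum; apply/seteqP; split => [[]|[]].
Qed.

Section tree_content.
Context {d : measure_display} {S : measurableType d} {R : realType} {T : finType}.
Variables (mu : {measure set S -> \bar R}) (r : R).
Implicit Types (A : seq T -> set S) (E : set (S * (nat -> T))) (l : nat).

(* [A v] stands for the rectangle [A v * cylinder of v] of [S * T^nat]; the content is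
   the Method I outer measure with gauge [r ^+ size v * mu (A v)], using only [l <= size v]. *)
Definition cover_weight A : \bar R :=
  (\esum_(v in [set: seq T]) ((r ^+ size v)%:E * mu (A v)))%E.

Definition tree_cover l A E :=
  [/\ forall v, measurable (A v), forall v, (size v < l)%N -> A v = set0 &
      forall p, E p -> exists m, A (trunc p.2 m) p.1].

Definition content l E : \bar R :=
  ereal_inf [set cover_weight A | A in [set A | tree_cover l A E]].

Hypothesis r_ge0 : 0 <= r.

Lemma cover_weight_term_ge0 A v : (0 <= (r ^+ size v)%:E * mu (A v))%E.
Proof. by apply: mule_ge0 => //; rewrite lee_fin exprn_ge0. Qed.

Lemma cover_weight_ge0 A : (0 <= cover_weight A)%E.
Proof. by apply: esum_ge0 => v _; exact: cover_weight_term_ge0. Qed.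

Lemma content_ge0 l E : (0 <= content l E)%E.
Proof. by apply: le_ereal_inf_tmp => _ [A _ <-]; exact: cover_weight_ge0. Qed.

Lemma content_le l A E : tree_cover l A E -> (content l E <= cover_weight A)%E.
Proof. by move=> cA; apply: ereal_inf_lbound; exists A. Qed.

Lemma tree_coverS l A E F : E `<=` F -> tree_cover l A F -> tree_cover l A E.
Proof. by move=> EF [mA lA cA]; split => // p /EF /cA. Qed.

Lemma le_content l E F : E `<=` F -> (content l E <= content l F)%E.
Proof.
move=> EF; apply: ereal_inf_le_tmp => _ [A cA <-]; exists A => //.
exact: tree_coverS cA.
Qed.

Lemma content_near l E (e : R) : 0 < e -> (content l E < +oo)%E ->
  exists2 A, tree_cover l A E & (cover_weight A <= content l E + e%:E)%E.
Proof.
move=> e0 fE; have cfin : content l E \is a fin_num by rewrite ge0_fin_numE ?content_ge0.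
have [_ [A cA <-] wA] := lb_ereal_inf_adherent e0 cfin.
by exists A => //; exact: ltW.
Qed.

Definition shadow A (v : seq T) : set S :=
  \bigcup_(i in [set i | (i < size v)%N]) A (take i v).

(** Over each parameter only the shortest nodes of the two covers survive. [meet_cover] receives
    what is discarded and what is counted twice, so that the two measures sum to at most those of
    [A v] and [B v]. *)
Definition join_cover A B (v : seq T) : set S :=
  (A v `|` B v) `\` shadow (fun u => A u `|` B u) v.

Definition meet_cover A B (v : seq T) : set S :=
  (A v `&` B v) `|` ((A v `|` B v) `&` shadow (fun u => A u `|` B u) v).

Lemma measurable_shadow A v : (forall u, measurable (A u)) -> measurable (shadow A v).
Proof. by move=> mA; apply: bigcup_measurable. Qed.

(** The first level at which either cover catches the path survives in the join. The bound on [m']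
    makes the covering level of a point nonincreasing under repeated joins. *)
Lemma join_cover_trunc l A B E F p m : tree_cover l A E -> tree_cover l B F ->
  A (trunc p.2 m) p.1 \/ B (trunc p.2 m) p.1 ->
  exists2 m', (m' <= m)%N & join_cover A B (trunc p.2 m') p.1.
Proof.
move=> cA cB ABm.
have ex : exists i, `[< (A (trunc p.2 i) `|` B (trunc p.2 i)) p.1 >].
  by exists m; apply/asboolP.
case: (ex_minnP ex) => m' /asboolP ABm' mmin.
exists m'; first by apply: mmin; apply/asboolP.
split => // -[i /=]; rewrite size_mkseq => im'; rewrite take_trunc ?(ltnW im')// => ABi.
by have /mmin : `[< (A (trunc p.2 i) `|` B (trunc p.2 i)) p.1 >] by [apply/asboolP];
  rewrite leqNgt im'.
Qed.

Lemma join_coverP l A B E F : tree_cover l A E -> tree_cover l B F ->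
  tree_cover l (join_cover A B) (E `|` F).
Proof.
move=> cA cB; have [mA lA EA] := cA; have [mB lB FB] := cB; split.
- by move=> v; apply: measurableD; [exact: measurableU|
    apply: measurable_shadow => u; exact: measurableU].
- by move=> v vl; rewrite /join_cover lA// lB// setU0 set0D.
- move=> p EFp.
  have [m ABm] : exists m, A (trunc p.2 m) p.1 \/ B (trunc p.2 m) p.1.
    by case: EFp => [/EA|/FB] [m ?]; exists m; [left|right].
  by have [m' _ ?] := join_cover_trunc cA cB ABm; exists m'.
Qed.

(** If the covers catch a point at different levels, the longer node is shadowed by the shorter one;
    at equal levels the point lies in the intersection. *)
Lemma meet_coverP l A B E F : tree_cover l A E -> tree_cover l B F ->
  tree_cover l (meet_cover A B) (E `&` F).
Proof.
move=> [mA lA EA] [mB lB FB]; split.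
- move=> v; apply: measurableU; first exact: measurableI.
  by apply: measurableI; [exact: measurableU|
    apply: measurable_shadow => u; exact: measurableU].
- by move=> v vl; rewrite /meet_cover lA// lB// setU0 !set0I setU0.
- move=> p [/EA[i Ai] /FB[j Bj]]; case: (ltngtP i j) => ij.
  + exists j; right; split; first by right.
    by exists i; rewrite /= ?size_mkseq// take_trunc ?(ltnW ij)//; left.
  + exists i; right; split; first by left.
    by exists j; rewrite /= ?size_mkseq// take_trunc ?(ltnW ij)//; right.
  + by exists j; left; split; rewrite // -ij.
Qed.

(* Strong subadditivity, level by level. *)
Lemma join_meet_weight A B : (forall v, measurable (A v)) -> (forall v, measurable (B v)) ->
  (cover_weight (join_cover A B) + cover_weight (meet_cover A B) <=
   cover_weight A + cover_weight B)%E.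
Proof.
move=> mA mB; rewrite -!esumD; try by move=> *; exact: cover_weight_term_ge0.
apply: le_esum => v _.
have mS : measurable (shadow (fun u => A u `|` B u) v).
  by apply: measurable_shadow => u; exact: measurableU.
have mU : measurable (A v `|` B v) by exact: measurableU.
have mI : measurable (A v `&` B v) by exact: measurableI.
rewrite -!ge0_muleDr//; apply: lee_pmul => //; first by rewrite lee_fin exprn_ge0.
  by apply: adde_ge0.
apply: (@le_trans _ _ (mu (A v `|` B v) + mu (A v `&` B v))%E); last first.
  rewrite (measureDI mu (mA v) (mB v)) addeAC.
  apply: leeD2r; have -> : A v `|` B v = (A v `\` B v) `|` B v by rewrite setUDl setDv setD0.
  by apply: measureU2 => //; exact: measurableD.
rewrite [in leRHS](measureDI mu mU mS) -addeA; apply: leeD2l.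
by rewrite addeC; apply: measureU2 => //; exact: measurableI.
Qed.

Lemma content_sigma_subadditive l (E : nat -> set (S * (nat -> T))) :
  (content l (\bigcup_i E i) <= \sum_(i <oo) content l (E i))%E.
Proof.
have [fin|/existsNP[i /negP]] := pselect (forall i, (content l (E i) < +oo)%E); last first.
  rewrite -leNgt leye_eq => /eqP ci; apply: (@le_trans _ _ +oo%E); first exact: leey.
  rewrite nneseries_esumT; last by move=> *; exact: content_ge0.
  rewrite -ci; apply: esum_ge; exists [set i]; last by rewrite fsbig_set1.
  by split => //; exact: finite_set1.
apply/lee_addgt0Pr => e e0.
have e2 i : 0 < e / (2 ^ i.+1)%:R by rewrite divr_gt0// ltr0n expn_gt0.
have /choice[A cA] i : exists A, tree_cover l A (E i) /\
    (cover_weight A <= content l (E i) + (e / (2 ^ i.+1)%:R)%:E)%E.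
  by have [A ? ?] := content_near (e2 i) (fin i); exists A.
have mA i v : measurable (A i v) by have [[]] := cA i.
apply: (@le_trans _ _ (cover_weight (fun v => \bigcup_i A i v))).
  apply: content_le; split.
  - by move=> v; apply: bigcup_measurable => i _.
  - by move=> v vl; rewrite bigcup0// => i _; have [[_ + _] _] := cA i; exact.
  - by move=> p [i _]; have [[_ _ +] _] := cA i => /[apply]-[m ?]; exists m, i.
apply: (@le_trans _ _ (\sum_(i <oo) cover_weight (A i))%E); last first.
  apply: le_trans (epsilon_trick xpredT _ (ltW e0)); last by move=> *; exact: content_ge0.
  by apply: lee_nneseries => [i _ _|i _]; [exact: cover_weight_ge0|exact: (cA i).2].
rewrite nneseries_esumT; last by move=> *; exact: cover_weight_ge0.
rewrite /cover_weight esum_interchange; last by move=> *; exact: cover_weight_term_ge0.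
apply: le_esum => v _; rewrite -nneseries_esumT; last by move=> *; exact: cover_weight_term_ge0.
rewrite nneseriesZl//; apply: lee_pmul => //; first by rewrite lee_fin exprn_ge0.
by apply: measure_sigma_subadditive => //; exact: bigcup_measurable.
Qed.

(** The increasing sets lemma: near-optimal covers of the [E i] are joined one after another. Each
    meet still covers [E m], so by strong subadditivity only the errors accumulate, and the lower
    limit of the joins covers the union. *)
Lemma content_nondecreasing l (E : nat -> set (S * (nat -> T))) (c : \bar R) :
  (forall i, E i `<=` E i.+1) -> (forall i, content l (E i) <= c)%E ->
  (content l (\bigcup_i E i) <= c)%E.
Proof.
move=> Einc Ec.
have [->|cfin] := eqVneq c +oo%E; first exact: leey.
have fin i : (content l (E i) < +oo)%E by rewrite (le_lt_trans (Ec i))// ltey.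
apply/lee_addgt0Pr => e e0.
have e2 i : 0 < e / (2 ^ i.+1)%:R by rewrite divr_gt0// ltr0n expn_gt0.
have /choice[A cA] i : exists A, tree_cover l A (E i) /\
    (cover_weight A <= content l (E i) + (e / (2 ^ i.+1)%:R)%:E)%E.
  by have [A ? ?] := content_near (e2 i) (fin i); exists A.
pose U := fix U m := if m is m'.+1 then join_cover (U m') (A m) else A 0%N.
have cU m : tree_cover l (U m) (E m).
  elim: m => [|m IH]; first exact: (cA 0%N).1.
  by apply: tree_coverS (join_coverP IH (cA m.+1).1) => x; right.
(* The accumulated error is e/2 + e/4 + ... + e/2^(m+1). *)
have wU m : (cover_weight (U m) <= content l (E m) + (e - e / (2 ^ m.+1)%:R)%:E)%E.
  elim: m => [|m IH].
    have [_] := cA 0%N; rewrite [U 0%N]/= => /le_trans; apply; apply: leeD2l.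
    by rewrite lee_fin expn1; lra.
  have := join_meet_weight (fun v => let: And3 h _ _ := cU m in h v)
    (fun v => let: And3 h _ _ := (cA m.+1).1 in h v).
  rewrite -/(U m.+1) => JM.
  have cV : (content l (E m) <= cover_weight (meet_cover (U m) (A m.+1)))%E.
    apply: content_le; apply: tree_coverS (meet_coverP (cU m) (cA m.+1).1).
    by move=> x Ex; split => //; exact: Einc.
  have Emfin : content l (E m) \is a fin_num by rewrite ge0_fin_numE ?content_ge0.
  rewrite -(@leeD2rE _ (content l (E m)))//.
  apply: le_trans (leeD2l _ cV) _; apply: le_trans JM _.
  apply: le_trans (leeD IH (cA m.+1).2) _.
  rewrite addeACA [in leRHS]addeAC [(content l (E m) + _)%E]addeC leeD2l// -EFinD lee_fin.
  have -> : (2 ^ m.+2)%:R = 2 * (2 ^ m.+1)%:R :> R by rewrite expnS natrM.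
  have : (2 ^ m.+1)%:R != 0 :> R by rewrite pnatr_eq0 -lt0n expn_gt0.
  by move=> ?; rewrite le_eqVlt; apply/orP; left; apply/eqP; field.
(* [W v] is the lower limit of the [U i v]; the sets [I m v] increase to it and lie in [U m v],
   which bounds their weight. *)
pose I m v := \bigcap_(i in [set i | (m <= i)%N]) U i v.
have mI m v : measurable (I m v).
  by apply: bigcap_measurableType => i _; have [] := cU i.
pose W v := \bigcup_m I m v.
have mW v : measurable (W v) by apply: bigcup_measurable.
apply: (@le_trans _ _ (cover_weight W)).
  apply: content_le; split => //.
  - move=> v vl; rewrite /W bigcup0// => m _; rewrite -subset0 => s /(_ m (leqnn m)).
    by have [_ -> //] := cU m.
  - move=> p [m0 _ Ep].
    have EU m : exists i, `[< U (m0 + m)%N (trunc p.2 i) p.1 >].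
      have [_ _ /(_ p)] := cU (m0 + m)%N; case.
        by elim: m => [|m IH]; rewrite ?addn0// addnS; exact: Einc.
      by move=> i ?; exists i; apply/asboolP.
    pose q m := ex_minn (EU m).
    have qP m : U (m0 + m)%N (trunc p.2 (q m)) p.1.
      by rewrite /q; case: ex_minnP => i /asboolP.
    have qS m : (q m.+1 <= q m)%N.
      have [] := @join_cover_trunc l (U (m0 + m)%N) (A (m0 + m).+1) _ _ p (q m) (cU _) (cA _).1.
        by left; exact: qP.
      move=> i iq Ui; apply: leq_trans iq; rewrite {1}/q; case: ex_minnP => j _; apply.
      by apply/asboolP; rewrite addnS.
    have qle m n : (m <= n)%N -> (q n <= q m)%N.
      move=> /subnK <-; elim: (n - m)%N => // k /(leq_trans (qS _)); exact.
    (* A nonincreasing sequence of natural numbers stays at its minimum from some index on: there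
       the point is covered at one fixed node. *)
    have exq : exists i, `[< exists m, q m = i >] by exists (q 0%N); apply/asboolP; exists 0%N.
    case: (ex_minnP exq) => i /asboolP[m qm] imin.
    exists i; exists (m0 + m)%N => // j /= mj.
    have -> : i = q (j - m0)%N.
      apply/eqP; rewrite eqn_leq -{2}qm qle; last by rewrite leq_subRL ?(leq_trans (leq_addr _ _) mj).
      by rewrite andbT; apply: imin; apply/asboolP; exists (j - m0)%N.
    by have := qP (j - m0)%N; rewrite subnKC// (leq_trans (leq_addr _ _) mj).
apply: ge_ereal_sup => _ [X [finX _] <-].
have cvgI v : ((r ^+ size v)%:E * mu (I m v) @[m --> \oo] --> (r ^+ size v)%:E * mu (W v))%E.
  apply: cvgeZl => //; apply: (@nondecreasing_cvg_mu _ _ _ mu (I ^~ v)) => [||m n mn]; [by []|exact: mW|].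
  by apply/subsetPset => s Is i ni; apply: Is; exact: leq_trans ni.
rewrite fsbig_finite//=; set sX := finmap.enum_fset _.
have cvgX : (\sum_(v <- sX) (r ^+ size v)%:E * mu (I m v) @[m --> \oo] -->
    \sum_(v <- sX) (r ^+ size v)%:E * mu (W v))%E.
  apply: cvg_nnesum => v _; last exact: cvgI.
  by apply: nearW => m; exact: cover_weight_term_ge0.
apply: (cvge_le _ cvgX); apply: nearW => m.
apply: (@le_trans _ _ (cover_weight (U m))).
  apply: esum_ge; exists X => //; rewrite fsbig_finite//=.
  apply: lee_sum => v _; apply: lee_pmul => //; first by rewrite lee_fin exprn_ge0.
  by apply: le_measure; rewrite ?inE; [exact: mI|by have [] := cU m|by move=> s Is; exact: (Is m (leqnn m))].
apply: le_trans (wU m) _; apply: leeD => //.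
by rewrite lee_fin gerBl ltW.
Qed.

End tree_content.

(** * Souslin sets and capacitability *)

Section souslin.
Context {X : topologicalType}.
Implicit Types (F : (nat -> nat) -> set X) (B : set X) (tau sg : nat -> nat).

Definition dominated F tau m : set X :=
  \bigcup_(sg in [set sg | forall i, (i < m)%N -> (sg i <= tau i)%N]) F sg.

(** The closure clause is stated for the sets that [souslin_capacity] produces, so that a big set
    contains an intersection of closures of big subsets; in this form it passes to countable unions
    and intersections. *)
Definition souslin_scheme F B :=
  B = \bigcup_tau F tau /\ forall tau, \bigcap_m closure (dominated F tau m) `<=` B.

Definition souslin B := exists F, souslin_scheme F B.

Lemma dominatedS F tau m m' : (m <= m')%N -> dominated F tau m' `<=` dominated F tau m.
Proof. by move=> mm' x [sg /= sgt Fx]; exists sg => //= i im; exact/sgt/(leq_trans im). Qed.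

Lemma dominated_sub F B tau m : souslin_scheme F B -> dominated F tau m `<=` B.
Proof. by move=> [-> _] x [sg _ Fx]; exists sg. Qed.

Lemma closed_souslin B : closed B -> souslin B.
Proof.
move=> cB; exists (fun=> B); split; first by apply/seteqP; split => [x ?|x [_ _]//]; exists id.
move=> tau x /(_ 0%N I); rewrite [X in _ -> X x](closure_id B).1//.
by apply: closureS => y [].
Qed.

(** The first entry of the sequence selects the set. A bound on it leaves finitely many sets, so a
    point outside all of them is excluded by a finite union of closed sets. *)
Lemma bigcup_souslin (B : nat -> set X) : (forall i, souslin (B i)) -> souslin (\bigcup_i B i).
Proof.
move=> /choice[F FB]; exists (fun tau => F (tau 0%N) (fun i => tau i.+1)); split.
  apply/seteqP; split => [x [i _]|x [tau _ Fx]].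
    have [-> _] := FB i; move=> [tau _ Fx].
    by exists (fun j => if j is j'.+1 then tau j' else i).
  by exists (tau 0%N) => //; have [-> _] := FB (tau 0%N); exists (fun i => tau i.+1).
move=> tau x xtau; apply: contrapT => nBx.
pose tau' i := tau i.+1.
have /choice[m xm] i : exists m, ~ closure (dominated (F i) tau' m) x.
  apply: contrapT => /forallNP h; apply: nBx; exists i => //.
  by have [_ /(_ tau')] := FB i; apply => m _; apply: contrapT; exact: h.
pose M := \max_(i < (tau 0%N).+1) m i.
pose C := \bigcup_(i in `I_(tau 0%N).+1) closure (dominated (F i) tau' (m i)).
have cC : closed C by apply: closed_bigcup => // i _; exact: closed_closure.
have sub : dominated (fun tau => F (tau 0%N) (fun i => tau i.+1)) tau M.+1 `<=` C.
  move=> y [sg /= sgt Fy]; have sg0 : (sg 0 < (tau 0).+1)%N by exact: sgt.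
  exists (sg 0%N) => //; apply: subset_closure; exists (fun i => sg i.+1) => //= i im.
  apply: sgt; rewrite ltnS (leq_trans im)//.
  exact: (@leq_bigmax _ (fun i : 'I_(tau 0).+1 => m i) (Ordinal sg0)).
by have := closureS sub (xtau M.+1 I); rewrite -(closure_id C).1// => -[i _ /xm].
Qed.

(** One sequence encodes a sequence of rows through [pickle]; a bound on an initial segment of a row
    follows from one on a longer initial segment of the whole. *)
Lemma bigcap_souslin (B : nat -> set X) : (forall i, souslin (B i)) -> souslin (\bigcap_i B i).
Proof.
move=> /choice[F FB]; pose row (i : nat) (tau : nat -> nat) (j : nat) := tau (pickle (i, j)).
exists (fun tau => \bigcap_i F i (row i tau)); split.
  apply/seteqP; split => [x Bx|x [tau _ Fx] i _].
    have /choice[t tF] i : exists tau, F i tau x.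
      by have := Bx i I; have [-> _] := FB i; move=> [tau _ ?]; exists tau.
    exists (fun p => if unpickle p is Some (i, j) then t i j else 0%N) => // i _.
    rewrite (_ : row _ _ = t i)//; apply/funext => j.
    by rewrite /row pickleK.
  by have [-> _] := FB i; exists (row i tau) => //; exact: Fx.
move=> tau x xtau i _; have [_ /(_ (row i tau))] := FB i; apply => m _.
pose M := (\max_(j < m) pickle (i, nat_of_ord j)).+1.
apply: closureS (xtau M I) => y [sg /= sgt Fy]; exists (row i sg); last exact: Fy.
move=> j /= jm; apply: sgt; rewrite ltnS.
exact: (@leq_bigmax _ (fun j : 'I_m => pickle (i, nat_of_ord j)) (Ordinal jm)).
Qed.

(** The sigma-algebra argument runs on the sets that are Souslin together with their complement. *)
Lemma borel_souslin B : 
  (forall U : set X, open U -> exists2 C : nat -> set X, forall i, closed (C i) & U = \bigcup_i C i) ->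
  borel_set B -> souslin B.
Proof.
move=> oc; pose P := [set B : set X | souslin B /\ souslin (~` B)].
suff: <<s [set U : set X | open U] >> `<=` P by move=> h /h[].
apply: smallest_sub; first split.
- split; first exact/closed_souslin/closed0.
  by rewrite setC0; apply/closed_souslin/closedT.
- by move=> A [sA sA']; rewrite /P /= setTD setCK.
- move=> A PA; split; first by apply: bigcup_souslin => i; have [] := PA i.
  by rewrite setC_bigcup; apply: bigcap_souslin => i; have [] := PA i.
move=> U /= oU; split; last exact/closed_souslin/open_closedC.
have [C cC ->] := oc U oU; apply: bigcup_souslin => i; exact: closed_souslin.
Qed.

(* Choquet's argument: the values of [tau] are chosen one at a time. *)
Lemma souslin_capacity F (big : set X -> Prop) :
  (forall E : nat -> set X, (forall i, E i `<=` E i.+1) -> big (\bigcup_i E i) ->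
     exists i, big (E i)) ->
  big (\bigcup_tau F tau) -> exists tau, forall m, big (dominated F tau m).
Proof.
move=> bigE bigF; pose dom s := dominated F (nth 0%N s) (size s).
have bigS s : exists n, big (dom s) -> big (dom (rcons s n)).
  have [ds|] := pselect (big (dom s)); last by exists 0%N.
  have [||n] := bigE (fun n => dom (rcons s n)).
  - move=> n x [sg /= sgs Fx]; exists sg => //= i; rewrite size_rcons => im.
    have := sgs i; rewrite size_rcons => /(_ im) /leq_trans; apply.
    by rewrite !nth_rcons; case: ifP => // _; case: ifP.
  - rewrite (_ : \bigcup_n _ = dom s)//; apply/seteqP; split => x.
      move=> [n _ [sg /= sgs Fx]]; exists sg => //= i im.
      have := sgs i; rewrite size_rcons nth_rcons im => -> //.
      by rewrite ltnS ltnW.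
    move=> [sg /= sgs Fx]; exists (sg (size s)) => //; exists sg => //= i.
    rewrite size_rcons ltnS nth_rcons leq_eqVlt => /orP[/eqP ->|im].
      by rewrite ltnn eqxx.
    by rewrite im sgs.
  - by exists n.
have [g gP] := choice bigS.
pose s := fix s m := if m is m'.+1 then rcons (s m') (g (s m')) else [::].
have size_s m : size (s m) = m by elim: m => //= m IH; rewrite size_rcons IH.
pose tau m := g (s m).
have nth_s m i : (i < m)%N -> nth 0%N (s m) i = tau i.
  elim: m => // m IH; rewrite ltnS leq_eqVlt /= nth_rcons size_s => /orP[/eqP ->|im].
    by rewrite ltnn eqxx.
  by rewrite im IH.
have bigs m : big (dom (s m)).
  elim: m => [|m IH]; last exact: gP.
  rewrite (_ : dom _ = \bigcup_tau F tau)//; apply/seteqP; split => x [sg _ Fx]; exists sg => //=.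
exists tau => m; rewrite (_ : dominated _ _ _ = dom (s m))//.
apply/seteqP; split => x [sg /= sgs Fx]; exists sg => //= i im.
  by rewrite size_s in im; rewrite nth_s// sgs.
by rewrite -(nth_s m)// sgs// size_s.
Qed.

End souslin.

Lemma open_bigcup_closed (R : realType) (X : pseudoMetricType R) (U : set X) : open U ->
  exists2 C : nat -> set X, forall i, closed (C i) & U = \bigcup_i C i.
Proof.
move=> oU; exists (fun i => ~` \bigcup_(y in ~` U) (ball y (i.+1%:R^-1 : R))°).
  by move=> i; apply: open_closedC; apply: bigcup_open => y _; exact: open_interior.
apply/seteqP; split => [x Ux|x [i _ Cx]]; last first.
  apply: contrapT => nUx; apply: Cx; exists x => //.
  by apply: nbhs_singleton; apply: nbhs_interior; apply: nbhsx_ballx; rewrite invr_gt0.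
have /nbhs_ballP[e /= e0 xU] : nbhs x U by exact: open_nbhs_nbhs.
have [i ie] : exists i : nat, (i.+1%:R^-1 : R) < e.
  by have [i] := ltr_add_invr e0; rewrite add0r => ?; exists i.
exists i => // -[y nUy /interior_subset /ball_sym yx]; apply/nUy/xU.
by apply: le_ball yx; exact: ltW.
Qed.

(** * Lebesgue outer measure *)

Lemma nat_pairing (R : realType) : exists2 f : nat -> nat * nat,
  (forall ij, exists p, f p = ij) &
  forall g : nat -> nat -> \bar R, (forall i j, 0 <= g i j)%E ->
    (\sum_(p <oo) g (f p).1 (f p).2 = \sum_(i <oo) \sum_(j <oo) g i j)%E.
Proof.
have /card_esym/ppcard_eqP[f] := card_nat2; exists f.
  by move=> ij; exists (f^-1%FUN ij); rewrite invK ?inE.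
move=> g g0; rewrite nneseries_esumT//.
rewrite -(reindex_esum setT setT f (fun p => g p.1 p.2)); last exact: bij.
rewrite nneseries_esumT; last by move=> i; exact: nneseries_ge0.
rewrite (eq_esum (b := fun i => \esum_(j in [set: nat]) g i j)); last first.
  by move=> i _; rewrite nneseries_esumT.
rewrite esum_esum//; congr esum.
by apply/seteqP; split => [[]|[]].
Qed.

Section lebesgue_outer.
Context {R : realType} {k : nat}.
Implicit Types (A : set 'rV[R]_k.+1) (a b : 'rV[R]_k.+1).

Definition box_cover (c : nat -> 'rV[R]_k.+1 * 'rV[R]_k.+1) A :=
  (forall j i, (c j).1 0 i <= (c j).2 0 i) /\ A `<=` \bigcup_j box (c j).1 (c j).2.

Definition box_total (c : nat -> 'rV[R]_k.+1 * 'rV[R]_k.+1) : \bar R :=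
  (\sum_(0 <= j <oo) (box_volume (c j).1 (c j).2)%:E)%E.

Lemma box_volume_ge0 a b : (forall i, a 0 i <= b 0 i) -> 0 <= box_volume a b.
Proof. by move=> ab; apply: prodr_ge0 => i _; rewrite subr_ge0. Qed.

(** Degenerate boxes pad finite coverings to sequences; positivity of the dimension [k.+1] makes
    them free. *)
Lemma box_volume_point a : box_volume a a = 0.
Proof. by rewrite /box_volume big_ord_recl subrr mul0r. Qed.

Lemma lebesgue_outer_le c A : box_cover c A -> (lebesgue_outer A <= box_total c)%E.
Proof. by move=> cA; apply: ereal_inf_lbound; exists c. Qed.

Lemma box_total_ge0 c A : box_cover c A -> (0 <= box_total c)%E.
Proof. by move=> [c0 _]; apply: nneseries_ge0 => j _ _; rewrite lee_fin box_volume_ge0. Qed.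

Lemma lebesgue_outer_ge0 A : (0 <= lebesgue_outer A)%E.
Proof. by apply: le_ereal_inf_tmp => _ [c cA <-]; exact: box_total_ge0 cA. Qed.

Lemma lebesgue_outer0 : lebesgue_outer (set0 : set 'rV[R]_k.+1) = 0%E.
Proof.
apply/eqP; rewrite eq_le lebesgue_outer_ge0 andbT.
apply: le_trans (lebesgue_outer_le (c := fun=> (0, 0)) _) _; first by split => // j i.
by rewrite /box_total eseries0// => j _ _ /=; rewrite box_volume_point.
Qed.

Lemma le_lebesgue_outer A B : A `<=` B -> (lebesgue_outer A <= lebesgue_outer B)%E.
Proof.
move=> AB; apply: ereal_inf_le_tmp => _ [c [c0 Bc] <-]; exists c => //; split => //.
exact: subset_trans Bc.
Qed.

Lemma lebesgue_outer_near A (e : R) : 0 < e -> (lebesgue_outer A < +oo)%E ->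
  exists2 c, box_cover c A & (box_total c <= lebesgue_outer A + e%:E)%E.
Proof.
move=> e0 fA; have Afin : lebesgue_outer A \is a fin_num.
  by rewrite ge0_fin_numE ?lebesgue_outer_ge0.
have [_ [c cA <-] wc] := lb_ereal_inf_adherent e0 Afin.
by exists c => //; exact: ltW.
Qed.

Lemma lebesgue_outer_box a b : (forall i, a 0 i <= b 0 i) ->
  (lebesgue_outer (box a b) <= (box_volume a b)%:E)%E.
Proof.
move=> ab; pose c j := if j is 0%N then (a, b) else (0, 0) : 'rV[R]_k.+1 * 'rV[R]_k.+1.
apply: le_trans (lebesgue_outer_le (c := c) _) _.
  by split => [[|j] i //=|x abx]; exists 0%N.
rewrite /box_total nneseries_recl//; last by move=> [|j]; rewrite lee_fin ?box_volume_ge0// box_volume_point.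
rewrite eseries0 ?adde0// => -[//|j] _ _ /=; by rewrite box_volume_point.
Qed.

Lemma lebesgue_outer_sigma_subadditive : sigma_subadditive (@lebesgue_outer R k.+1).
Proof.
move=> A.
have [fin|/existsNP[i /negP]] := pselect (forall i, (lebesgue_outer (A i) < +oo)%E); last first.
  rewrite -leNgt leye_eq => /eqP Ai; apply: (@le_trans _ _ +oo%E); first exact: leey.
  rewrite nneseries_esumT; last by move=> *; exact: lebesgue_outer_ge0.
  rewrite -Ai; apply: esum_ge; exists [set i]; last by rewrite fsbig_set1.
  by split => //; exact: finite_set1.
apply/lee_addgt0Pr => e e0.
have e2 i : 0 < e / (2 ^ i.+1)%:R by rewrite divr_gt0// ltr0n expn_gt0.
have /choice[c cA] i : exists c, box_cover c (A i) /\
    (box_total c <= lebesgue_outer (A i) + (e / (2 ^ i.+1)%:R)%:E)%E.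
  by have [c ? ?] := lebesgue_outer_near (e2 i) (fin i); exists c.
have c0 i j : (0 <= (box_volume (c i j).1 (c i j).2)%:E)%E.
  by rewrite lee_fin box_volume_ge0// => ?; have [[]] := cA i.
have [f fsurj fsum] := nat_pairing R.
apply: (@le_trans _ _ (box_total (fun p => c (f p).1 (f p).2))).
  apply: lebesgue_outer_le; split=> [j i|x [i _ Aix]] /=.
    by have [[]] := cA (f j).1.
  have [[_ /(_ _ Aix)[j _ xj]] _] := cA i.
  by have [p fp] := fsurj (i, j); exists p => //; rewrite fp.
rewrite /box_total (fsum (fun i j => (box_volume (c i j).1 (c i j).2)%:E))//.
apply: (@le_trans _ _ (\sum_(i <oo) (lebesgue_outer (A i) + (e / (2 ^ i.+1)%:R)%:E))%E).
  apply: lee_nneseries => [i _ _|i _]; last exact: (cA i).2.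
  exact: nneseries_ge0.
apply: (epsilon_trick xpredT _ (ltW e0)) => i; exact: lebesgue_outer_ge0.
Qed.

HB.instance Definition _ := isOuterMeasure.Build R 'rV[R]_k.+1 (@lebesgue_outer R k.+1)
  lebesgue_outer0 lebesgue_outer_ge0 le_lebesgue_outer lebesgue_outer_sigma_subadditive.

Definition lebesgue_mu : {outer_measure set 'rV[R]_k.+1 -> \bar R} := @lebesgue_outer R k.+1.

Definition set_coord a i (x : R) : 'rV[R]_k.+1 := \row_j (if j == i then x else a 0 j).

Lemma box_volume_split a b i (x : R) :
  box_volume a (set_coord b i x) + box_volume (set_coord a i x) b = box_volume a b.
Proof.
rewrite /box_volume (bigD1 i)//= [X in _ + X](bigD1 i)//= [RHS](bigD1 i)//= !mxE eqxx.
rewrite (eq_bigr (fun j => b 0 j - a 0 j)); last by move=> j ji; rewrite !mxE (negbTE ji).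
rewrite [X in _ + _ * X](eq_bigr (fun j => b 0 j - a 0 j)); last by move=> j ji; rewrite !mxE (negbTE ji).
by rewrite -mulrDl addrC addrA subrK.
Qed.

(** The hyperplane cuts each box of a near-optimal covering into two boxes of the same total
    volume. *)
Lemma caratheodory_half_space i (x : R) :
  lebesgue_mu.-caratheodory [set y : 'rV[R]_k.+1 | y 0 i < x].
Proof.
apply: le_caratheodory_measurable => Y.
have [->|Yfin] := eqVneq (lebesgue_mu Y) +oo%E; first exact: leey.
apply/lee_addgt0Pr => e e0.
have [|c [c0 Yc] wc] := @lebesgue_outer_near Y e e0; first by rewrite ltey.
apply: le_trans wc.
(* Clamping [x] to the edge treats the boxes on one side of the hyperplane: one of their two pieces
   is degenerate. *)
pose mid j := Num.max ((c j).1 0 i) (Num.min ((c j).2 0 i) x).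
have mid1 j : (c j).1 0 i <= mid j by rewrite /mid le_max lexx.
have mid2 j : mid j <= (c j).2 0 i by rewrite /mid ge_max c0 ge_min lexx.
pose c1 j := ((c j).1, set_coord (c j).2 i (mid j)).
pose c2 j := (set_coord (c j).1 i (mid j), (c j).2).
have c1c : box_cover c1 (Y `&` [set y | y 0 i < x]).
  split=> [j l|y [/Yc[j _ yj] /= yx]]; rewrite /= ?mxE; first by case: eqP => [->|].
  exists j => // l; rewrite /= mxE; have /andP[-> yl] := yj l.
  by case: eqP => [->|//]; rewrite /mid le_max le_min (ltW yx) andbT; have /andP[_ ->] := yj i; rewrite orbT.
have c2c : box_cover c2 (Y `&` ~` [set y | y 0 i < x]).
  split=> [j l|y [/Yc[j _ yj] /= /negP]]; rewrite /= ?mxE; first by case: eqP => [->|].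
  rewrite -leNgt => xy.
  exists j => // l; rewrite /= mxE; have /andP[yl ->] := yj l; rewrite andbT.
  by case: eqP => [->|//]; rewrite /mid ge_max ge_min xy orbT andbT; have /andP[] := yj i.
apply: le_trans (leeD (lebesgue_outer_le c1c) (lebesgue_outer_le c2c)) _.
have v1 j : 0 <= box_volume (c1 j).1 (c1 j).2 by apply: box_volume_ge0 => l; exact: c1c.1.
have v2 j : 0 <= box_volume (c2 j).1 (c2 j).2 by apply: box_volume_ge0 => l; exact: c2c.1.
rewrite /box_total -nneseriesD => [|j _ _|j _ _]; rewrite ?lee_fin//.
by apply: lee_nneseries => j *; rewrite -EFinD lee_fin ?addr_ge0// box_volume_split.
Qed.

Lemma measurable_half_space i (x : R) :
  lebesgue_mu.-cara.-measurable [set y : 'rV[R]_k.+1 | y 0 i < x].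
Proof. exact: caratheodory_half_space. Qed.

Definition cell a (h : R) : set 'rV[R]_k.+1 :=
  [set y | forall i, a 0 i <= y 0 i < a 0 i + h].

Lemma measurable_cell a h : lebesgue_mu.-cara.-measurable (cell a h).
Proof.
rewrite (_ : cell a h = \bigcap_(i in [set: 'I_k.+1])
  ([set y | y 0 i < a 0 i + h] `&` ~` [set y | y 0 i < a 0 i])).
  apply: fin_bigcap_measurable => // i _; apply: measurableI; first exact: measurable_half_space.
  by apply: measurableC; exact: measurable_half_space.
apply/seteqP; split => y /= yi i.
  by move=> _; have /andP[ay yh] := yi i; split => //=; apply/negP; rewrite -leNgt.
by have [//= -> /negP] := yi i I; rewrite -leNgt => ->.
Qed.

(** The grid cells of mesh 1/(m+1) contained in [U] form a countable family with union [U]. *)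
Lemma measurable_open (U : set 'rV[R]_k.+1) : open U -> lebesgue_mu.-cara.-measurable U.
Proof.
move=> oU.
pose corner (z : 'rV[int]_k.+1) (m : nat) : 'rV[R]_k.+1 := \row_i ((z 0 i)%:~R / m.+1%:R).
pose D := [set p : 'rV[int]_k.+1 * nat | cell (corner p.1 p.2) p.2.+1%:R^-1 `<=` U].
rewrite (_ : U = \bigcup_(p in D) cell (corner p.1 p.2) p.2.+1%:R^-1).
  rewrite bigcup_mkcond; apply: countable_bigcupT_measurable => [|p].
    exact: countableP.
  by case: ifP => _; [exact: measurable_cell|exact: measurable0].
apply/seteqP; split => [x Ux|x [p Dp]]; last exact: Dp.
have /nbhs_ballP[e /= e0 xU] : nbhs x U by exact: open_nbhs_nbhs.
have [m me] : exists m : nat, (m.+1%:R^-1 : R) < e.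
  by have [m] := ltr_add_invr e0; rewrite add0r => ?; exists m.
have m0 : 0 < m.+1%:R :> R by rewrite ltr0n.
have xcell : cell (corner (\row_i Num.floor (x 0 i * m.+1%:R)) m) m.+1%:R^-1 x.
  move=> i; rewrite !mxE ler_pdivrMr// floor_le /=.
  rewrite -[X in _ < _ + X]mul1r -mulrDl ltr_pdivlMr//.
  by have := floorD1_gt (x 0 i * m.+1%:R); rewrite intrD.
exists (\row_i Num.floor (x 0 i * m.+1%:R), m) => // y yc; apply: xU.
split=> // i j; rewrite ord1 /ball /= /ball_ /= distrC.
have := xcell j; have := yc j; rewrite ltr_distlC /= => /andP[y1 y2] /andP[x1 x2].
move: y1 y2 x1 x2 me; move: (corner _ _ _ _) (x 0 j) (y 0 j) (m.+1%:R^-1) => c u w h *.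
by apply/andP; split; lra.
Qed.

End lebesgue_outer.

(** * Dyadic null sets and Hausdorff dimension *)

(** [rate s ^+ m] is the s-dimensional gauge of the scale 2^-m; natural powers of one number replace
    real powers of scales. *)
Definition rate (R : realType) (s : R) : R := 2 `^ (- s).

Section rate.
Context {R : realType}.
Implicit Types s : R.

Lemma rate_gt0 s : 0 < rate s. Proof. exact: powR_gt0. Qed.

Lemma rate_ge0 s : 0 <= rate s. Proof. exact/ltW/rate_gt0. Qed.

Lemma rate_lt1 s : 0 < s -> rate s < 1.
Proof.
by move=> s0; rewrite /rate powRN invf_lt1 ?powR_gt0// /powR pnatr_eq0 expR_gt1 mulr_gt0// ln_gt0// ltr1n.
Qed.

Lemma rateE s m : rate s ^+ m = (2^-1 ^+ m) `^ s.
Proof.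
rewrite /rate -powR_mulrn ?powR_ge0// -powRrM exprVn.
by rewrite -powR_invn// -powRrM; congr powR; ring.
Qed.

Lemma rateD s t : rate (s + t) = rate s * rate t.
Proof. by rewrite /rate opprD powRD// pnatr_eq0 implybT. Qed.

Lemma ler_rate s t : s <= t -> rate t <= rate s.
Proof. by move=> st; apply: ler_powR; rewrite ?lerN2// ler1n. Qed.

Lemma rate_nat k : rate k%:R = 2^-1 ^+ k :> R.
Proof. by rewrite /rate powR_invn// exprVn. Qed.

Lemma expr_small (r e : R) : 0 <= r < 1 -> 0 < e -> exists m : nat, r ^+ m < e.
Proof.
move=> /andP[r0 r1] e0; have : r ^+ n @[n --> \oo] --> 0 by apply: cvg_expr; rewrite ger0_norm.
by move=> /cvgr_lt/(_ _ e0)[m _ mP]; exists m; apply: mP => /=.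
Qed.

End rate.

Section dyadic_null.
Context {R : realType} {T : Type}.
Variable dist : T -> T -> R.
Implicit Types (E F : set T) (s : R).

(** The weight [c i] only dominates the gauge of a scale, which leaves room for additive slack. *)
Definition dyadic_cover s E (U : nat -> set T) (c : nat -> \bar R) :=
  E `<=` \bigcup_i U i /\ forall i, (0 <= c i)%E /\ (U i !=set0 ->
    exists m : nat, (forall x y, U i x -> U i y -> dist x y <= 2^-1 ^+ m) /\
      ((rate s ^+ m)%:E <= c i)%E).

(* For [0 < s] this is nullity of the [s]-dimensional Hausdorff measure, with the
   diameters of the covering sets rounded up to powers of [1/2]. *)
Definition dyadic_null s E := forall e : R, 0 < e ->
  exists U c, dyadic_cover s E U c /\ (\sum_(i <oo) c i <= e%:E)%E.

Lemma dyadic_null_sub s E F : E `<=` F -> dyadic_null s F -> dyadic_null s E.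
Proof.
move=> EF nF e /nF[U [c [[FU Uc] ce]]]; exists U, c; split => //; split => //.
exact: subset_trans FU.
Qed.

Lemma dyadic_null0 s : dyadic_null s set0.
Proof.
move=> e e0; exists (fun=> set0), (fun=> 0%E); rewrite eseries0//; split; last by rewrite lee_fin ltW.
by split => // i; split => // -[].
Qed.

Lemma dyadic_null_le s t E : s <= t -> dyadic_null s E -> dyadic_null t E.
Proof.
move=> st nE e /nE[U [c [[EU Uc] ce]]]; exists U, c; split => //; split => // i.
have [c0 Ui] := Uc i; split => // /Ui[m [dm mc]]; exists m; split => //.
apply: le_trans mc; rewrite lee_fin; apply: lerXn2r; rewrite ?nnegrE ?rate_ge0//.
exact: ler_rate.
Qed.

Lemma dyadic_null_bigcup s (E : nat -> set T) :
  (forall i, dyadic_null s (E i)) -> dyadic_null s (\bigcup_i E i).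
Proof.
move=> nE e e0.
have e2 i : 0 < e / (2 ^ i.+1)%:R by rewrite divr_gt0// ltr0n expn_gt0.
have /choice[U /choice[c UcP]] i := nE i _ (e2 i).
have [f fsurj fsum] := nat_pairing R.
exists (fun p => U (f p).1 (f p).2), (fun p => c (f p).1 (f p).2); split.
  split=> [x [i _ Ex]|p].
    have [[/(_ x Ex)[j _ Ux] _] _] := UcP i.
    by have [p fp] := fsurj (i, j); exists p => //; rewrite fp.
  by have [[_ +] _] := UcP (f p).1; apply.
have c0 i j : (0 <= c i j)%E by have [[_ /(_ j)[]]] := UcP i.
rewrite fsum//; apply: le_trans (epsilon_trick0 xpredT (ltW e0)).
apply: lee_nneseries => [i _ _|i _]; first exact: nneseries_ge0.
exact: (UcP i).2.
Qed.

Lemma dyadic_nullU s E F : dyadic_null s E -> dyadic_null s F -> dyadic_null s (E `|` F).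
Proof.
move=> nE nF; apply: (@dyadic_null_sub _ _ (\bigcup_i (if i is 0%N then E else F))).
  by move=> x [Ex|Fx]; [exists 0%N|exists 1%N].
by apply: dyadic_null_bigcup => -[].
Qed.

Lemma nneseries_ge_term (c : nat -> \bar R) i : (forall i, 0 <= c i)%E ->
  (c i <= \sum_(j <oo) c j)%E.
Proof.
move=> c0; rewrite nneseries_esumT//; apply: esum_ge.
by exists [set i]; rewrite ?fsbig_set1//; split => //; exact: finite_set1.
Qed.

(* A total weight below [rate s ^+ l] forces every scale to be finer than [l]. *)
Lemma dyadic_null_fine s E l (e : R) : 0 < s -> 0 < e -> dyadic_null s E ->
  exists (U : nat -> set T) c,
  [/\ E `<=` \bigcup_i U i, (forall i, 0 <= c i)%E, (\sum_(i <oo) c i <= e%:E)%E &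
  forall i, U i !=set0 -> exists m : nat, [/\ (l <= m)%N,
    (forall x y, U i x -> U i y -> dist x y <= 2^-1 ^+ m) & ((rate s ^+ m)%:E <= c i)%E]].
Proof.
move=> s0 e0 nE; have e'0 : 0 < Num.min e (rate s ^+ l) by rewrite lt_min e0 exprn_gt0// rate_gt0.
have [U [c [[EU Uc] ce]]] := nE _ e'0; exists U, c.
have c0 i : (0 <= c i)%E by have [] := Uc i.
split => //.
  by apply: le_trans ce _; rewrite lee_fin ge_min lexx.
move=> i /(proj2 (Uc i))[m [dm mc]]; exists m; split => //.
have : (rate s ^+ m <= rate s ^+ l).
  have := le_trans mc (le_trans (nneseries_ge_term i c0) ce).
  by rewrite lee_fin le_min => /andP[].
by rewrite ler_iXn2l ?rate_gt0 ?rate_lt1.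
Qed.

Hypothesis dist_xx : forall x, dist x x = 0.

Lemma diameter_ge0 E : E !=set0 -> (0 <= diameter dist E)%E.
Proof. by move=> [x Ex]; apply: ereal_sup_ubound; exists x => //; exists x; rewrite ?dist_xx. Qed.

Lemma diameter_le E (h : R) : (forall x y, E x -> E y -> dist x y <= h) ->
  (diameter dist E <= h%:E)%E.
Proof. by move=> Eh; apply: ge_ereal_sup => _ [x Ex [y Ey <-]]; rewrite lee_fin Eh. Qed.

Lemma dist_le_diameter E (x y : T) : E x -> E y -> ((dist x y)%:E <= diameter dist E)%E.
Proof. by move=> Ex Ey; apply: ereal_sup_ubound; exists x => //; exists y. Qed.

Lemma diameter_pow_ge0 s E : (0 <= diameter_pow dist s E)%E.
Proof. by rewrite /diameter_pow; case: ifP => // _; exact: poweR_ge0. Qed.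

Lemma hausdorff_premeasure_ge0 s h E : (0 <= hausdorff_premeasure dist s h E)%E.
Proof.
by apply: le_ereal_inf_tmp => _ [U _ <-]; apply: nneseries_ge0 => *; exact: diameter_pow_ge0.
Qed.

Lemma hausdorff_measure_eq0 s E : hausdorff_measure dist s E = 0%E <->
  forall h e : R, 0 < h -> 0 < e -> exists U : nat -> set T,
    [/\ E `<=` \bigcup_i U i, forall i, (diameter dist (U i) <= h%:E)%E &
      (\sum_(0 <= i <oo) diameter_pow dist s (U i) <= e%:E)%E].
Proof.
split=> [H0 h e h0 e0|H].
  have : (hausdorff_premeasure dist s h E < e%:E)%E.
    apply: (@le_lt_trans _ _ 0%E); last by rewrite lte_fin.
    by rewrite -H0; apply: ereal_sup_ubound; exists h.
  by move=> /ereal_inf_ltP[_ [U [EU Uh] <-] /ltW Ue]; exists U.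
apply/eqP; rewrite eq_le; apply/andP; split; last first.
  apply: le_trans (hausdorff_premeasure_ge0 s 1 E) _.
  by apply: ereal_sup_ubound; exists 1 => //=; exact: ltr01.
apply: ge_ereal_sup => _ [h /= h0 <-]; apply/lee_addgt0Pr => e e0; rewrite add0e.
have [U [EU Uh Ue]] := H h e h0 e0; apply: le_trans Ue.
by apply: ereal_inf_lbound; exists U.
Qed.

(** Rounding up to a power of 1/2 costs a factor 2^s. The slack [e] pays for diameter 0, whose gauge
    vanishes although every scale has positive weight. *)
Lemma dyadic_scale s (D e : R) : 0 < s -> 0 <= D <= 1 -> 0 < e ->
  exists m : nat, D <= 2^-1 ^+ m /\ rate s ^+ m <= 2 `^ s * D `^ s + e.
Proof.
move=> s0 /andP[D0 D1] e0; have half1 : 0 <= (2^-1 : R) < 1 by rewrite invr_ge0 invf_lt1 ?ltr1n ?ler0n.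
move: D0; rewrite le_eqVlt => /predU1P[D0|D0].
  have [|m me] := @expr_small _ (rate s) e _ e0; first by rewrite rate_ge0 rate_lt1.
  exists m; rewrite -D0 exprn_ge0 ?invr_ge0//; split => //.
  by rewrite powR0 ?gt_eqF// mulr0 add0r ltW.
have ex := expr_small half1 D0.
case: (ex_minnP ex) => -[|m] mD mmin; first by move: mD; rewrite expr0 ltNge D1.
exists m; split; first by rewrite leNgt; apply/negP => /mmin; rewrite ltnn.
rewrite rateE -powRM//; last exact: ltW.
apply: (@le_trans _ _ ((2 * D) `^ s)); last by rewrite lerDl ltW.
apply: ge0_ler_powR; rewrite ?nnegrE ?ltW ?exprn_gt0 ?mulr_gt0// ?invr_gt0//.
by move: mD; rewrite exprS; lra.
Qed.

Lemma hausdorff_measure0P s E : 0 < s -> hausdorff_measure dist s E = 0%E <-> dyadic_null s E.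
Proof.
move=> s0; rewrite hausdorff_measure_eq0; split => H.
- move=> e e0; have p0 : 0 < 2 `^ s :> R by exact: powR_gt0.
  (* Diameters at most 1 allow [dyadic_scale]; half of [e] goes to the rounded diameters, the other
     half to the slack. *)
  have [|U [EU Uh Ue]] := H 1 (e / 2 / 2 `^ s) ltr01; first by rewrite !divr_gt0.
  have e2 i : 0 < (e / 2) / (2 ^ i.+1)%:R by rewrite !divr_gt0// ltr0n expn_gt0.
  pose c i : \bar R := ((2 `^ s)%:E * diameter_pow dist s (U i) + ((e / 2) / (2 ^ i.+1)%:R)%:E)%E.
  have c1 i : (0 <= (2 `^ s)%:E * diameter_pow dist s (U i))%E.
    by apply: mule_ge0; [rewrite lee_fin ltW|exact: diameter_pow_ge0].
  exists U, c; split; first split => // i.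
    split; first by rewrite adde_ge0// lee_fin ltW.
    move=> Ui; have D0 := diameter_ge0 Ui.
    have Dfin : diameter dist (U i) \is a fin_num by rewrite ge0_fin_numE// (le_lt_trans (Uh i))// ltry.
    have [|m [Dm mD]] := @dyadic_scale s (fine (diameter dist (U i))) _ s0 _ (e2 i).
      by rewrite fine_ge0//= -lee_fin fineK//; exact: Uh.
    exists m; split.
      move=> x y Ux Uy; apply: le_trans Dm; rewrite -lee_fin fineK//.
      exact: dist_le_diameter.
    rewrite /c /diameter_pow; case: ifPn => [/eqP U0|_]; first by case: Ui => x; rewrite U0.
    by rewrite -(fineK Dfin) poweR_EFin -EFinM -EFinD lee_fin.
  apply: le_trans (epsilon_trick xpredT _ (ltW (divr_gt0 e0 (ltr0Sn _ 1)))) _ => //.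
  rewrite nneseriesZl; last by move=> *; exact: diameter_pow_ge0.
  apply: (@le_trans _ _ ((2 `^ s)%:E * (e / 2 / 2 `^ s)%:E + (e / 2)%:E)%E).
    by apply: leeD => //; apply: lee_pmul => //; apply: nneseries_ge0 => *; exact: diameter_pow_ge0.
  by rewrite -EFinM -EFinD lee_fin mulrCA divff ?gt_eqF//; lra.
- move=> h e h0 e0.
  have [|l lh] := @expr_small _ (2^-1 : R) h _ h0; first by rewrite invr_ge0 invf_lt1 ?ltr1n ?ler0n.
  have [U [c [EU c0 ce Uc]]] := dyadic_null_fine l s0 e0 H.
  exists U; split => // [i|].
    have [->|/set0P Ui] := eqVneq (U i) set0.
      by rewrite /diameter [X in ereal_sup X](_ : _ = set0) ?ereal_sup0 ?leNye//; apply/seteqP; split => // ? [].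
    have [m [lm dm _]] := Uc i Ui; apply: le_trans (diameter_le dm) _.
    rewrite lee_fin; apply: le_trans (ltW lh).
    by rewrite ler_wiXn2l ?invr_ge0// invf_le1 ?ler1n.
  apply: le_trans ce; apply: lee_nneseries => [i *|i _]; first exact: diameter_pow_ge0.
  rewrite /diameter_pow; case: ifPn => // /set0P Ui.
  have [m [_ dm mc]] := Uc i Ui; apply: le_trans mc.
  rewrite rateE -poweR_EFin; apply: gt0_ler_poweR; first exact: ltW.
  - by rewrite in_itv /= diameter_ge0// leey.
  - by rewrite in_itv /= lee_fin exprn_ge0 ?invr_ge0// leey.
  - exact: diameter_le.
Qed.

Lemma hausdorff_dim_ge0 E : (0 <= hausdorff_dim dist E)%E.
Proof. by apply: le_ereal_inf_tmp => _ [s [s0 _] <-]. Qed.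

Lemma hausdorff_dim_le E (v : \bar R) : (0 <= v)%E ->
  (forall s, 0 < s -> (v < s%:E)%E -> dyadic_null s E) -> (hausdorff_dim dist E <= v)%E.
Proof.
case: v => [v||//]; last by move=> *; exact: leey.
rewrite lee_fin => v0 vE; apply/lee_addgt0Pr => e e0; rewrite -EFinD.
have s0 : 0 < v + e by rewrite ltr_wpDl.
apply: ereal_inf_lbound; exists (v + e) => //; split; first exact: ltW.
by apply/hausdorff_measure0P => //; apply: vE; rewrite // lte_fin ltrDl.
Qed.

(** In dimension 0 each nonempty covering set weighs 1. This settles the exponent that
    [hausdorff_measure0P] excludes. *)
Lemma hausdorff_measure0_empty E : hausdorff_measure dist 0 E = 0%E -> E = set0.
Proof.
move=> /hausdorff_measure_eq0/(_ 1 2^-1)[] => [||U [EU _ Ue]]; rewrite ?invr_gt0//.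
rewrite -subset0 => x /EU[i _ Ux].
suff : (1 <= (2^-1)%:E :> \bar R)%E by rewrite lee_fin; lra.
apply: le_trans Ue; apply: le_trans (nneseries_ge_term i _); last by move=> *; exact: diameter_pow_ge0.
by rewrite /diameter_pow; case: ifPn => [/eqP U0|_]; [rewrite U0 in Ux|rewrite poweRe0].
Qed.

Lemma hausdorff_dim_lt E s : (hausdorff_dim dist E < s%:E)%E -> dyadic_null s E.
Proof.
move=> /ereal_inf_ltP[_ [t [t0 Ht] <-]]; rewrite lte_fin => ts.
move: t0; rewrite le_eqVlt => /predU1P[t0|t0]; last first.
  exact: dyadic_null_le (ltW ts) ((hausdorff_measure0P _ t0).1 Ht).
rewrite -t0 in Ht; rewrite (hausdorff_measure0_empty Ht).
exact: dyadic_null0.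
Qed.

End dyadic_null.

(** * Binary digits of points *)

Lemma nested_compact (X : topologicalType) (K : set X) (C : nat -> set X) :
  compact K -> C 0%N `<=` K -> (forall n, closed (C n)) ->
  (forall n, C n.+1 `<=` C n) -> (forall n, C n !=set0) -> exists x, forall n, C n x.
Proof.
move=> cK CK cC CS C0.
have Cle m n : (m <= n)%N -> C n `<=` C m.
  by move=> /subnK <-; elim: (n - m)%N => // i IH x /CS /IH.
pose F := [set A | exists n, C n `<=` A].
have FF : ProperFilter F.
  apply: Build_ProperFilter.
    by move=> [n Cn]; have [x /Cn] := C0 n.
  split; first by exists 0%N.
  - move=> A B [m Am] [n Bn]; exists (maxn m n) => x Cx; split.
      by apply: Am; apply: Cle Cx; exact: leq_maxl.
    by apply: Bn; apply: Cle Cx; exact: leq_maxr.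
  - by move=> A B AB [n An]; exists n => x /An /AB.
have [|x [_ xF]] := cK F FF; first by exists 0%N.
by exists x => n; apply: cC => B Bx; apply: xF => //; exists n.
Qed.

Lemma closed_box (R : realType) m (a b : 'rV[R]_m) : closed (box a b).
Proof.
rewrite (_ : box a b = \bigcap_(i in [set: 'I_m]) ((fun x : 'rV[R]_m => x 0 i) @^-1`
   `[a 0 i, b 0 i]%classic)); last first.
  apply/seteqP; split => x /= h i; first by move=> _; rewrite /= in_itv; exact: h.
  by have := h i I; rewrite /= in_itv.
apply: closed_bigI => i _; apply: preimage_closed; last exact: itv_closed.
by move=> x _; exact: coord_continuous.
Qed.

Section euclidean.
Context {R : realType}.

Lemma eucl_dist_ge0 m (x y : 'rV[R]_m) : 0 <= eucl_dist x y.
Proof. exact: sqrtr_ge0. Qed.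

Lemma eucl_dist_xx m (x : 'rV[R]_m) : eucl_dist x x = 0.
Proof. by rewrite /eucl_dist big1 ?sqrtr0// => i _; rewrite subrr expr0n. Qed.

Lemma coord_le_eucl_dist m (x y : 'rV[R]_m) i : `|x 0 i - y 0 i| <= eucl_dist x y.
Proof.
rewrite -sqrtr_sqr /eucl_dist ler_sqrt; last by apply: sumr_ge0 => j _; exact: sqr_ge0.
by rewrite (bigD1 i)//= lerDl; apply: sumr_ge0 => j _; exact: sqr_ge0.
Qed.

Lemma eucl_dist_le m (x y : 'rV[R]_m) h : 0 <= h ->
  (forall i, `|x 0 i - y 0 i| <= h) -> eucl_dist x y <= m%:R * h.
Proof.
move=> h0 xyh; have mh0 : 0 <= m%:R * h by rewrite mulr_ge0.
rewrite -[leRHS]ger0_norm// -sqrtr_sqr ler_sqrt ?sqr_ge0//.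
apply: (@le_trans _ _ (\sum_(i < m) h ^+ 2)).
  apply: ler_sum => i _; rewrite -[leLHS]ger0_norm ?sqr_ge0// normrX.
  by apply: lerXn2r; rewrite ?nnegrE.
rewrite sumr_const card_ord -[leLHS]mulr_natl exprMn; apply: ler_wpM2r; first exact: sqr_ge0.
by rewrite -natrX ler_nat -mulnn; case: (m) => // m'; exact: leq_pmulr.
Qed.

End euclidean.

Section coding.
Context {R : realType} {D : nat}.
Implicit Types (u v : seq {ffun 'I_D -> bool}) (y : nat -> {ffun 'I_D -> bool}) (x : 'rV[R]_D) (a : nat).

(** The bits along axis [i], read as a binary number, index the cube along that axis. *)
Definition position u i : nat := foldl (fun p t => (2 * p + (t : {ffun 'I_D -> bool}) i)%N) 0%N u.

Definition side a m : R := 2 * a.+1%:R * 2^-1 ^+ m.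

Definition corner a u : 'rV[R]_D := \row_i (- a.+1%:R + side a (size u) * (position u i)%:R).

(** Closed, so that nested cubes have a common point; a point on a face may then have several codes,
    and coverings by nodes have to catch all of them. *)
Definition cube a u : set 'rV[R]_D :=
  [set x | forall i, corner a u 0 i <= x 0 i <= corner a u 0 i + side a (size u)].

(* [codes a y x]: the point [x] of the window [-(a+1), a+1]^D has binary digits [y]. *)
Definition codes a y x := forall m, cube a (trunc y m) x.

Definition window a : set 'rV[R]_D := [set x | forall i, - a.+1%:R <= x 0 i <= a.+1%:R].

Definition digit a u x : {ffun 'I_D -> bool} :=
  [ffun i => corner a u 0 i + side a (size u).+1 <= x 0 i].

Lemma position_rcons u t i : position (rcons u t) i = (2 * position u i + t i)%N.
Proof. by rewrite /position foldl_rcons. Qed.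

Lemma side_gt0 a m : 0 < side a m.
Proof. by rewrite /side !mulr_gt0// ?exprn_gt0// invr_gt0. Qed.

Lemma sideS a m : side a m = 2 * side a m.+1.
Proof. by rewrite /side exprS; field. Qed.

Lemma side0 a : side a 0 = 2 * a.+1%:R.
Proof. by rewrite /side expr0 mulr1. Qed.

Lemma exp_le_side a m : 2^-1 ^+ m <= side a m.
Proof.
rewrite /side -[leLHS]mul1r ler_wpM2r ?exprn_ge0 ?invr_ge0//.
by rewrite -natrM ler1n.
Qed.

Lemma corner_rcons a u t i :
  corner a (rcons u t) 0 i = corner a u 0 i + (t i)%:R * side a (size u).+1.
Proof.
by rewrite !mxE size_rcons position_rcons (sideS a (size u)) natrD natrM; ring.
Qed.

Lemma cube_nil a : cube a [::] = window a.
Proof.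
apply/seteqP; split => x /= xi i; have := xi i; rewrite !mxE /= side0 mulr0 addr0 => /andP[x1 x2];
  by apply/andP; split; lra.
Qed.

Lemma cube_rcons a u t : cube a (rcons u t) `<=` cube a u.
Proof.
move=> x xu i; have := xu i; rewrite corner_rcons size_rcons (sideS a (size u)).
have := side_gt0 a (size u).+1; case: (t i) => /= s0 /andP[x1 x2]; apply/andP; split; lra.
Qed.

Lemma trunc_rcons (T : Type) (y : nat -> T) m : trunc y m.+1 = rcons (trunc y m) (y m).
Proof. by rewrite mkseqS. Qed.

Lemma cube_trunc a y m n : (m <= n)%N -> cube a (trunc y n) `<=` cube a (trunc y m).
Proof.
move=> /subnK <-; elim: (n - m)%N => // k IH x; rewrite addSn trunc_rcons.
by move=> /cube_rcons /IH.
Qed.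

Lemma cubeP a u x x' i : cube a u x -> cube a u x' -> `|x 0 i - x' 0 i| <= side a (size u).
Proof.
move=> /(_ i)/andP[x1 x2] /(_ i)/andP[x1' x2']; rewrite ler_norml.
by apply/andP; split; lra.
Qed.

Lemma side_small a e : 0 < e -> exists m, side a m < e.
Proof.
move=> e0; have [||m me] := @expr_small R 2^-1 (e / (2 * a.+1%:R)).
- by rewrite invr_ge0 ler0n invf_lt1 ?ltr1n.
- by rewrite divr_gt0// mulr_gt0.
by exists m; move: me; rewrite ltr_pdivlMr ?mulr_gt0// mulrC.
Qed.

Lemma codes_unique a y x x' : codes a y x -> codes a y x' -> x = x'.
Proof.
move=> yx yx'; apply/rowP => i; apply/eqP; rewrite -subr_eq0 -normr_le0.
apply/ler_addgt0Pr => e e0; rewrite add0r; have [m me] := side_small a e0.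
apply: le_trans (ltW me); have := cubeP i (yx m) (yx' m); by rewrite size_mkseq.
Qed.

Lemma cube_digit a u x : cube a u x -> cube a (rcons u (digit a u x)) x.
Proof.
move=> xu i; have := xu i; rewrite corner_rcons size_rcons (sideS a (size u)) ffunE.
by case: (leP (corner a u 0 i + side a (size u).+1) (x 0 i)) => /= h /andP[x1 x2]; apply/andP; split; lra.
Qed.

Lemma cell_digit a u x : (forall i, corner a u 0 i <= x 0 i < corner a u 0 i + side a (size u)) ->
  forall i, corner a (rcons u (digit a u x)) 0 i <= x 0 i <
     corner a (rcons u (digit a u x)) 0 i + side a (size (rcons u (digit a u x))).
Proof.
move=> xu i; have := xu i; rewrite corner_rcons size_rcons (sideS a (size u)) ffunE.
by case: (leP (corner a u 0 i + side a (size u).+1) (x 0 i)) => /= h /andP[x1 x2]; apply/andP; split; lra.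
Qed.

Fixpoint expansion a x m := if m is m'.+1 then rcons (expansion a x m') (digit a (expansion a x m') x) else [::].

Lemma size_expansion a x m : size (expansion a x m) = m.
Proof. by elim: m => //= m IH; rewrite size_rcons IH. Qed.

Lemma codes_surj a x : window a x -> exists y, codes a y x.
Proof.
move=> wx; exists (fun m => digit a (expansion a x m) x) => m.
have -> : trunc (fun m => digit a (expansion a x m) x) m = expansion a x m.
  by elim: m => //= m IH; rewrite trunc_rcons IH.
elim: m => [|m IH] /=; first by rewrite cube_nil.
exact: cube_digit.
Qed.

Lemma closed_cube a u : closed (cube a u).
Proof.
rewrite (_ : cube a u = box (corner a u) (\row_i (corner a u 0 i + side a (size u)))).
  exact: closed_box.
by apply/seteqP; split => x /= h i; have := h i; rewrite !mxE.
Qed.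

Lemma compact_window a : compact (window a).
Proof.
rewrite (_ : window a = [set x : 'rV[R]_D | forall i, `[- a.+1%:R, a.+1%:R]%classic (x ord0 i)]).
  by apply: (@rV_compact R D (fun=> `[- a.+1%:R, a.+1%:R]%classic)) => i; exact: segment_compact.
by apply/seteqP; split => x /= h i; have := h i; rewrite in_itv.
Qed.

Lemma codes_exists a y : exists x, codes a y x.
Proof.
apply: (@nested_compact _ (window a) (fun m => cube a (trunc y m))).
- exact: compact_window.
- by rewrite cube_nil.
- by move=> m; exact: closed_cube.
- by move=> m; exact: cube_trunc.
- move=> m; exists (corner a (trunc y m)) => i.
  by rewrite lexx lerDl ltW ?side_gt0.
Qed.

Lemma position_inj u v : size u = size v -> (forall i, position u i = position v i) -> u = v.
Proof.
elim/last_ind: u v => [|u t IH] v; first by case: v.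
case/lastP: v => [|v t']; rewrite !size_rcons // => -[suv] puv.
have h i : position u i = position v i /\ t i = t' i.
  by have := puv i; rewrite !position_rcons; case: (t i); case: (t' i); lia.
rewrite (IH v suv) => [|i]; last by have [] := h i.
by congr rcons; apply/ffunP => i; have [] := h i.
Qed.

(** Two cubes of side h containing points at coordinate distance at most C h have positions that
    differ by at most C + 1 along each axis, which leaves 2 C + 3 values. *)
Lemma node_count a (C : nat) m (Z : set 'rV[R]_D) :
  (forall x x' i, Z x -> Z x' -> `|x 0 i - x' 0 i| <= C%:R * side a m) ->
  exists V : seq (seq {ffun 'I_D -> bool}), [/\ (size V <= (2 * C + 3) ^ D)%N,
    forall v, v \in V -> size v = m & forall y x, Z x -> codes a y x -> trunc y m \in V].
Proof.
move=> ZC.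
have [[[y0 x0] /= [Zx0 yx0]]|none] := pselect (exists p, Z p.2 /\ codes a p.1 p.2); last first.
  by exists [::]; split => // y x Zx yx; exfalso; apply: none; exists (y, x).
pose p0 := position (trunc y0 m).
pose near (u : m.-tuple {ffun 'I_D -> bool}) :=
  [forall i, (position u i <= p0 i + C + 1)%N && (p0 i <= position u i + C + 1)%N].
exists [seq tval w | w <- enum near]; split.
- rewrite size_map -cardE.
  pose f (u : m.-tuple {ffun 'I_D -> bool}) : {ffun 'I_D -> 'I_(2 * C + 2).+1} :=
    [ffun i => inord (position u i + C + 1 - p0 i)%N].
  have finj : {in near &, injective f}.
    move=> u v /forallP nu /forallP nv /ffunP fuv; apply: val_inj => /=.
    apply: position_inj; first by rewrite !size_tuple.
    move=> i; have := fuv i; rewrite !ffunE => /(congr1 val) /=.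
    have /andP[u1 u2] := nu i; have /andP[v1 v2] := nv i.
    by rewrite !inordK; lia.
  rewrite -(card_in_image finj); apply: leq_trans (max_card _) _.
  by rewrite card_ffun !card_ord addn3 addn2.
- by move=> v /mapP[u _ ->]; rewrite size_tuple.
- move=> y x Zx yx; apply/mapP; exists [tuple y i | i < m]; last first.
    apply: (@eq_from_nth _ [ffun=> false]); rewrite size_mkseq ?size_tuple// => i im.
    by rewrite nth_mkseq// -[i]/(val (Ordinal im)) -tnth_nth tnth_mktuple.
  rewrite mem_enum; apply/forallP => i.
  have -> : val [tuple y i | i < m] = trunc y m.
    apply: (@eq_from_nth _ [ffun=> false]); rewrite size_tuple ?size_mkseq// => j jm.
    by rewrite nth_mkseq// -[j]/(val (Ordinal jm)) -tnth_nth tnth_mktuple.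
  have s0 := side_gt0 a m.
  have := yx m i; have := yx0 m i; have := ZC _ _ i Zx Zx0; rewrite !mxE !size_mkseq ler_norml.
  move=> /andP[d1 d2] /andP[x1 x2] /andP[z1 z2].
  have le_nat (p q : nat) : side a m * p%:R <= side a m * (q%:R) -> (p <= q)%N.
    by rewrite ler_pM2l// ler_nat.
  by apply/andP; split; apply: le_nat; rewrite !natrD mulrDr mulrDr mulr1 -/(p0 i); nra.
Qed.

End coding.

(** * Passage between coverings by sets and coverings by nodes *)

Section countable_covers.
Context {R : realType}.

Lemma nneseries_pickle (I : countType) (c : I -> \bar R) : (forall i, 0 <= c i)%E ->
  (\sum_(n <oo) oapp c 0 (pickle_inv n) = \esum_(i in [set: I]) c i)%E.
Proof.
move=> c0; have f0 n : (0 <= oapp c 0 (@pickle_inv I n))%E by case: pickle_inv.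
rewrite nneseries_esumT// (eq_esum (b := fun i => oapp c 0%E (pickle_inv (pickle i)))); last first.
  by move=> i _; rewrite pickleK_inv.
rewrite -[RHS](esum_image setT pickle (fun n => oapp c 0%E (@pickle_inv I n))); last first.
  by move=> i j _ _; exact: pcan_inj pickleK_inv _ _.
rewrite [RHS]esum_mkcond. apply: eq_esum => n _.
case: ifPn => // /negP nn; case E : (pickle_inv n) => [i|//].
by exfalso; apply: nn; rewrite inE; exists i => //; have := @pickle_invK I n; rewrite E.
Qed.

Lemma dyadic_null_count (I : countType) (T : Type) (dist : T -> T -> R) s (E : set T) :
  (forall e : R, 0 < e -> exists (U : I -> set T) (c : I -> \bar R),
    [/\ E `<=` \bigcup_i U i,
        forall i, (0 <= c i)%E /\ (U i !=set0 -> exists m : nat,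
          (forall x y, U i x -> U i y -> dist x y <= 2^-1 ^+ m) /\ ((rate s ^+ m)%:E <= c i)%E) &
        (\esum_(i in [set: I]) c i <= e%:E)%E]) ->
  dyadic_null dist s E.
Proof.
move=> H e /H[U [c [EU Uc ce]]].
exists (fun n => oapp U set0 (pickle_inv n)), (fun n => oapp c 0%E (pickle_inv n)).
rewrite nneseries_pickle => [|i]; last by have [] := Uc i.
split => //; split => [x /EU[i _ Ux]|n]; first by exists (pickle i); rewrite // pickleK_inv.
by case: pickle_inv => [i|] /=; [exact: Uc|split => // -[]].
Qed.

Lemma esum_seq (I : choiceType) (V : seq I) (f : I -> \bar R) : (forall i, 0 <= f i)%E ->
  (\esum_(i in [set: I]) (if i \in V then f i else 0) <= \sum_(i <- V) f i)%E.
Proof.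
move=> f0; elim: V => [|x V IH]; first by rewrite big_nil esum1.
rewrite big_cons; apply: le_trans (leeD (lexx _) IH).
apply: (@le_trans _ _ (\esum_(i in [set: I]) (if i \in [set x] then f i else 0) +
   \esum_(i in [set: I]) (if i \in V then f i else 0))%E); last first.
  by rewrite leeD2r// -esum_mkcond esum_set1.
rewrite -esumD; [|by move=> i _; case: ifP..].
apply: le_esum => i _; rewrite in_cons; case: eqVneq => [->|ix] /=.
  by rewrite mem_set//; case: ifP => _; rewrite ?adde0// leeDl.
case: ifP => iV; last by rewrite adde_ge0//; case: ifP.
by rewrite leeDr//; case: ifP.
Qed.

End countable_covers.

Section content_bounds.
Context {d : measure_display} {S : measurableType d} {R : realType} {T : finType}.
Variables (mu : {measure set S -> \bar R}) (r : R).
Hypothesis r_ge0 : 0 <= r.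

Lemma content_le_seq l (X : set S) (V : seq (seq T)) (E : set (S * (nat -> T))) : measurable X ->
  (forall v, v \in V -> (l <= size v)%N) ->
  (forall p, E p -> X p.1 /\ exists m, trunc p.2 m \in V) ->
  (content mu r l E <= \sum_(v <- V) (r ^+ size v)%:E * mu X)%E.
Proof.
move=> mX lV EV; pose A v := if v \in V then X else set0.
have cA : tree_cover l A E.
  split => [v|v vl|p /EV[Xp [m pV]]]; rewrite /A; first by case: ifP.
    by case: ifPn => // /lV; rewrite leqNgt vl.
  by exists m; rewrite pV.
apply: le_trans (content_le mu r cA) _.
have f0 (v : seq T) : (0 <= (r ^+ size v)%:E * mu X)%E.
  by apply: mule_ge0 => //; rewrite lee_fin exprn_ge0.
apply: le_trans (esum_seq V f0); apply: le_esum => v _.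
by rewrite /A; case: ifP => _ //; rewrite measure0 mule0.
Qed.

End content_bounds.

Section nodes.
Context {R : realType} {D : nat}.
Implicit Types (a l : nat) (s : R) (E : set 'rV[R]_D).

Definition preimage_codes (S : Type) a (E : set (S * 'rV[R]_D)) : set (S * (nat -> {ffun 'I_D -> bool})) :=
  [set p | exists2 x, E (p.1, x) & codes a p.2 x].

Lemma eucl_dist_cube a (v : seq {ffun 'I_D -> bool}) x y : cube a v x -> cube a v y ->
  @eucl_dist R D x y <= D%:R * side a (size v).
Proof. by move=> vx vy; apply: eucl_dist_le => [|i]; [exact/ltW/side_gt0|exact: cubeP]. Qed.

(** A cube of generation m has diameter at most 2^(K - m) for a constant [K]; shifting scales by [K]
    multiplies the weight by a constant. *)
Lemma nodes_dyadic_null a s E : 0 < s ->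
  (forall e : R, 0 < e -> exists P : set (seq {ffun 'I_D -> bool}),
     (\esum_(v in P) (rate s ^+ size v)%:E <= e%:E)%E /\
     forall x, E x -> exists2 v, P v & cube a v x) ->
  dyadic_null (@eucl_dist R D) s E.
Proof.
move=> s0 H; have r0 := rate_gt0 s; have r1 := rate_lt1 s0.
have [K DK] : exists K, (D * 2 * a.+1)%:R <= 2 ^+ K :> R.
  exists (D * 2 * a.+1)%N; rewrite -natrX ler_nat; exact/ltnW/ltn_expl.
apply: (@dyadic_null_count _ (seq {ffun 'I_D -> bool})) => e e0.
(* A total of at most [rate s ^+ K] forces all nodes to have size at least [K], so that [size v - K]
   is not truncated. *)
have e'0 : 0 < Num.min e 1 * rate s ^+ K by rewrite mulr_gt0 ?exprn_gt0// lt_min e0 ltr01.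
have [P [Pe EP]] := H _ e'0.
have PK v : P v -> (K <= size v)%N.
  move=> Pv; rewrite -(ler_iXn2l r0 r1) -lee_fin; apply: le_trans (le_trans Pe _).
    apply: esum_ge; exists [set v]; last by rewrite fsbig_set1.
    by split; [exact: finite_set1|move=> _ ->].
  by rewrite lee_fin ler_piMl ?exprn_ge0 ?rate_ge0// ge_min lexx orbT.
exists (fun v => if v \in P then cube a v else set0),
  (fun v => if v \in P then (rate s ^+ (size v - K))%:E else 0%E); split.
- move=> x /EP[v Pv vx]; exists v => //=; by rewrite mem_set.
- move=> v; split; first by case: ifP => // _; rewrite lee_fin exprn_ge0// ltW.
  case: ifPn => [|_ []//]; rewrite inE => Pv _; exists (size v - K)%N; split => //.
  move=> x y vx vy; apply: le_trans (eucl_dist_cube vx vy) _.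
  have := PK v Pv; set n := size v => Kn.
  have -> : 2^-1 ^+ (n - K) = 2 ^+ K * 2^-1 ^+ n :> R.
    rewrite -[in RHS](subnK Kn) exprD mulrCA exprVn mulrA mulrAC -mulrA.
    by rewrite exprVn [X in _ * X]mulVf ?mulr1// expf_neq0// pnatr_eq0.
  rewrite /side mulrA; apply: ler_wpM2r; first by rewrite exprn_ge0// invr_ge0.
  by rewrite mulrA -!natrM.
- rewrite -esum_mkcond.
  rewrite (eq_esum (b := fun v => ((rate s ^+ K)^-1%:E * (rate s ^+ size v)%:E)%E)); last first.
    move=> v Pv; rewrite -EFinM; congr EFin.
    by rewrite -[in RHS](subnK (PK v Pv)) exprD mulrCA mulVf ?mulr1// expf_neq0// gt_eqF.
  have K0 : 0 < rate s ^+ K by rewrite exprn_gt0.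
  apply: (@le_trans _ _ ((rate s ^+ K)^-1%:E * \esum_(v in P) (rate s ^+ size v)%:E)%E).
    apply: ge_ereal_sup => _ [X [finX XP] <-].
    rewrite -ge0_mule_fsumr; last by move=> v; rewrite lee_fin exprn_ge0// ltW.
    apply: lee_pmul => //.
    - by rewrite lee_fin invr_ge0 ltW.
    - by apply: fsume_ge0 => v _; rewrite lee_fin exprn_ge0// ltW.
    - by apply: esum_ge; exists X.
  apply: (@le_trans _ _ ((rate s ^+ K)^-1%:E * (Num.min e 1 * rate s ^+ K)%:E)%E).
    apply: lee_pmul => //; first by rewrite lee_fin invr_ge0 ltW.
    by apply: esum_ge0 => v _; rewrite lee_fin exprn_ge0// ltW.
  by rewrite -EFinM lee_fin mulrCA mulVf ?gt_eqF// mulr1 ge_min lexx.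
Qed.

(** A set of diameter 2^-m spreads over at most one side of generation m, so [node_count] with C = 1
    replaces it by at most 5^D nodes. *)
Lemma dyadic_null_nodes a l s E (e : R) : 0 < s -> 0 < e -> dyadic_null (@eucl_dist R D) s E ->
  exists V : nat -> seq (seq {ffun 'I_D -> bool}), [/\
    forall i v, v \in V i -> (l <= size v)%N,
    (\sum_(i <oo) \sum_(v <- V i) (rate s ^+ size v)%:E <= e%:E)%E &
    forall x y, E x -> codes a y x -> exists i m, trunc y m \in V i].
Proof.
move=> s0 e0 nE; have r0 := rate_gt0 s.
have N0 : 0 < (5 ^ D)%:R :> R by rewrite ltr0n expn_gt0.
have [U [c [EU c0 ce Uc]]] := dyadic_null_fine l s0 (divr_gt0 e0 N0) nE.
have /choice[V VP] i : exists V : seq (seq {ffun 'I_D -> bool}), [/\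
    forall v, v \in V -> (l <= size v)%N, (\sum_(v <- V) (rate s ^+ size v)%:E <= (5 ^ D)%:R%:E * c i)%E &
    forall x y, U i x -> codes a y x -> exists m, trunc y m \in V].
  have [Ui0|/set0P /Uc[m [lm dm mc]]] := eqVneq (U i) set0.
    exists [::]; split => [//||x y]; last by rewrite Ui0.
    by rewrite big_nil; apply: mule_ge0 => //.
  have [|V [sV Vm UV]] := @node_count R D a 1 m (U i).
    move=> x x' j Ux Ux'; rewrite mul1r; apply: le_trans (exp_le_side a m).
    exact: le_trans (coord_le_eucl_dist _ _ _) (dm _ _ Ux Ux').
  exists V; split => [v /Vm ->//||x y Ux yx]; last by exists m; exact: (UV _ _ Ux yx).
  rewrite big_seq (eq_bigr (fun=> (rate s ^+ m)%:E)); last by move=> v /Vm ->.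
  rewrite -big_seq sumEFin big_const_seq count_predT iter_addr_0 -[X in (X%:E <= _)%E]mulr_natl.
  apply: (@le_trans _ _ ((5 ^ D)%:R * rate s ^+ m)%:E).
    by rewrite lee_fin ler_wpM2r ?exprn_ge0 ?rate_ge0// ler_nat.
  by rewrite EFinM lee_pmul// lee_fin ?exprn_ge0 ?rate_ge0.
exists V; split => [i v|| x y Ex yx].
- by have [+ _ _] := VP i; apply.
- apply: (@le_trans _ _ (\sum_(i <oo) (5 ^ D)%:R%:E * c i)%E).
    apply: lee_nneseries => [i _ _|i _]; last by have [] := VP i.
    by apply: sume_ge0 => v _; rewrite lee_fin exprn_ge0// ltW.
  rewrite nneseriesZl//; apply: (@le_trans _ _ ((5 ^ D)%:R%:E * (e / (5 ^ D)%:R)%:E)%E).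
    by apply: lee_pmul => //; exact: nneseries_ge0.
  by rewrite -EFinM lee_fin mulrCA divff ?gt_eqF// mulr1.
- by have [i _ Ux] := EU x Ex; exists i; have [_ _ /(_ x y Ux yx)] := VP i.
Qed.

End nodes.

(** * Slices of Borel sets *)

Lemma continuous_fst (X Y : topologicalType) : continuous (@fst X Y).
Proof. by move=> [x y]; exact: cvg_fst. Qed.

Lemma continuous_snd (X Y : topologicalType) : continuous (@snd X Y).
Proof. by move=> [x y]; exact: cvg_snd. Qed.

Section neighborhoods.
Context {R : realType} {n : nat}.
Implicit Types (a : nat) (v : seq {ffun 'I_n -> bool}).

(** Compactness of slices asks for open coverings. The enlarged cube is three sides wide, and
    [node_count] with C = 3 gives the constant 9^n. *)
Definition cube_nbhd a v : set 'rV[R]_n :=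
  [set x | forall i, corner a v 0 i - side a (size v) < x 0 i < corner a v 0 i + 2 * side a (size v)].

Lemma open_cube_nbhd a v : open (cube_nbhd a v).
Proof.
pose I i := `]corner a v 0 i - side a (size v), corner a v 0 i + 2 * side a (size v)[%classic : set R.
rewrite (_ : cube_nbhd a v =
    ~` \bigcup_(i in [set: 'I_n]) ~` ((fun x : 'rV[R]_n => x 0 i) @^-1` I i)).
  apply: closed_openC; apply: closed_bigcup => [|i _]; first exact: finite_finset.
  apply: open_closedC; apply: open_comp; last exact: interval_open.
  by move=> x _; exact: coord_continuous.
rewrite setC_bigcup; apply/seteqP; split => x /= h i; rewrite ?setCK; have := h i.
  by rewrite /I /= in_itv.
by rewrite setCK /I /= in_itv; exact.
Qed.

Lemma cube_sub_nbhd a v : cube a v `<=` cube_nbhd a v.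
Proof.
move=> x xv i; have := xv i; have := side_gt0 (R := R) a (size v) => s0 /andP[? ?].
by apply/andP; split; lra.
Qed.

Lemma nbhd_nodes a v : exists V : seq (seq {ffun 'I_n -> bool}),
  [/\ (size V <= 9 ^ n)%N, forall u, u \in V -> size u = size v &
      forall y x, cube_nbhd a v x -> codes a y x -> exists m, trunc y m \in V].
Proof.
have [|V [sV Vv Vy]] := @node_count R n a 3 (size v) (cube_nbhd a v).
  move=> x x' i /(_ i)/andP[x1 x2] /(_ i)/andP[x1' x2'].
  by rewrite ler_norml; apply/andP; split; lra.
by exists V; split => // y x vx yx; exists (size v); exact: (Vy _ _ vx yx).
Qed.

End neighborhoods.

Section null_slices.
Context {R : realType} {k n : nat}.
Let S := caratheodory_type (@lebesgue_mu R k).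

Definition lebesgue_meas : {measure set (caratheodory_type (@lebesgue_mu R k)) -> \bar R} := @lebesgue_mu R k.

Lemma measurable_closed (A : set 'rV[R]_k.+1) : closed A -> measurable (A : set S).
Proof.
move=> cA; rewrite -[A]setCK; apply: measurableC; apply: measurable_open.
exact: closed_openC.
Qed.

Lemma window_volume_lty a : (lebesgue_outer (window a : set 'rV[R]_k.+1) < +oo)%E.
Proof.
rewrite (_ : window a = box (const_mx (- a.+1%:R)) (const_mx a.+1%:R)).
  apply: le_lt_trans (lebesgue_outer_box _) _; last exact: ltry.
  by move=> i; rewrite !mxE -subr_ge0 opprK addr_ge0.
by apply/seteqP; split => x /= h i; have := h i; rewrite !mxE.
Qed.

Lemma closed_window m a : closed (window a : set 'rV[R]_m).
Proof. by rewrite -cube_nil; exact: closed_cube. Qed.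

Lemma contentU d (S' : measurableType d) (T : finType) (mu : {measure set S' -> \bar R}) (r : R) l
    (E F : set (S' * (nat -> T))) : 0 <= r ->
  (content mu r l (E `|` F) <= content mu r l E + content mu r l F)%E.
Proof.
move=> r0.
pose G i := if i is 0%N then E else if i is 1%N then F else set0.
have c0 : content mu r l (set0 : set (S' * (nat -> T))) = 0%E.
  apply/eqP; rewrite eq_le content_ge0// andbT.
  by apply: le_trans (content_le_seq (X := set0) (V := [::]) _ _ _ _ _) _; rewrite ?big_nil// => p [].
have := content_sigma_subadditive mu r0 l G.
rewrite (_ : \bigcup_i G i = E `|` F); last first.
  apply/seteqP; split => [x [[|[|i]] _ //]|x [Ex|Fx]]; [by left|by right| |].
    by exists 0%N.
  by exists 1%N.
move/le_trans; apply.
rewrite (@nneseries_split _ _ 0 2); last by move=> *; exact: content_ge0.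
rewrite eseries0; last by move=> [|[|i]].
by rewrite adde0 big_nat_recr//= big_nat1.
Qed.

Definition all_nodes (T : finType) l : seq (seq T) := [seq tval w | w <- enum {: l.-tuple T}].

Lemma mem_all_nodes (T : finType) l (v : seq T) : (v \in all_nodes T l) = (size v == l).
Proof.
apply/mapP/eqP => [[w _ ->]|<-]; first exact: size_tuple.
by exists (in_tuple v); rewrite ?mem_enum.
Qed.

(* If the content were positive, capacitability would give compact sets decreasing into [B], all of content
   above some [c]. By compactness of the slices, over most [t] one of countably many finite families of nodes, of
   weight at most [delta], covers the slice of a single such compact set, whose content is then below [c]. *)
Lemma content_null_slices (a l : nat) (s : R) (B : set ('rV[R]_k.+1 * 'rV[R]_n)) (N : set 'rV[R]_k.+1) :
  0 < s -> borel_set B -> (forall p, B p -> window a p.1 /\ window a p.2) ->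
  lebesgue_outer N = 0%E ->
  (forall t, ~ N t -> dyadic_null (@eucl_dist R n) s (xsection B t)) ->
  content lebesgue_meas (rate s) l (preimage_codes a B) = 0%E.
Proof.
move=> s0 bB Bw N0 Bnull; have r0 := rate_ge0 s.
apply/eqP; rewrite eq_le content_ge0// andbT leNgt; apply/negP => cpos.
have [c c0 Bc] : exists2 c : R, 0 < c & (c%:E < content lebesgue_meas (rate s) l (preimage_codes a B))%E.
  have := cpos; case: (content _ _ _ _) => [x||//]; last by exists 1; rewrite ?ltry.
  by rewrite lte_fin => x0; exists (x / 2); rewrite ?divr_gt0// lte_fin; lra.
have [F [BF FB]] : souslin B by apply: borel_souslin bB => U; exact: (@open_bigcup_closed R).
pose big (E : set ('rV[R]_k.+1 * 'rV[R]_n)) := (c%:E < content lebesgue_meas (rate s) l (preimage_codes a E))%E.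
have [||tau bigtau] := @souslin_capacity _ F big.
- move=> E Einc bigE; apply: contrapT => /forallNP nE.
  suff le_c : (content lebesgue_meas (rate s) l (preimage_codes a (\bigcup_i E i)) <= c%:E)%E.
    by move: bigE; rewrite /big ltNge le_c.
  rewrite (_ : preimage_codes _ _ = \bigcup_i preimage_codes a (E i)).
    apply: content_nondecreasing => // [i p [x /Einc Ex yx]|i]; first by exists x.
    by rewrite leNgt; apply/negP; exact: nE.
  apply/seteqP; split => [p [x [i _ Ex] yx]|p [i _ [x Ex yx]]]; first by exists i => //; exists x.
  by exists x => //; exists i.
- by rewrite -BF.
pose K m := closure (dominated F tau m).
pose W := (window a : set 'rV[R]_k.+1) `*` (window a : set 'rV[R]_n).
have cW : compact W by apply: compact_setX; exact: compact_window.
have clW : closed W by apply: compact_closed cW; exact: norm_hausdorff.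
have KW m : K m `<=` W.
  rewrite /K (closure_id W).1//; apply: closureS => p /(dominated_sub (conj BF FB)).
  exact: Bw.
have clK m : closed (K m) by exact: closed_closure.
have KS m : K m.+1 `<=` K m by apply: closureS; exact: dominatedS.
have cK m : compact (K m) by apply: subclosed_compact cW _.
have KB : \bigcap_m K m `<=` B by exact: FB.
have N9 : 0 < (9 ^ n)%:R :> R by rewrite ltr0n expn_gt0.
pose vol := fine (lebesgue_outer (window a : set 'rV[R]_k.+1)) + 1.
have volE : (lebesgue_outer (window a : set 'rV[R]_k.+1) <= vol%:E)%E.
  rewrite -[leLHS]fineK ?ge0_fin_numE ?lebesgue_outer_ge0 ?window_volume_lty//.
  by rewrite lee_fin lerDl.
have vol0 : 0 < vol by rewrite ltr_wpDl// fine_ge0// lebesgue_outer_ge0.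
(* Families of weight [delta] cost at most [c / 2] in all: 9^n for passing from neighbourhoods to
   nodes, [vol] for the measure of the parameters. *)
pose delta := c / 2 / ((9 ^ n)%:R * vol).
have delta0 : 0 < delta by rewrite !divr_gt0// mulr_gt0.
have /choice[NV NVP] := @nbhd_nodes R n a.
pose nbF (f : seq (seq {ffun 'I_n -> bool})) : set 'rV[R]_n :=
  \bigcup_(v in [set v | v \in f]) cube_nbhd a v.
have open_nbF f : open (nbF f) by apply: bigcup_open => v _; exact: open_cube_nbhd.
pose fam i : seq (seq {ffun 'I_n -> bool}) := odflt [::] (unpickle i).
pose good (f : seq (seq {ffun 'I_n -> bool})) := (forall v, v \in f -> (l <= size v)%N) /\ (\sum_(v <- f) (rate s ^+ size v)%:E <= delta%:E)%E.
(* The slice of [K m] escapes [f] over these parameters. As a projection of a compact set, [bad m f]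
   is closed, hence measurable. *)
pose bad m f : set 'rV[R]_k.+1 := fst @` (K m `&` [set p | ~ nbF f p.2]).
have clbad m f : closed (bad m f).
  apply: compact_closed; first exact: norm_hausdorff.
  apply: continuous_compact; first by apply: continuous_subspaceT => p; exact: continuous_fst.
  apply: compact_closedI => //; apply: open_closedC.
  by apply: (@open_comp _ _ snd) => // p _; exact: continuous_snd.
pose G m i : set S := if `[< good (fam i) >] then ~` bad m (fam i) else set0.
have mG m i : measurable (G m i).
  by rewrite /G; case: ifP => _ //; apply: measurableC; exact: measurable_closed.
have mW : measurable (window a : set S) by apply: measurable_closed; exact: closed_window.
(* No cheap finite family covers the slice of [K m] over these parameters. The sets decrease into
   the null set [N], so their measures tend to 0. *)
pose U m : set S := window a `\` \bigcup_i G m i.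
have mU m : measurable (U m) by apply: measurableD => //; exact: bigcup_measurable.
have capU : \bigcap_m U m `<=` N.
  move=> t Ut; apply: contrapT => /Bnull nBt.
  have [V [lV Vd BV]] := dyadic_null_nodes a l s0 delta0 nBt.
  (* What the first [j] families leave of the slice of [K j] decreases with empty intersection, so
     compactness makes it empty for some [j]. *)
  pose C j := K j `&` [set p | p.1 = t] `&` ~` [set p | exists2 i, (i < j)%N & nbF (V i) p.2].
  have [j Cj] : exists j, C j = set0.
    apply: contrapT => /forallNP Cn.
    have [||||p Cp] := @nested_compact _ W C cW.
    - by move=> p [[/KW]].
    - move=> j; apply: closedI; first apply: closedI => //.
        rewrite (_ : [set p | p.1 = t] = fst @^-1` [set t])//; apply: preimage_closed => [p _|]; first exact: continuous_fst.
        by apply: accessible_closed_set1; apply: hausdorff_accessible; exact: norm_hausdorff.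
      apply: open_closedC.
      rewrite (_ : [set p | _] = \bigcup_(i in `I_j) (snd @^-1` nbF (V i))).
        apply: bigcup_open => i _; apply: open_comp => // p _; exact: continuous_snd.
      by apply/seteqP; split => p [i /=]; exists i.
    - move=> j p [[/KS Kp pt] np]; split => // -[i ij Vp]; apply: np; exists i => //.
      exact: ltnW.
    - by move=> j; apply/set0P/eqP; exact: Cn.
    have Bp : B p by apply: KB => m _; have [[]] := Cp m.
    have pt : p.1 = t by have [[]] := Cp 0%N.
    have [y yp] : exists y, codes a y p.2 by apply: codes_surj; have [] := Bw p Bp.
    have [|i [m Vy]] := BV p.2 y _ yp; first by apply/xsectionP; rewrite -pt -surjective_pairing.
    have [_ /(_ _)] := Cp i.+1; apply; exists i => //; exists (trunc y m) => //.
    exact/cube_sub_nbhd/yp.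
  pose f := flatten [seq V i | i <- iota 0 j].
  have gf : good f.
    split=> [v /flatten_mapP[i _ /lV]//|].
    rewrite big_flatten /= big_map; apply: le_trans Vd.
    rewrite -[in iota 0 j](subn0 j) -/(index_iota 0 j).
    apply: nneseries_lim_ge => i _ _; apply: sume_ge0 => v _.
    by rewrite lee_fin exprn_ge0.
  have [wt] := Ut j I; apply; exists (pickle f) => //.
  rewrite /G /fam pickleK /= ifT; last exact/asboolP.
  move=> [p [Kp /= np] pt]; suff : C j p by rewrite Cj.
  split; first by split.
  move=> [i ij [v Vv pv]]; apply: np; exists v => //=.
  by apply/flatten_mapP; exists i => //; rewrite mem_iota.
have USm m : U m.+1 `<=` U m.
  move=> t [wt nt]; split => // -[i _ Gi]; apply: nt; exists i => //; move: Gi.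
  rewrite /G; case: ifP => // _ nb [p [/KS Kp np] pt]; apply: nb; by exists p.
(* Over the exceptional parameters all nodes of generation [l] are used; with this [eta] they weigh
   at most [c / 2]. *)
pose eta := c / 2 / (size (all_nodes {ffun 'I_n -> bool} l)).+1%:R.
have eta0 : 0 < eta by rewrite !divr_gt0.
have [m Um] : exists m, (lebesgue_meas (U m) < eta%:E)%E.
  have U0 : lebesgue_meas (\bigcap_m U m) = 0%E.
    apply/eqP; rewrite eq_le measure_ge0 andbT -[leRHS]N0.
    exact: le_lebesgue_outer.
  have cvgU : lebesgue_meas (U m) @[m --> \oo] --> lebesgue_meas (\bigcap_m U m).
    apply: nonincreasing_cvg_mu => //.
    - apply: le_lt_trans (window_volume_lty a); apply: le_lebesgue_outer; exact: subDsetl.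
    - by apply: bigcap_measurableType => m _; exact: mU.
    - by apply/nonincreasing_seqP => m; apply/subsetPset; exact: USm.
  apply: contrapT => /forallNP nU.
  suff : (eta%:E <= 0 :> \bar R)%E by rewrite lee_fin leNgt eta0.
  rewrite -U0; apply: cvge_ge cvgU; apply: nearW => m.
  by rewrite leNgt; apply/negP; exact: nU.
have := bigtau m; rewrite /big ltNge => /negP; apply.
(* Each remaining parameter goes to the first good family that works, which gives disjoint
   measurable pieces. *)
pose Dm i := seqDU (fun i => G m i `&` window a) i.
have mDm i : measurable (Dm i : set S).
  apply: measurableD; first exact: measurableI.
  by apply: bigsetU_measurable => j _; exact: measurableI.
pose E := preimage_codes a (dominated F tau m).
pose Ei i := E `&` [set p | Dm i p.1].
pose E' := E `&` [set p | U m p.1].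
apply: (@le_trans _ _ (content lebesgue_meas (rate s) l (E' `|` \bigcup_i Ei i))).
  apply: le_content => p Ep.
  have wp : window a p.1 by have [x /(dominated_sub (conj BF FB)) /Bw[]] := Ep.
  have [Gp|nGp] := pselect ((\bigcup_i G m i) p.1); last by left.
  right; have : (\bigcup_i (G m i `&` window a)) p.1 by case: Gp => i _ Gp; exists i.
  by rewrite seqDU_bigcup_eq => -[i _ ?]; exists i.
apply: le_trans (contentU _ _ _ _ r0) _.
have -> : c = c / 2 + c / 2 by lra.
rewrite EFinD; apply: leeD.
  apply: le_trans (@content_le_seq _ _ _ _ lebesgue_meas _ r0 l (U m) (all_nodes _ l) E' (mU m) _ _) _.
  - by move=> v; rewrite mem_all_nodes => /eqP ->.
  - by move=> p [_ Up]; split => //; exists l; rewrite mem_all_nodes size_mkseq.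
  apply: (@le_trans _ _ (\sum_(v <- all_nodes {ffun 'I_n -> bool} l) eta%:E)%E).
    apply: lee_sum => v _; rewrite -[leRHS]mul1e; apply: lee_pmul => //.
    - by rewrite lee_fin exprn_ge0.
    - by rewrite lee_fin exprn_ile1// ltW// rate_lt1.
    - exact: ltW.
  rewrite sumEFin big_const_seq count_predT iter_addr_0 lee_fin -[leLHS]mulr_natl.
  rewrite /eta mulrCA ler_piMr//; first by rewrite divr_ge0// ltW.
  by rewrite ler_pdivrMr// mul1r ler_nat.
apply: le_trans (content_sigma_subadditive _ r0 _ _) _.
apply: (@le_trans _ _ (\sum_(i <oo) (delta * (9 ^ n)%:R)%:E * lebesgue_meas (Dm i))%E).
  apply: lee_nneseries => [i _ _|i _]; first exact: content_ge0.
  have [gi|ngi] := pselect (good (fam i)); last first.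
    apply: le_trans (@content_le_seq _ _ _ _ lebesgue_meas _ r0 l (Dm i) [::] (Ei i) (mDm i) _ _) _ => //.
      move=> p [_] [[+ _] _]; rewrite /G ifF//; exact/asboolPn.
    by rewrite big_nil mule_ge0// lee_fin mulr_ge0// ltW.
  have [li di] := gi.
  apply: le_trans (@content_le_seq _ _ _ _ lebesgue_meas _ r0 l (Dm i) (flatten [seq NV v | v <- fam i]) (Ei i) (mDm i) _ _) _.
  - move=> u /flatten_mapP[v vi uv]; have [_ /(_ u uv) -> _] := NVP v; exact: li.
  - move=> p [[x Fx yx] Dp]; split => //.
    have [[Gp _] _] := Dp; move: Gp; rewrite /G ifT; last exact/asboolP.
    move=> nbad; have [v vi xv] : nbF (fam i) x.
      apply: contrapT => nx; apply: nbad; exists (p.1, x) => //; split => //.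
      exact: subset_closure.
    have [_ _ /(_ _ _ xv yx)[m' m'V]] := NVP v.
    by exists m'; apply/flatten_mapP; exists v.
  rewrite -ge0_sume_distrl; last by move=> v _; rewrite lee_fin exprn_ge0.
  apply: lee_pmul => //; first by apply: sume_ge0 => v _; rewrite lee_fin exprn_ge0.
  rewrite big_flatten big_map /= mulrC EFinM.
  apply: (@le_trans _ _ (\sum_(v <- fam i) (9 ^ n)%:R%:E * (rate s ^+ size v)%:E)%E).
    apply: lee_sum => v _; have [sV Vu _] := NVP v.
    rewrite big_seq (eq_bigr (fun=> (rate s ^+ size v)%:E)); last by move=> u /Vu ->.
    rewrite -big_seq sumEFin big_const_seq count_predT iter_addr_0 -[X in (X%:E <= _)%E]mulr_natl.
    by rewrite -EFinM lee_fin ler_wpM2r ?exprn_ge0// ler_nat.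
  rewrite -ge0_sume_distrr; last by move=> v _; rewrite lee_fin exprn_ge0.
  by apply: lee_pmul => //; apply: sume_ge0 => v _; rewrite lee_fin exprn_ge0.
rewrite nneseriesZl//.
have -> : (\sum_(i <oo) lebesgue_meas (Dm i) = lebesgue_meas (\bigcup_i Dm i))%E.
  rewrite measure_bigcup//; first by apply: eq_eseriesl => i; rewrite in_setT.
  exact: trivIset_seqDU.
apply: (@le_trans _ _ ((delta * (9 ^ n)%:R)%:E * vol%:E)%E).
  apply: lee_pmul => //; first by rewrite lee_fin mulr_ge0// ltW.
  apply: le_trans volE; apply: le_lebesgue_outer => t [i _ [[_ wt] _]]; exact: wt.
rewrite -EFinM lee_fin le_eqVlt; apply/orP; left; apply/eqP.
rewrite /delta -[LHS]mulrA divfK// mulf_neq0// gt_eqF//.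
Qed.

End null_slices.

(** * Borel sets, geometric series and Borel-Cantelli *)

Section borel.
Context {X : topologicalType}.
Implicit Types A B : set X.

Lemma borel_open A : open A -> borel_set A.
Proof. by move=> oA; apply: sub_sigma_algebra. Qed.

Lemma borelC A : borel_set A -> borel_set (~` A).
Proof. by move=> bA; rewrite -setTD; exact: sigma_algebraCD. Qed.

Lemma borel_closed A : closed A -> borel_set A.
Proof. by move=> cA; rewrite -[A]setCK; apply: borelC; apply: borel_open; exact: closed_openC. Qed.

Lemma borel_bigcup (A : nat -> set X) : (forall i, borel_set (A i)) -> borel_set (\bigcup_i A i).
Proof. exact: sigma_algebra_bigcup. Qed.

Lemma borel_bigcap (A : nat -> set X) : (forall i, borel_set (A i)) -> borel_set (\bigcap_i A i).
Proof.
move=> bA; rewrite -[\bigcap_i _]setCK setC_bigcap; apply: borelC.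
by apply: borel_bigcup => i; exact: borelC.
Qed.

Lemma borelU A B : borel_set A -> borel_set B -> borel_set (A `|` B).
Proof.
move=> bA bB; rewrite (_ : A `|` B = \bigcup_i (if i is 0%N then A else B)).
  by apply: borel_bigcup => -[].
apply/seteqP; split => [x [Ax|Bx]|x [[|i] _ ?]]; [by exists 0%N|by exists 1%N|by left|by right].
Qed.

Lemma borelI A B : borel_set A -> borel_set B -> borel_set (A `&` B).
Proof.
by move=> bA bB; rewrite -[A `&` B]setCK setCI; apply: borelC; apply: borelU; exact: borelC.
Qed.

Lemma borelD A B : borel_set A -> borel_set B -> borel_set (A `\` B).
Proof. by move=> bA bB; rewrite setDE; apply: borelI => //; exact: borelC. Qed.

End borel.

Section geometric.
Context {R : realType}.
Implicit Types (q C e : R).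

Lemma nneseries_geometric_le q C : 0 <= q < 1 -> 0 <= C ->
  (\sum_(j <oo) (C * q ^+ j)%:E <= (C / (1 - q))%:E)%E.
Proof.
move=> /andP[q0 q1] C0; have q1' : 0 < 1 - q by rewrite subr_gt0.
apply: lime_le; first by apply: is_cvg_nneseries => j _ _; rewrite lee_fin mulr_ge0// exprn_ge0.
apply: nearW => n; rewrite sumEFin lee_fin big_mkord -mulr_sumr ler_pdivlMr// -mulrA ler_piMr//.
have := subrX1 q n; rewrite -[X in _ = X * _]opprB mulNr => /eqP; rewrite -eqr_oppLR => /eqP; rewrite opprB mulrC => <-.
by rewrite lerBlDr lerDl exprn_ge0.
Qed.

Lemma geometric_tail q C e : 0 <= q < 1 -> 0 <= C -> 0 < e ->
  exists J : nat, (\sum_(j <oo) (C * q ^+ (J + j))%:E <= e%:E)%E.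
Proof.
move=> /andP[q0 q1] C0 e0; have q1' : 0 < 1 - q by rewrite subr_gt0.
have [||J Je] := @expr_small _ q (e * (1 - q) / (C + 1)); first by rewrite q0.
  by rewrite divr_gt0 ?mulr_gt0// ltr_wpDl.
exists J; rewrite (@eq_eseriesr _ _ (fun j => ((C * q ^+ J) * q ^+ j)%:E)); last first.
  by move=> j _; rewrite exprD mulrA.
apply: le_trans (nneseries_geometric_le _ _) _; rewrite ?q0 ?mulr_ge0 ?exprn_ge0//.
rewrite lee_fin ler_pdivrMr//; move: Je; rewrite ltr_pdivlMr; last by rewrite ltr_wpDl.
by move=> /ltW; apply: le_trans; rewrite mulrC ler_wpM2l ?exprn_ge0// lerDl.
Qed.

Lemma nneseries_if (N : nat) (x : R) : 0 <= x ->
  (\sum_(i <oo) (if (i < N)%N then x%:E else 0) = (N%:R * x)%:E)%E.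
Proof.
move=> x0; rewrite (@nneseries_split _ _ 0 N); last by move=> i _; case: ifP.
rewrite add0n eseries0 ?adde0; last by move=> i Ni _; rewrite ltnNge Ni.
rewrite big_mkord (eq_bigr (fun=> x%:E)) => [|i _]; last by rewrite ltn_ord.
by rewrite sumEFin sumr_const card_ord mulr_natl.
Qed.

Lemma dyadic_null_lists (I : eqType) (T : Type) (dist : T -> T -> R) s (E : set T) (U : I -> set T) :
  (forall e : R, 0 < e -> exists (V : nat -> seq I) (m : nat -> nat),
    [/\ forall x, E x -> exists j i, i \in V j /\ U i x,
        forall j i, i \in V j -> forall x y, U i x -> U i y -> dist x y <= 2^-1 ^+ m j &
        (\sum_(j <oo) ((size (V j))%:R * rate s ^+ m j)%:E <= e%:E)%E]) ->
  dyadic_null dist s E.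
Proof.
move=> H e /H[V [m [EV Vm Ve]]]; have [f fsurj fsum] := nat_pairing R.
pose W j i := nth set0 [seq U v | v <- V j] i.
pose c j i : \bar R := if (i < size (V j))%N then (rate s ^+ m j)%:E else 0%E.
have c0 j i : (0 <= c j i)%E by rewrite /c; case: ifP => // _; rewrite lee_fin exprn_ge0// rate_ge0.
exists (fun p => W (f p).1 (f p).2), (fun p => c (f p).1 (f p).2); split; last first.
  rewrite fsum//; apply: le_trans Ve; apply: lee_nneseries => [j _ _|j _]; first exact: nneseries_ge0.
  by rewrite /c nneseries_if// exprn_ge0// rate_ge0.
split => [x /EV[j [i [iV Ux]]]|p]; last split => //.
  have [p fp] := fsurj (j, index i (V j)); exists p => //; rewrite fp /W /=.
  by rewrite (nth_map i) ?index_mem// nth_index.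
case: (f p) => j i /=; rewrite /W /c; case: ltnP => [iV|Vi]; last first.
  by rewrite nth_default ?size_map// => -[].
move=> [x Ux]; have [i0 _] : exists i0 : I, i0 \in V j by case: (V j) iV => // v ? _; exists v; rewrite mem_head.
exists (m j); split => //; rewrite (nth_map i0)//; apply: Vm; exact: mem_nth.
Qed.

End geometric.

Section outer.
Context {R : realType} {k : nat}.

Lemma lebesgue_outer_seq (I : eqType) (V : seq I) (A : I -> set 'rV[R]_k.+1) :
  (lebesgue_outer (\bigcup_(i in [set` V]) A i) <= \sum_(i <- V) lebesgue_outer (A i))%E.
Proof.
elim: V => [|v V IH]; first by rewrite set_nil bigcup_set0 lebesgue_outer0 big_nil.
rewrite big_cons; apply: le_trans (leeD (lexx _) IH).
apply: le_trans (outer_measureU2 (@lebesgue_mu R k) _ _); apply: le_lebesgue_outer.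
move=> x [i /=]; rewrite in_cons => /predU1P[->|iV] Ax; [by left|by right; exists i].
Qed.

(** Borel-Cantelli: the tails of the geometric series tend to 0. *)
Lemma lebesgue_outer_limsup (L : nat -> set 'rV[R]_k.+1) (A : set 'rV[R]_k.+1) (q C : R) :
  0 <= q < 1 -> 0 <= C -> (forall j, lebesgue_outer (L j) <= (C * q ^+ j)%:E)%E ->
  (forall J x, A x -> exists2 j, (J <= j)%N & L j x) -> lebesgue_outer A = 0%E.
Proof.
move=> q01 C0 Lq AL; apply/eqP; rewrite eq_le lebesgue_outer_ge0 andbT.
apply/lee_addgt0Pr => e e0; rewrite add0e; have [J Je] := geometric_tail q01 C0 e0.
apply: le_trans Je; apply: (@le_trans _ _ (\sum_(j <oo) lebesgue_outer (L (J + j)%N))%E); last first.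
  by apply: lee_nneseries => [j *|j _]; [exact: lebesgue_outer_ge0|exact: Lq].
apply: le_trans (lebesgue_outer_sigma_subadditive _); apply: le_lebesgue_outer => x /(AL J)[j Jj Lx].
by exists (j - J)%N => //; rewrite subnKC.
Qed.

End outer.

Lemma bigcup_mem_cons (I : eqType) (T : Type) v (V : seq I) (A : I -> set T) :
  \bigcup_(i in [set` v :: V]) A i = A v `|` \bigcup_(i in [set` V]) A i.
Proof.
apply/seteqP; split => x.
  by move=> [i /=]; rewrite in_cons => /predU1P[->|iV] Ax; [left|right; exists i].
by move=> [Ax|[i /= iV Ax]]; [exists v|exists i]; rewrite //= in_cons ?eqxx ?iV ?orbT.
Qed.

Lemma sum_measure_disjoint d (S : measurableType d) (R : realType) (mu : {measure set S -> \bar R})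
    (I : eqType) (V : seq I) (A : I -> set S) (B : set S) : uniq V ->
  (forall i, measurable (A i)) -> measurable B ->
  (forall i j, i \in V -> j \in V -> i != j -> A i `&` A j = set0) ->
  (\sum_(i <- V) mu (B `&` A i) <= mu B)%E.
Proof.
move=> uV mA mB dA.
have mU (W : seq I) : measurable (\bigcup_(i in [set` W]) A i).
  elim: W => [|w W IH]; first by rewrite set_nil bigcup_set0.
  by rewrite bigcup_mem_cons; exact: measurableU.
suff : (\sum_(i <- V) mu (B `&` A i) <= mu (B `&` \bigcup_(i in [set` V]) A i))%E.
  move=> /le_trans; apply; apply: le_measure; rewrite ?inE; [exact: measurableI|by []|exact: subIsetl].
elim: V uV dA => [|v V IH] /=; first by rewrite big_nil.
move=> /andP[vV uV] dA; rewrite big_cons.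
apply: le_trans (leeD (lexx _) (IH uV _)) _.
  by move=> i j iV jV; apply: dA; rewrite in_cons ?iV ?jV orbT.
rewrite bigcup_mem_cons setIUr measureU//; try exact: measurableI.
apply/seteqP; split => // x [[_ Ax] [_ [i /= iV Ai]]].
have : (A v `&` A i) x by [].
by rewrite dA ?mem_head// ?in_cons ?iV ?orbT//; apply: contraNneq vV => ->.
Qed.

(** * Light and heavy cells *)

Section cells.
Context {R : realType} {k : nat}.
Implicit Types (a : nat) (u v : seq {ffun 'I_k.+1 -> bool}).

(** Half-open, unlike [cube], so that cells of one generation are disjoint and measures over them
    add up. *)
Definition dyadic_cell a u : set 'rV[R]_k.+1 := cell (corner a u) (side a (size u)).

Lemma dyadic_cell_sub_cube a u : dyadic_cell a u `<=` cube a u.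
Proof. by move=> x xu i; have /andP[-> /ltW] := xu i. Qed.

Lemma dyadic_cell_disjoint a u v : size u = size v -> u != v ->
  dyadic_cell a u `&` dyadic_cell a v = set0.
Proof.
move=> suv /eqP uv; apply/seteqP; split => // x [xu xv]; apply: uv; apply: position_inj => // i.
have := xu i; have := xv i; rewrite !mxE suv => /andP[v1 v2] /andP[u1 u2].
have s0 := side_gt0 (R := R) a (size v).
have le_nat (p q : nat) :
    side a (size v) * p%:R < side a (size v) * q%:R + side a (size v) :> R -> (p <= q)%N.
  by rewrite -[X in _ + X]mulr1 -mulrDr ltr_pM2l// natr1 ltr_nat ltnS.
by apply/eqP; rewrite eqn_leq; apply/andP; split; apply: le_nat; lra.
Qed.

Lemma dyadic_cell_exists a x m : dyadic_cell a [::] x -> exists2 u, size u = m & dyadic_cell a u x.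
Proof.
move=> x0; exists (expansion a x m); first exact: size_expansion.
by elim: m => //= m IH; exact: cell_digit.
Qed.

End cells.

Lemma size_all_nodes (T : finType) j : size (all_nodes T j) = (#|T| ^ j)%N.
Proof. by rewrite size_map -cardE card_tuple. Qed.

Lemma uniq_all_nodes (T : finType) j : uniq (all_nodes T j).
Proof. by rewrite map_inj_uniq ?enum_uniq//; exact: val_inj. Qed.

Lemma rate_natX (R : realType) (k j : nat) : (#|{ffun 'I_k -> bool}| ^ j)%:R * rate (k%:R : R) ^+ j = 1.
Proof.
by rewrite card_ffun card_bool card_ord rate_nat !natrX -exprM -exprM exprVn mulfV// expf_neq0// pnatr_eq0.
Qed.

Section graph_null.
Context {R : realType} {k n : nat}.

Lemma eucl_dist_prod_le (p q : 'rV[R]_k.+1 * 'rV[R]_n) :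
  eucl_dist_prod p q <= eucl_dist p.1 q.1 + eucl_dist p.2 q.2.
Proof.
have a0 := eucl_dist_ge0 p.1 q.1; have b0 := eucl_dist_ge0 p.2 q.2.
rewrite /eucl_dist_prod -[leRHS]ger0_norm ?addr_ge0// -sqrtr_sqr ler_sqrt ?sqr_ge0//.
by rewrite sqrrD addrAC lerDl mulrn_wge0// mulr_ge0.
Qed.

(* [N] is the limsup of the products of cubes that are heavy: [A v] fills a proportion at least [2^-(j eta)] of
   the cell [u]. The total weight of [A] bounds the number of heavy pairs, while a Lipschitz graph meets boundedly
   many cubes over each cell, so the light ones contribute measures summable in [j]. *)
Lemma graph_null_decomposition (a : nat) (s e : R) (B : set ('rV[R]_k.+1 * 'rV[R]_n)) (Z : set 'rV[R]_k.+1) :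
  0 < s -> s < e -> borel_set B ->
  (forall p, B p -> dyadic_cell a [::] p.1 /\ window a p.2) ->
  lebesgue_outer Z = 0%E ->
  (forall t, ~ Z t -> dyadic_null (@eucl_dist R n) s (xsection B t)) ->
  exists N : set ('rV[R]_k.+1 * 'rV[R]_n), [/\ borel_set N,
    dyadic_null (@eucl_dist_prod R k.+1 n) (k.+1%:R + e) N &
    forall f : 'rV[R]_k.+1 -> 'rV[R]_n, eucl_lipschitz f ->
      lebesgue_outer [set t | B (t, f t) /\ ~ N (t, f t)] = 0%E].
Proof.
move=> s0 se bB Bw Z0 Bnull.
pose eta := (e - s) / 2; have eta0 : 0 < eta by rewrite divr_gt0// subr_gt0.
have r0 := rate_gt0 s; have r0' := rate_ge0 s.
pose S := caratheodory_type (@lebesgue_mu R k).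
pose mu : {measure set S -> \bar R} := @lebesgue_meas R k.
pose Bp : set (S * (nat -> {ffun 'I_n -> bool})) := preimage_codes a B.
have e2 l : 0 < 1 / (2 ^ l.+1)%:R :> R by rewrite divr_gt0// ltr0n expn_gt0.
have /choice[A0 A0P] l : exists A : seq {ffun 'I_n -> bool} -> set S, tree_cover l A (Bp) /\
    (cover_weight mu (rate s) A <= (1 / (2 ^ l.+1)%:R)%:E)%E.
  have c0 : content mu (rate s) l (Bp) = 0%E.
    apply: (content_null_slices l s0 bB _ Z0 Bnull) => p /Bw[p1 p2]; split => //.
    by rewrite -cube_nil; exact: dyadic_cell_sub_cube.
  have [|A cA wA] := content_near (mu := mu) (l := l) (E := Bp) r0' (e2 l).
    by rewrite c0 ltry.
  by exists A; split => //; move: wA; rewrite c0 add0e.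
(* As [A0 l] uses only nodes of size at least [l], every code of a point of [B] is caught by [A] at
   arbitrarily large sizes. *)
pose A v := \bigcup_l A0 l v.
have mA0 l v : measurable (A0 l v) by have [[]] := A0P l.
have mA v : measurable (A v) by apply: bigcup_measurable.
have wA : (cover_weight mu (rate s) A <= 1)%E.
  apply: (@le_trans _ _ (\sum_(l <oo) cover_weight mu (rate s) (A0 l))%E); last first.
    apply: le_trans (epsilon_trick0 xpredT (ltW (ltr01 : 0 < (1 : R)))).
    by apply: lee_nneseries => [l *|l _]; [exact: cover_weight_ge0|exact: (A0P l).2].
  rewrite nneseries_esumT; last by move=> *; exact: cover_weight_ge0.
  rewrite /cover_weight esum_interchange; last by move=> *; exact: cover_weight_term_ge0.
  apply: le_esum => v _; rewrite -nneseries_esumT; last by move=> *; exact: cover_weight_term_ge0.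
  rewrite nneseriesZl//; apply: lee_pmul => //; first by rewrite lee_fin exprn_ge0.
  by apply: measure_sigma_subadditive => //; exact: bigcup_measurable.
have sumA j : (\sum_(v <- all_nodes {ffun 'I_n -> bool} j) mu (A v) <= ((rate s ^+ j)^-1)%:E)%E.
  have : ((rate s ^+ j)%:E * \sum_(v <- all_nodes {ffun 'I_n -> bool} j) mu (A v) <= 1)%E.
    apply: le_trans wA; rewrite ge0_sume_distrr; last by move=> *; exact: measure_ge0.
    apply: esum_ge; exists [set` all_nodes {ffun 'I_n -> bool} j]; first by split => //; exact: finite_seq.
    rewrite -fsbig_seq ?uniq_all_nodes// big_seq [leRHS]big_seq; apply: lee_sum => v.
    by rewrite mem_all_nodes => /eqP ->.
  by rewrite muleC -lee_pdivlMr ?exprn_gt0// mul1e.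
(* Up to a constant, the proportion 2^(-j eta) of the measure of a cell of generation [j]. *)
pose theta j := rate (k.+1%:R + eta) ^+ j.
have theta0 j : 0 < theta j by rewrite exprn_gt0// rate_gt0.
pose heavy (p : seq {ffun 'I_k.+1 -> bool} * seq {ffun 'I_n -> bool}) :=
  `[< ((theta (size p.1))%:E <= mu (A p.2 `&` dyadic_cell a p.1))%E >].
pose pairs j := [seq (u, v) | u <- all_nodes {ffun 'I_k.+1 -> bool} j, v <- all_nodes {ffun 'I_n -> bool} j].
pose H j := [seq p <- pairs j | heavy p].
(* Markov's inequality: cells of one generation are disjoint, so for each [v] the heavy pairs share
   the measure of [A v]. *)
have sizeH j : (size (H j))%:R <= (rate (k.+1%:R + (s + eta)) ^+ j)^-1.
  have mcell u : measurable (dyadic_cell a u : set (caratheodory_type (@lebesgue_mu R k))) by exact: measurable_cell.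
  suff : (((size (H j))%:R * theta j)%:E <= ((rate s ^+ j)^-1)%:E)%E.
    rewrite lee_fin -ler_pdivlMr// => /le_trans; apply; rewrite /theta -invfM -exprMn -rateD.
    by rewrite (_ : s + (k.+1%:R + eta) = k.+1%:R + (s + eta))//; ring.
  apply: le_trans (sumA j).
  apply: (@le_trans _ _ (\sum_(p <- H j) mu (A p.2 `&` dyadic_cell a p.1))%E).
    apply: (@le_trans _ _ (\sum_(p <- H j) (theta j)%:E)%E).
      by rewrite sumEFin big_const_seq count_predT iter_addr_0 mulr_natl.
    rewrite big_seq [leRHS]big_seq; apply: lee_sum => p; rewrite mem_filter => /andP[/asboolP].
    move=> hp /allpairsP[[u v] /= [uj _ pE]]; move: hp; rewrite pE /=.
    by move: uj; rewrite mem_all_nodes => /eqP ->.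
  rewrite big_filter; apply: (@le_trans _ _ (\sum_(p <- pairs j) mu (A p.2 `&` dyadic_cell a p.1))%E).
    by rewrite big_mkcond; apply: lee_sum => p _; case: ifP => // _; exact: measure_ge0.
  rewrite big_allpairs exchange_big /=; apply: lee_sum => v _.
  apply: (@sum_measure_disjoint _ _ _ mu _ (all_nodes _ j) (fun u => dyadic_cell a u) (A v)) => //.
    exact: uniq_all_nodes.
  move=> u u'; rewrite !mem_all_nodes => /eqP uj /eqP u'j; apply: dyadic_cell_disjoint.
  by rewrite uj u'j.
pose N0 j := \bigcup_(p in [set` H j]) (cube a p.1 `*` cube a p.2 : set ('rV[R]_k.+1 * 'rV[R]_n)).
pose N := \bigcap_J \bigcup_j N0 (J + j)%N.
exists N; split.
- apply: borel_bigcap => J; apply: borel_bigcup => j; apply: borel_closed.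
  apply: closed_bigcup => [|p _]; first exact: finite_seq.
  have -> : (cube a p.1 `*` cube a p.2 : set ('rV[R]_k.+1 * 'rV[R]_n)) =
      (fst @^-1` cube a p.1) `&` (snd @^-1` cube a p.2) by [].
  apply: closedI; apply: preimage_closed => [q _|]; try exact: closed_cube.
    exact: continuous_fst.
  exact: continuous_snd.
(* [2 ^+ K] absorbs the window size and the dimensional factor in the diameter of a product of
   cubes. *)
- have [K DK] : exists K, ((k.+1 + n) * (2 * a.+1))%:R <= 2 ^+ K :> R.
    exists ((k.+1 + n) * (2 * a.+1))%N; rewrite -natrX ler_nat; exact/ltnW/ltn_expl.
  apply: (@dyadic_null_lists _ _ _ _ _ _ (fun p => cube a p.1 `*` cube a p.2)) => eps eps0.
  have F0 := rate_gt0 (k.+1%:R + (s + eta)).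
  have q01 : 0 <= rate eta < 1 by rewrite rate_ge0 rate_lt1.
  have C0 : 0 <= (rate (k.+1%:R + (s + eta)) ^+ K)^-1 by rewrite invr_ge0 exprn_ge0// ltW.
  have [J Je] := geometric_tail q01 C0 eps0.
  (* Generation J + K + j serves at scale J + j; its weight is at most a constant times
     [rate eta ^+ (J + j)]. *)
  exists (fun j => H (J + K + j)%N), (fun j => (J + j)%N); split.
  + by move=> x /(_ (J + K)%N I)[j _ [p /= pH px]]; exists j, p.
  + move=> j p; rewrite mem_filter => /andP[_ /allpairsP[[u v] /= [+ + ->]]] /=.
    rewrite !mem_all_nodes => /eqP uj /eqP vj [x1 x2] [y1 y2] [/= xu xv] [/= yu yv].
    apply: le_trans (eucl_dist_prod_le _ _) _.
    apply: le_trans (lerD (eucl_dist_cube xu yu) (eucl_dist_cube xv yv)) _.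
    rewrite uj vj -mulrDl -natrD /side.
    have -> : 2^-1 ^+ (J + j) = 2 ^+ K * 2^-1 ^+ (J + K + j) :> R.
      rewrite [(J + K)%N]addnC -addnA [in RHS]exprD mulrA -[LHS]mul1r.
      by congr (_ * _); rewrite exprVn mulfV// expf_neq0// pnatr_eq0.
    rewrite mulrA; apply: ler_wpM2r; first by rewrite exprn_ge0// invr_ge0.
    by move: DK; rewrite !natrM.
  + apply: le_trans Je; apply: lee_nneseries => j *.
      by rewrite lee_fin mulr_ge0// exprn_ge0// rate_ge0.
    rewrite lee_fin; apply: le_trans (ler_wpM2r _ (sizeH _)) _; first by rewrite exprn_ge0// rate_ge0.
    have -> : rate (k.+1%:R + e) = rate (k.+1%:R + (s + eta)) * rate eta.
      by rewrite -rateD; congr rate; rewrite /eta; field.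
    move: (rate (k.+1%:R + (s + eta))) F0 => F F0.
    rewrite [(J + K)%N]addnC -addnA exprMn exprD invfM -mulrA.
    apply: ler_wpM2l; first by rewrite invr_ge0 exprn_ge0// ltW.
    by rewrite mulrA mulVf ?mul1r// expf_neq0// gt_eqF.
- move=> f [L fL].
  (* Over a cell the graph moves by at most [C] sides along each axis. *)
  pose C := Num.bound (`|L| * k.+1%:R).
  have LC : `|L| * k.+1%:R <= C%:R by apply/ltW/archi_boundP; rewrite mulr_ge0.
  have /choice[VV VVP] u : exists V : seq (seq {ffun 'I_n -> bool}), [/\ (size V <= (2 * C + 3) ^ n)%N,
      forall v, v \in V -> size v = size u &
      forall y t, dyadic_cell a u t -> codes a y (f t) -> trunc y (size u) \in V].
    have [|V [sV Vs VZ]] := @node_count R n a C (size u) (f @` dyadic_cell a u).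
      move=> _ _ i [t tu <-] [t' t'u <-]; apply: le_trans (coord_le_eucl_dist _ _ _) _.
      apply: le_trans (fL t t') _; apply: (@le_trans _ _ (`|L| * (k.+1%:R * side a (size u)))).
        apply: le_trans (ler_wpM2r (eucl_dist_ge0 _ _) (ler_norm L)) _.
        apply: ler_wpM2l => //.
        by apply: eucl_dist_cube; exact: dyadic_cell_sub_cube.
      by rewrite mulrA ler_wpM2r// ltW// side_gt0.
    by exists V; split => // y t tu yt; apply: (VZ y (f t)) => //; exists t.
  pose light u := [seq v <- VV u | ~~ heavy (u, v)].
  pose Li j := \bigcup_(u in [set` all_nodes {ffun 'I_k.+1 -> bool} j])
    \bigcup_(v in [set` light u]) (A v `&` dyadic_cell a u).
  apply: (@lebesgue_outer_limsup _ _ Li _ (rate eta) ((2 * C + 3) ^ n)%:R) => //.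
  + by rewrite rate_ge0 rate_lt1.
  + move=> j; apply: le_trans (lebesgue_outer_seq _ _) _.
    apply: (@le_trans _ _ (\sum_(u <- all_nodes {ffun 'I_k.+1 -> bool} j) (((2 * C + 3) ^ n)%:R * theta j)%:E)%E).
      rewrite big_seq [leRHS]big_seq; apply: lee_sum => u; rewrite mem_all_nodes => /eqP uj.
      apply: le_trans (lebesgue_outer_seq _ _) _.
      apply: (@le_trans _ _ (\sum_(v <- light u) (theta j)%:E)%E).
        rewrite big_seq [leRHS]big_seq; apply: lee_sum => v; rewrite mem_filter => /andP[/asboolPn + _].
        by rewrite /= uj => /negP; rewrite -ltNge => /ltW.
      rewrite sumEFin big_const_seq count_predT iter_addr_0 lee_fin -[leLHS]mulr_natl ler_wpM2r ?(ltW (theta0 j))//.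
      rewrite ler_nat; have [+ _ _] := VVP u; apply: leq_trans.
      by rewrite size_filter count_size.
    rewrite sumEFin big_const_seq count_predT iter_addr_0 size_all_nodes lee_fin -[leLHS]mulr_natl.
    by rewrite mulrCA /theta rateD exprMn [X in _ * X <= _]mulrA rate_natX mul1r.
  + move=> J t [/= Bt /existsNP[J1 /not_implyP[_ nN]]].
    have [t0 ft] := Bw _ Bt; have [y yft] := codes_surj ft.
    (* No heavy product of generation at least [J1] contains the point, so a pair found at size at
       least [maxn J J1] is light. *)
    have [[_ A0l A0B] _] := A0P (maxn J J1).
    have [|m tm] := A0B (t, y); first by exists (f t).
    have mJ : (maxn J J1 <= m)%N.
      rewrite leqNgt; apply/negP => mJ; have := tm; rewrite A0l//; by rewrite size_mkseq.
    have [u um tu] := dyadic_cell_exists m t0.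
    exists m; first exact: leq_trans (leq_maxl _ _) mJ.
    have vV : trunc y m \in VV u by have [_ _ /(_ y t tu yft)] := VVP u; rewrite um.
    exists u => /=; first by rewrite mem_all_nodes um.
    exists (trunc y m) => /=; last by split => //; exists (maxn J J1).
    rewrite mem_filter vV andbT; apply/negP => hv; apply: nN.
    exists (m - J1)%N => //; rewrite subnKC; last exact: leq_trans (leq_maxr _ _) mJ.
    exists (u, trunc y m) => /=; last by split; [exact: dyadic_cell_sub_cube|exact: yft].
    rewrite mem_filter hv; apply/allpairsP; exists (u, trunc y m).
    by rewrite !mem_all_nodes um size_mkseq.
Qed.

End graph_null.

(** * Dimension of slices *)

(** The integral of the series is the sum of the weighted measures, and an integrable function is
    finite almost everywhere. *)
Lemma ae_nneseries_lty d (S : measurableType d) (R : realType) (mu : {measure set S -> \bar R})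
    (P : nat -> set S) (w : nat -> R) :
  (forall p, measurable (P p)) -> (forall p, 0 <= w p) ->
  (\sum_(p <oo) (w p)%:E * mu (P p) < +oo)%E ->
  {ae mu, forall t, (\sum_(p <oo) (w p * \1_(P p) t)%:E < +oo)%E}.
Proof.
move=> mP w0 fin; pose f p (t : S) : \bar R := (w p * \1_(P p) t)%:E.
have f0 p t : (0 <= f p t)%E by rewrite lee_fin mulr_ge0.
have mf p : measurable_fun [set: S] (f p : S -> \bar R).
  by apply/measurable_EFinP; apply: measurable_funM => //; exact: measurable_indic.
pose g t := (\sum_(p <oo) f p t)%E.
have mg : measurable_fun [set: S] (g : S -> \bar R) by apply: ge0_emeasurable_sum.
have g0 t : (0 <= g t)%E by apply: nneseries_ge0.
have ig : mu.-integrable setT g.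
  apply/integrableP; split => //.
  rewrite (eq_integral g) => [|t _]; last by rewrite gee0_abs.
  rewrite /g integral_nneseries//.
  apply: le_lt_trans fin; apply: lee_nneseries => [p _ _|p _]; first exact: integral_ge0.
  rewrite /f (eq_integral (fun t => (w p)%:E * (\1_(P p) t)%:E)%E) => [|t _]; last by rewrite EFinM.
  rewrite ge0_integralZl_EFin//; last by apply/measurable_EFinP; exact: measurable_indic.
  by rewrite integral_indic// setIT.
have [N [mN N0 Nf]] := integrable_ae measurableT ig.
exists N; split => // t /= nt; apply: Nf => /= /(_ I) gfin; apply: nt.
by rewrite -ge0_fin_numE; [exact: gfin|exact: g0].
Qed.

Lemma nneseries_small_term (R : realType) (G : nat -> \bar R) (e : R) :
  (forall l, 0 <= G l)%E -> 0 < e -> (\sum_(l <oo) G l < +oo)%E -> exists l, (G l <= e%:E)%E.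
Proof.
move=> G0 e0 fin; apply: contrapT => /forallNP big.
have Ge l : (e%:E <= G l)%E by rewrite leNgt; apply/negP => /ltW; exact: big.
have Sfin : (\sum_(l <oo) G l)%E \is a fin_num by rewrite ge0_fin_numE// nneseries_ge0.
pose M := fine (\sum_(l <oo) G l)%E.
have nM n : n%:R * e <= M.
  rewrite -lee_fin fineK//; apply: le_trans (nneseries_lim_ge n _) => //.
  apply: (@le_trans _ _ (\sum_(0 <= l < n) e%:E)%E); last exact: lee_sum.
  by rewrite sumEFin sumr_const_nat subn0 lee_fin mulr_natl.
have M0 : 0 <= M by rewrite fine_ge0// nneseries_ge0.
have := archi_boundP (divr_ge0 M0 (ltW e0)); rewrite ltr_pdivrMr//.
by rewrite ltNge nM.
Qed.

Lemma eucl_dist_fst_le (R : realType) k n (p q : 'rV[R]_k * 'rV[R]_n) :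
  eucl_dist p.1 q.1 <= eucl_dist_prod p q.
Proof.
rewrite /eucl_dist_prod -[leLHS]ger0_norm ?eucl_dist_ge0// -sqrtr_sqr ler_sqrt ?addr_ge0 ?sqr_ge0//.
by rewrite lerDl sqr_ge0.
Qed.

Lemma eucl_dist_snd_le (R : realType) k n (p q : 'rV[R]_k * 'rV[R]_n) :
  eucl_dist p.2 q.2 <= eucl_dist_prod p q.
Proof.
rewrite /eucl_dist_prod -[leLHS]ger0_norm ?eucl_dist_ge0// -sqrtr_sqr ler_sqrt ?addr_ge0 ?sqr_ge0//.
by rewrite lerDr sqr_ge0.
Qed.

Lemma dyadic_null_fst (R : realType) k n s (B : set ('rV[R]_k * 'rV[R]_n)) :
  dyadic_null (@eucl_dist_prod R k n) s B -> dyadic_null (@eucl_dist R k) s (fst @` B).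
Proof.
move=> nB e /nB[U [c [[BU Uc] ce]]]; exists (fun i => fst @` U i), c; split => //; split.
  by move=> _ [p /BU[i _ Up] <-]; exists i => //; exists p.
move=> i; have [c0 Ui] := Uc i; split => // -[_ [p Up _]].
have [|m [dm mc]] := Ui; first by exists p.
exists m; split => // _ _ [x Ux <-] [y Uy <-].
exact: le_trans (eucl_dist_fst_le _ _) (dm _ _ Ux Uy).
Qed.

(* A covering set of diameter [h = 2^-m] lies over a box of volume [(2 h)^(k+1)], so the integral over [t] of the
   total [q]-weight of the slices of a covering is at most [2^(k+1)] times its [(k+1+q)]-weight. *)
Lemma dyadic_null_slices (R : realType) k n q (B : set ('rV[R]_k.+1 * 'rV[R]_n)) : 0 < q ->
  dyadic_null (@eucl_dist_prod R k.+1 n) (k.+1%:R + q) B ->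
  exists2 Z : set 'rV[R]_k.+1, lebesgue_outer Z = 0%E &
    forall t, ~ Z t -> dyadic_null (@eucl_dist R n) q (xsection B t).
Proof.
move=> q0 nB.
have e2 l : 0 < 1 / (2 ^ l.+1)%:R :> R by rewrite divr_gt0// ltr0n expn_gt0.
have /choice[U /choice[c UcP]] l := nB _ (e2 l).
have c0 l i : (0 <= c l i)%E by have [[_ /(_ i)[]]] := UcP l.
(* Each nonempty covering set gets a base point and a scale; the box centred there with that
   half-side contains its projection. *)
have pt_ : forall l i, exists x : ('rV[R]_k.+1 * 'rV[R]_n) * nat, U l i !=set0 -> 
  [/\ U l i x.1, (forall y z, U l i y -> U l i z -> eucl_dist_prod y z <= 2^-1 ^+ x.2) &
   ((rate (k.+1%:R + q) ^+ x.2)%:E <= c l i)%E].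
  move=> l i; have [->|/set0P Ui] := eqVneq (U l i) set0; first by exists (0, 0, 0%N) => -[].
  have [[_ /(_ i)[_ /(_ Ui)[m [dm mc]]]] _] := UcP l.
  by have [x Ux] := Ui; exists (x, m).
pose x_ l i := projT1 (cid (pt_ l i)).
have xP l i := projT2 (cid (pt_ l i)).
pose lo l i : 'rV[R]_k.+1 := \row_j ((x_ l i).1.1 0 j - 2^-1 ^+ (x_ l i).2).
pose hi l i : 'rV[R]_k.+1 := \row_j ((x_ l i).1.1 0 j + 2^-1 ^+ (x_ l i).2).
have h0 m : 0 <= 2^-1 ^+ m :> R by rewrite exprn_ge0// invr_ge0.
have lohi l i j : lo l i 0 j <= hi l i 0 j by rewrite !mxE lerD2l; apply: le_trans (h0 _); rewrite oppr_le0.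
pose S := caratheodory_type (@lebesgue_mu R k).
pose mu : {measure set S -> \bar R} := @lebesgue_meas R k.
pose P l i : set S := if U l i == set0 then set0 else box (lo l i) (hi l i).
pose w l i : R := rate q ^+ (x_ l i).2.
have w0 l i : 0 <= w l i by rewrite exprn_ge0// rate_ge0.
have mP l i : measurable (P l i).
  rewrite /P; case: ifP => // _; apply: measurable_closed; exact: closed_box.
have wP l i : ((w l i)%:E * mu (P l i) <= (2 ^+ k.+1)%:E * c l i)%E.
  rewrite /P; case: eqVneq => [_|/set0P Ui]; first by rewrite measure0 mule0 mule_ge0// lee_fin exprn_ge0.
  have [_ _ mc] := xP l i Ui.
  apply: (@le_trans _ _ ((w l i)%:E * (box_volume (lo l i) (hi l i))%:E)%E).
    by apply: lee_pmul => //; [rewrite lee_fin|exact: (lebesgue_outer_box (lohi l i))].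
  apply: (@le_trans _ _ ((2 ^+ k.+1)%:E * (rate (k.+1%:R + q) ^+ (x_ l i).2)%:E)%E); last first.
    by apply: lee_pmul => //; rewrite lee_fin ?exprn_ge0// rate_ge0.
  rewrite -!EFinM lee_fin /box_volume (eq_bigr (fun=> 2 * 2^-1 ^+ (x_ l i).2)) => [|j _]; last by rewrite !mxE opprD opprK addrACA subrr add0r -mulr2n mulr_natl.
  rewrite prodr_const card_ord exprMn rateD exprMn rate_nat -!exprM [(k.+1 * _)%N]mulnC /w.
  by rewrite mulrC -!mulrA.
have [f fsurj fsum] := nat_pairing R.
(* One null set has to serve every [e]: the coverings of weight 2^-(l+1) are summed over [l], and
   the finite sum at [t] then has arbitrarily small terms. *)
have fin : (\sum_(p <oo) (w (f p).1 (f p).2)%:E * mu (P (f p).1 (f p).2) < +oo)%E.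
  rewrite (fsum (fun l i => (w l i)%:E * mu (P l i))%E); last by move=> l i; apply: mule_ge0 => //; rewrite lee_fin.
  apply: (@le_lt_trans _ _ (\sum_(l <oo) (2 ^+ k.+1)%:E * (1 / (2 ^ l.+1)%:R)%:E)%E).
    apply: lee_nneseries => [l _ _|l _]; first by apply: nneseries_ge0 => i _ _; apply: mule_ge0 => //; rewrite lee_fin.
    apply: (@le_trans _ _ (\sum_(i <oo) (2 ^+ k.+1)%:E * c l i)%E).
      by apply: lee_nneseries => [i _ _|i _]; [apply: mule_ge0 => //; rewrite lee_fin|exact: wP].
    rewrite nneseriesZl//; apply: lee_pmul => //; last exact: (UcP l).2.
    exact: nneseries_ge0.
  rewrite nneseriesZl; last by move=> l _; rewrite lee_fin ltW.
  apply: (@le_lt_trans _ _ ((2 ^+ k.+1)%:E * 1%:E)%E); last by rewrite -EFinM ltry.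
  apply: lee_pmul => //; last exact: (epsilon_trick0 xpredT (ltW ltr01)).
  by apply: nneseries_ge0 => l _ _; rewrite lee_fin ltW.
have [Z [mZ Z0 gZ]] := ae_nneseries_lty (fun p => mP (f p).1 (f p).2) (fun p => w0 (f p).1 (f p).2) fin.
exists Z; first exact: Z0.
move=> t nZt e e0.
have : (\sum_(p <oo) (w (f p).1 (f p).2 * \1_(P (f p).1 (f p).2) t)%:E < +oo)%E.
  by apply: contrapT => nt; apply: nZt; apply: gZ.
have g0 l i : (0 <= (w l i * \1_(P l i) t)%:E)%E by rewrite lee_fin mulr_ge0.
rewrite (fsum (fun l i => (w l i * \1_(P l i) t)%:E))// => gfin.
have [l le] := nneseries_small_term (fun l => nneseries_ge0 (fun i _ _ => g0 l i)) e0 gfin.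
exists (fun i => [set x | U l i (t, x)]), (fun i => (w l i * \1_(P l i) t)%:E); split => //.
split => [x /xsectionP Bx|i].
  by have [[/(_ _ Bx)[i _ Ux] _] _] := UcP l; exists i.
split => // -[x /= Ux].
have Ui : U l i !=set0 by exists (t, x).
have [Ux_ dU mc] := xP l i Ui; exists (x_ l i).2; split.
  by move=> y z Uy Uz; exact: le_trans (eucl_dist_snd_le (t, y) (t, z)) (dU _ _ Uy Uz).
have Pt : P l i t.
  rewrite /P ifF; last by apply/negbTE/set0P.
  move=> j; have := le_trans (coord_le_eucl_dist t (x_ l i).1.1 j) (le_trans (eucl_dist_fst_le (t, x) (x_ l i).1) (dU _ _ Ux Ux_)).
  by rewrite ler_distl !mxE.
by rewrite indicE mem_set// mulr1.
Qed.

Section dimension.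
Context {R : realType} {T : Type} (dist : T -> T -> R).
Hypothesis dist_xx : forall x, dist x x = 0.

Lemma hausdorff_dim_ge (E : set T) (v : \bar R) :
  (forall s : R, 0 < s -> dyadic_null dist s E -> (v <= s%:E)%E) -> (v <= hausdorff_dim dist E)%E.
Proof.
move=> Ev; apply: le_ereal_inf_tmp => _ [s [s0 Hs] <-].
rewrite le_eqVlt in s0; case/predU1P: s0 => [s0|s0]; last first.
  exact: (Ev s s0 ((hausdorff_measure0P dist_xx E s0).1 Hs)).
(* At exponent 0 the set is empty, hence null for every positive exponent. *)
rewrite -s0 in Hs *; apply/lee_addgt0Pr => e e0; rewrite add0e; apply: Ev => //.
rewrite (hausdorff_measure0_empty Hs).
exact: dyadic_null0.
Qed.

Lemma le_hausdorff_dim (E F : set T) : E `<=` F -> (hausdorff_dim dist E <= hausdorff_dim dist F)%E.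
Proof.
move=> EF; apply: hausdorff_dim_le => // [|s s0 Fs]; first exact: hausdorff_dim_ge0.
exact: dyadic_null_sub EF (hausdorff_dim_lt dist_xx Fs).
Qed.

End dimension.

(** * Compact subsets of prescribed mass *)

Section tree_mass.
Context {R : realType} {T : finType}.
Variable r : R.
Hypothesis r_gt0 : 0 < r.
Hypothesis r_lt1 : r < 1.
Local Notation Y := (nat -> T).
Implicit Types (E F : set Y) (V W : seq (seq T)) (u v : seq T) (y : Y) (j m : nat).

Definition cyl v : set Y := [set y | trunc y (size v) = v].

(** Closedness in the product topology, with [T] discrete. *)
Definition tree_closed E := forall y, (forall m, exists2 y', E y' & trunc y' m = trunc y m) -> E y.

Lemma tree_closed_trunc E (P : seq T -> Prop) j : tree_closed E ->
  tree_closed (E `&` [set y | P (trunc y j)]).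
Proof.
move=> cE y ay; split.
  by apply: cE => m; have [y' [Ey' _] y'm] := ay m; exists y'.
by have [y' [_ /= Py'] <-] := ay j.
Qed.

Lemma tree_closedI E F : tree_closed E -> tree_closed F -> tree_closed (E `&` F).
Proof.
by move=> cE cF y ay; split; [apply: cE|apply: cF] => m; have [y' [? ?] ?] := ay m; exists y'.
Qed.

Lemma tree_closed_bigcap (E : nat -> set Y) : (forall i, tree_closed (E i)) ->
  tree_closed (\bigcap_i E i).
Proof. by move=> cE y ay i _; apply: cE => m; have [y' /(_ i I) ? ?] := ay m; exists y'. Qed.

(** If each of the finitely many children of a node missed some [E i], the largest of these indices
    would contradict that the node meets all of them. *)
Lemma koenig (E : nat -> set Y) : (forall i, tree_closed (E i)) ->
  (forall i, E i.+1 `<=` E i) -> (forall i, E i !=set0) -> exists y, forall i, E i y.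
Proof.
move=> cE ES E0.
have Ele i j : (i <= j)%N -> E j `<=` E i.
  by move=> /subnK <-; elim: (j - i)%N => // n IH y /ES /IH.
pose alive v := forall i, (E i `&` cyl v) !=set0.
have step v : exists t, alive v -> alive (rcons v t).
  have [av|] := pselect (alive v); last first.
    by have [y _] := E0 0%N; exists (y 0%N).
  apply: contrapT => /forallNP h.
  have /choice[i iP] t : exists i, ~ ((E i `&` cyl (rcons v t)) !=set0).
    by apply: contrapT => /forallNP h'; apply: (h t) => _ i; apply: contrapT; exact: h'.
  have [y [Ey vy]] := av (\max_t i t).
  apply: (iP (y (size v))); exists y; split; first by apply: Ele Ey; exact: leq_bigmax.
  by rewrite /cyl /= size_rcons trunc_rcons vy.
have [g gP] := choice step.
pose s := fix s m := if m is m'.+1 then rcons (s m') (g (s m')) else [::].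
have s_alive m : alive (s m).
  elim: m => [i|m IH]; last exact: gP.
  by have [y Ey] := E0 i; exists y.
exists (fun m => g (s m)) => i; apply: cE => m.
have sE : trunc (fun m => g (s m)) m = s m.
  by elim: m => //= m IH; rewrite trunc_rcons IH.
have [y [Ey ys]] := s_alive m i; exists y => //; rewrite sE -ys.
by congr mkseq; rewrite -[in RHS]sE size_mkseq.
Qed.

Definition fcover j E V := (forall v, v \in V -> (j <= size v)%N) /\
  (forall y, E y -> exists2 v, v \in V & cyl v y).

Definition weight V : R := \sum_(v <- V) r ^+ size v.

Definition mass j E : R := inf [set weight V | V in fcover j E].

Lemma fcover_koenig j (E : nat -> set Y) V : (forall i, tree_closed (E i)) ->
  (forall i, E i.+1 `<=` E i) -> fcover j (\bigcap_i E i) V -> exists i, fcover j (E i) V.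
Proof.
move=> cE ES [jV EV]; apply: contrapT => /forallNP nV.
have [|||y Fy] := @koenig (fun i => E i `&` [set y | forall v, v \in V -> ~ cyl v y]).
- move=> i; apply: tree_closedI => // y ay v vV vy.
  have [y' /(_ v vV) nvy' y'y] := ay (size v); apply: nvy'.
  by rewrite /cyl /= y'y.
- by move=> i y [/ES].
- move=> i; apply: contrapT => nE; apply: (nV i); split => // y Ey.
  apply: contrapT => ny; apply: nE; exists y; split => // v vV vy; apply: ny; by exists v.
have [|v vV vy] := EV y; first by move=> i _; have [] := Fy i.
by have [_ /(_ v vV)] := Fy 0%N.
Qed.

Lemma weight_ge0 V : 0 <= weight V.
Proof. by apply: sumr_ge0 => v _; rewrite exprn_ge0// ltW. Qed.

Lemma weight_cat V W : weight (V ++ W) = weight V + weight W.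
Proof. by rewrite /weight big_cat. Qed.

Lemma fcover_all j E : fcover j E (all_nodes T j).
Proof.
split=> [v|y _]; first by rewrite mem_all_nodes => /eqP ->.
by exists (trunc y j); rewrite ?mem_all_nodes /cyl /= size_mkseq.
Qed.

Lemma has_inf_mass j E : has_inf [set weight V | V in fcover j E].
Proof.
split; first by exists (weight (all_nodes T j)); exists (all_nodes T j) => //; exact: fcover_all.
by exists 0 => _ [V _ <-]; exact: weight_ge0.
Qed.

Lemma mass_le j E V : fcover j E V -> mass j E <= weight V.
Proof. by move=> cV; apply: ge_inf; [have [] := has_inf_mass j E|exists V]. Qed.

Lemma mass_near j E (e : R) : 0 < e -> exists2 V, fcover j E V & weight V < mass j E + e.
Proof. by move=> /inf_adherent/(_ (has_inf_mass j E))[_ [V cV <-] Ve]; exists V. Qed.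

Lemma le_mass_lb j E (c : R) : (forall V, fcover j E V -> c <= weight V) -> c <= mass j E.
Proof.
move=> h; apply: lb_le_inf; first by have [] := has_inf_mass j E.
by move=> _ [V cV <-]; exact: h.
Qed.

Lemma mass_ge0 j E : 0 <= mass j E.
Proof. by apply: le_mass_lb => V _; exact: weight_ge0. Qed.

Lemma le_mass i j E F : (i <= j)%N -> E `<=` F -> mass i E <= mass j F.
Proof.
move=> ij EF; apply: le_mass_lb => V [jV FV]; apply: mass_le; split.
  by move=> v /jV; exact: leq_trans.
by move=> y /EF /FV.
Qed.

Lemma mass0 j : mass j set0 = 0.
Proof.
apply/eqP; rewrite eq_le mass_ge0 andbT.
by apply: le_trans (mass_le (V := [::]) _) _ => //; rewrite /weight big_nil.
Qed.

Lemma massU j E F : mass j (E `|` F) <= mass j E + mass j F.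
Proof.
apply/ler_addgt0Pr => e e0; have e2 : 0 < e / 2 by rewrite divr_gt0.
have [V [jV EV] Ve] := mass_near j E e2; have [W [jW FW] We] := mass_near j F e2.
apply: (@le_trans _ _ (weight (V ++ W))); last first.
  by rewrite weight_cat (splitr e) addrACA lerD// ltW.
apply: mass_le; split=> [v|y]; rewrite ?mem_cat; first by move=> /orP[/jV|/jW].
by case=> [/EV|/FW] [v vV vy]; exists v => //; rewrite mem_cat vV ?orbT.
Qed.

Lemma mass_cyl j E v : (j <= size v)%N -> mass j (E `&` cyl v) <= r ^+ size v.
Proof.
move=> jv; apply: le_trans (mass_le (V := [:: v]) _) _; last by rewrite /weight big_seq1.
by split=> [u|y [_ vy]]; [rewrite inE => /eqP ->|exists v; rewrite ?inE].
Qed.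

Lemma mass_seq (I : eqType) j (L : seq I) (E : I -> set Y) :
  mass j (\bigcup_(i in [set` L]) E i) <= \sum_(i <- L) mass j (E i).
Proof.
elim: L => [|i L IH]; first by rewrite set_nil bigcup_set0 mass0 big_nil.
rewrite big_cons bigcup_mem_cons; apply: le_trans (massU _ _ _) _.
by rewrite lerD2l.
Qed.

Lemma weight_split j V : (forall v, v \in V -> (j <= size v)%N) ->
  \sum_(v <- all_nodes T j) weight [seq u <- V | take j u == v] = weight V.
Proof.
move=> jV; rewrite /weight.
under eq_bigr => v _ do rewrite big_filter big_mkcond.
rewrite exchange_big /= [LHS]big_seq [RHS]big_seq; apply: eq_bigr => u uV.
rewrite -big_mkcond /= (big_rem (take j u)) ?mem_all_nodes ?size_takel ?jV//= eqxx.
rewrite big_seq_cond big1 ?addr0// => v /andP[].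
by rewrite mem_rem_uniq ?uniq_all_nodes// inE eq_sym => /andP[/negbTE ->].
Qed.

Lemma cyl_take u v y : (size v <= size u)%N -> cyl u y -> cyl v y -> take (size v) u = v.
Proof. by move=> vu; rewrite /cyl /= => uy vy; rewrite -uy take_trunc. Qed.

(** A node of size at least [j] lies below a single node of generation [j], so a covering splits. *)
Lemma mass_superadditive j E :
  \sum_(v <- all_nodes T j) mass j (E `&` cyl v) <= mass j E.
Proof.
apply: le_mass_lb => V [jV EV]; rewrite -(weight_split jV) big_seq [leRHS]big_seq.
apply: ler_sum => v; rewrite mem_all_nodes => /eqP vj; apply: mass_le; split.
  by move=> u; rewrite mem_filter => /andP[_ /jV].
move=> y [/EV[u uV uy] vy]; exists u => //; rewrite mem_filter uV andbT.
by apply/eqP; rewrite -vj; apply: cyl_take uy vy; rewrite vj jV.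
Qed.

Lemma discrete_ivt (f : nat -> R) (c e : R) n : f 0%N <= c + e -> (forall i, f i.+1 <= f i + e) ->
  c <= f n -> exists i, c <= f i <= c + e.
Proof.
move=> f0 fS cn; have ex : exists i, c <= f i by exists n.
case: (ex_minnP ex) => -[|i] ci imin; first by exists 0%N; rewrite ci.
exists i.+1; rewrite ci /=; apply: le_trans (fS i) _; rewrite lerD2r.
by rewrite leNgt; apply/negP => /ltW /imin; rewrite ltnn.
Qed.

(* Inside each cylinder of generation [j], cylinders of a much finer generation are added back one by one; the
   mass then grows by small steps, so that it can be stopped at the required value. *)
Lemma trim j E (e : R) : tree_closed E -> 0 < e -> exists E', [/\ E' `<=` E, tree_closed E' &
  forall v, size v = j -> mass j (E `&` cyl v) <= mass j.+1 (E' `&` cyl v) <= mass j (E `&` cyl v) + e].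
Proof.
move=> cE e0; have r01 : 0 <= r < 1 by rewrite ltW.
(* A node of generation [J] weighs at most [e], the size of one step. *)
have [J0 J0e] := expr_small r01 e0; pose J := maxn J0 j.+1.
have Je : r ^+ J <= e.
  by apply: le_trans (ltW J0e); rewrite ler_wiXn2l ?leq_maxl// ltW.
pose L := all_nodes T J.
pose part v i := E `&` cyl v `&` [set y | trunc y J \in take i L].
have /choice[n nP] v : exists i, size v = j ->
    mass j (E `&` cyl v) <= mass j.+1 (part v i) <= mass j (E `&` cyl v) + e.
  have [vj|] := pselect (size v = j); last by exists 0%N.
  have [|i||i iP] := @discrete_ivt (fun i => mass j.+1 (part v i)) (mass j (E `&` cyl v)) e (size L).
  - rewrite /part take0 (_ : _ `&` _ = set0) ?mass0 ?addr_ge0 ?mass_ge0 ?ltW//.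
    by apply/seteqP; split => // y [].
  - have [iL|Li] := ltnP i (size L); last first.
      by rewrite /part !take_oversize ?(leqW Li)// lerDl ltW.
    apply: (@le_trans _ _ (mass j.+1 (part v i `|` (E `&` cyl (nth [::] L i))))).
      apply: le_mass => // y [[Ey vy]] /=; rewrite (take_nth [::])// mem_rcons inE => /predU1P[yi|yi].
        right; split => //; rewrite /cyl /= -yi size_mkseq//.
      by left.
    apply: le_trans (massU _ _ _) _; rewrite lerD2l; apply: le_trans Je.
    have : nth [::] L i \in L by exact: mem_nth.
    rewrite mem_all_nodes => /eqP LJ; rewrite -[X in r ^+ X]LJ; apply: mass_cyl.
    by rewrite LJ leq_maxr.
  - apply: le_mass => // y [Ey vy]; split => //=.
    by rewrite take_size mem_all_nodes size_mkseq.
  - by exists i.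
exists (E `&` [set y | trunc y J \in take (n (take j (trunc y J))) L]); split.
- by move=> y [].
- exact: (@tree_closed_trunc E (fun u => u \in take (n (take j u)) L)).
- move=> v vj; have := nP v vj.
  rewrite (_ : part v (n v) = E `&` [set y | trunc y J \in take (n (take j (trunc y J))) L] `&` cyl v)//.
  have tE y : cyl v y -> take j (trunc y J) = v.
    by move=> vy; rewrite take_trunc ?(leq_trans (leqnSn j)) ?leq_maxr// -vj.
  by apply/seteqP; split => y [[Ey vy] yn] /=; [split => //; split => //=; rewrite tE|
    split => //=; move: vy => /=; rewrite tE].
Qed.

Section trimmed.
Variables (j : nat) (E E' : set Y) (e : R).
Hypothesis EE' : forall v, size v = j ->
  mass j (E `&` cyl v) <= mass j.+1 (E' `&` cyl v) <= mass j (E `&` cyl v) + e.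

(** Subadditivity for [E'] and superadditivity for [E] over the nodes of generation [j]. *)
Lemma trimmed_mass_le : mass j.+1 E' <= mass j E + (#|T| ^ j)%:R * e.
Proof.
apply: (@le_trans _ _ (\sum_(v <- all_nodes T j) mass j.+1 (E' `&` cyl v))).
  apply: le_trans (mass_seq _ _ _); apply: le_mass => // y Ey.
  by exists (trunc y j); rewrite /= ?mem_all_nodes ?size_mkseq//; split; rewrite // /cyl /= size_mkseq.
apply: (@le_trans _ _ (\sum_(v <- all_nodes T j) (mass j (E `&` cyl v) + e))).
  rewrite big_seq [leRHS]big_seq; apply: ler_sum => v; rewrite mem_all_nodes => /eqP /EE'.
  by case/andP.
rewrite big_split /= big_const_seq count_predT iter_addr_0 size_all_nodes.
by rewrite -[X in _ + X <= _]mulr_natl lerD2r mass_superadditive.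
Qed.

(** A covering of [E'] pays for [E] too: its nodes of size at most [j] are kept, and below any other
    node of generation [j] it weighs at least [mass j.+1] of [E'], hence at least [mass j] of [E]
    there. *)
Lemma trimmed_mass_ge : mass 0 E <= mass 0 E'.
Proof.
apply: le_mass_lb => V [_ E'V].
pose low := [seq u <- V | (size u <= j)%N]; pose high := [seq u <- V | (j < size u)%N].
pose nodes := [seq v <- all_nodes T j | ~~ has (fun u => take (size u) v == u) low].
have VE : weight V = weight low + weight high.
  rewrite /weight (bigID (fun u => (size u <= j)%N)) /= !big_filter; congr (_ + _).
  by apply: eq_bigl => u; rewrite ltnNge.
have highj u : u \in high -> (j <= size u)%N by rewrite mem_filter => /andP[/ltnW].
rewrite VE -(weight_split highj).
apply: (@le_trans _ _ (mass 0 ((E `&` \bigcup_(u in [set` low]) cyl u) `|` \bigcup_(v in [set` nodes]) (E `&` cyl v)))).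
  apply: le_mass => // y Ey.
  have [/hasP[u ul /eqP uy]|nl] := boolP (has (fun u => take (size u) (trunc y j) == u) low).
    left; split => //; exists u => //=; move: ul; rewrite mem_filter => /andP[uj _].
    by rewrite /cyl /= -[RHS]uy take_trunc.
  right; exists (trunc y j); first by rewrite /= mem_filter nl mem_all_nodes size_mkseq eqxx.
  by split; rewrite // /cyl /= size_mkseq.
apply: le_trans (massU _ _ _) _; apply: lerD.
  apply: mass_le; split => // y [_ [u ul uy]]; by exists u.
apply: le_trans (mass_seq _ _ _) _; rewrite big_filter big_mkcond big_seq [leRHS]big_seq.
apply: ler_sum => v; rewrite mem_all_nodes => /eqP vj.
case: ifPn => [nl|_]; last exact: weight_ge0.
apply: (@le_trans _ _ (mass j.+1 (E' `&` cyl v))).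
  by apply: le_trans (proj1 (andP (EE' vj))); exact: le_mass.
apply: mass_le; split=> [u|y [/E'V[u uV uy] vy]].
  by rewrite !mem_filter => /andP[_ /andP[]].
have [uj|ju] := leqP (size u) j.
  exfalso; move/negP: nl; apply; apply/hasP; exists u; first by rewrite mem_filter uj.
  by rewrite -vy take_trunc ?vj// uy.
exists u => //; rewrite !mem_filter uV ju /= andbT.
by apply/eqP; rewrite -vj; apply: cyl_take uy vy; rewrite vj ltnW.
Qed.

End trimmed.

(** Iterated trimming bounds the mass at every generation, hence the Hausdorff measure of the
    intersection, and keeps the content [c]. The mass starts at 1 at most, the weight of the root,
    and the errors sum to at most 1. *)
Lemma thin_subset E (c : R) : tree_closed E -> c <= mass 0 E ->
  exists H : nat -> set Y, [/\ forall j, H j `<=` E, forall j, tree_closed (H j),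
    forall j, H j.+1 `<=` H j, forall j, mass j (H j) <= 2 & c <= mass 0 (\bigcap_j H j)].
Proof.
move=> cE cm.
(* The errors at the #|T|^j nodes of generation [j] add up to at most 2^-(j+1). *)
pose e j : R := 1 / (2 ^ j.+1)%:R / (#|T| ^ j).+1%:R.
have e0 j : 0 < e j by rewrite !divr_gt0// ltr0n expn_gt0.
have /choice[next nextP] (x : nat * set Y) : exists E', tree_closed x.2 -> [/\ E' `<=` x.2, tree_closed E' &
  forall v, size v = x.1 -> mass x.1 (x.2 `&` cyl v) <= mass x.1.+1 (E' `&` cyl v) <= mass x.1 (x.2 `&` cyl v) + e x.1].
  have [/(trim x.1)/(_ (e0 x.1))[E' h]|] := pselect (tree_closed x.2); first by exists E'.
  by exists set0.
pose H := fix H j := if j is j'.+1 then next (j', H j') else E.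
have cH j : tree_closed (H j).
  by elim: j => // j IH; have [] := nextP (j, H j) IH.
have HS j : H j.+1 `<=` H j by have [] := nextP (j, H j) (cH j).
have Htrim j v : size v = j -> mass j (H j `&` cyl v) <= mass j.+1 (H j.+1 `&` cyl v) <= mass j (H j `&` cyl v) + e j.
  by have [_ _ +] := nextP (j, H j) (cH j); exact.
have Hle i j : (i <= j)%N -> H j `<=` H i.
  by move=> /subnK <-; elim: (j - i)%N => // n IH y /HS /IH.
exists H; split => //.
- by move=> j; exact: (Hle 0%N).
- have step j : mass j (H j) <= 2 - 1 / (2 ^ j)%:R.
    elim: j => [|j IH].
      rewrite /= expn0 divr1; apply: le_trans (_ : 1 <= _); last lra.
      apply: le_trans (le_mass (j := 0) (F := setT `&` cyl [::]) _ _) _ => //.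
      exact: (mass_cyl setT (v := [::])).
    apply: le_trans (trimmed_mass_le (Htrim j)) _; apply: le_trans (lerD IH (lexx _)) _.
    have p0 : 0 < (2 ^ j)%:R :> R by rewrite ltr0n expn_gt0.
    have : (#|T| ^ j)%:R * e j <= 1 / (2 ^ j.+1)%:R.
      rewrite /e mulrCA ler_piMr//.
      by rewrite ler_pdivrMr// mul1r ler_nat.
    rewrite expnS natrM invfM !mul1r; move: (2 ^ j)%:R^-1 => w; lra.
  move=> j; apply: le_trans (step j) _; by rewrite gerBl divr_ge0.
- apply: le_mass_lb => V VH; have [j Vj] := fcover_koenig cH HS VH.
  apply: le_trans (mass_le Vj); apply: le_trans cm _.
  elim: {Vj} j => // j IH; apply: le_trans IH _; exact: trimmed_mass_ge (Htrim j).
Qed.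

End tree_mass.

(** * Besicovitch subsets of Borel sets in Euclidean space *)

Section subset_of_dimension.
Context {R : realType} {D : nat}.
Local Notation T := {ffun 'I_D -> bool}.
Implicit Types (a : nat) (E : set 'rV[R]_D).

(** Over a one-point parameter space the tree content is a content on sequences alone, and its
    increasing sets property can be reused. *)
Definition point_mass : {measure set unit -> \bar R} := @dirac _ unit tt R.

Lemma point_massE (A : set unit) : point_mass A = (tt \in A)%:R%:E.
Proof. by rewrite /point_mass /= diracE. Qed.

Definition coded a E : set (nat -> T) := [set y | exists2 x, E x & codes a y x].

Definition coded_content a s E : \bar R :=
  content point_mass (rate s) 0 [set p : unit * (nat -> T) | coded a E p.2].

Lemma coded_content0 a s E : 0 < s -> E `<=` window a -> coded_content a s E = 0%E ->
  dyadic_null (@eucl_dist R D) s E.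
Proof.
move=> s0 Ew c0; have r0 := rate_ge0 s; apply: (nodes_dyadic_null (a := a)) => // e e0.
have [|A [mA _ EA] wA] := content_near (mu := point_mass) (l := 0%N)
    (E := [set p : unit * (nat -> T) | coded a E p.2]) r0 e0.
  by move: c0; rewrite /coded_content => ->; rewrite ltry.
exists [set v | A v tt]; split.
  move: wA; rewrite -/(coded_content a s E) c0 add0e; apply: le_trans.
  rewrite esum_mkcond; apply: le_esum => v _; rewrite point_massE.
  case: ifPn => [|_]; first by rewrite inE => Av; rewrite mem_set// mule1.
  by apply: mule_ge0; rewrite lee_fin ?exprn_ge0.
move=> x Ex; have [y yx] := codes_surj (Ew x Ex).
have [m Am] : exists m, A (trunc y m) tt by apply: (EA (tt, y)); exists x.
by exists (trunc y m) => //; exact: yx.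
Qed.

(** Points whose codes share a prefix of length m lie within one side of generation m, so limits of
    codes code limits of points. *)
Lemma closure_coded a E y :
  (forall m, exists2 y', coded a E y' & trunc y' m = trunc y m) -> coded a (closure E) y.
Proof.
move=> ay; have [x yx] := codes_exists (R := R) a y; exists x => //.
move=> B /nbhs_ballP[e /= e0 xB]; have [m me] := side_small (R := R) a e0.
have [y' [x' Ex' yx'] y'y] := ay m.
exists x'; split => //; apply: xB; split => // i j; rewrite ord1 /ball /= /ball_ /=.
apply: le_lt_trans me; have := cubeP (u := trunc y m) j (yx m); rewrite size_mkseq; apply.
by rewrite -y'y; exact: yx'.
Qed.

Lemma coded_window_borel a s E : 0 < s -> borel_set E -> E `<=` window a ->
  ~ dyadic_null (@eucl_dist R D) s E ->
  exists K : set (nat -> T), exists2 c : R, 0 < c &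
    [/\ tree_closed K, K `<=` coded a E & c <= mass (rate s) 0 K].
Proof.
move=> s0 bE Ew nE; have r0 := rate_ge0 s.
have [c c0 cE] : exists2 c : R, 0 < c & (c%:E < coded_content a s E)%E.
  have : (0 < coded_content a s E)%E.
    rewrite lt_neqAle content_ge0// andbT; apply/eqP => c0; apply: nE.
    exact: (coded_content0 s0 Ew (esym c0)).
  case: (coded_content a s E) => [x||//]; last by exists 1; rewrite ?ltry.
  by rewrite lte_fin => x0; exists (x / 2); rewrite ?divr_gt0// lte_fin ltr_pdivrMr// ltr_pMr// ltr1n.
have [F [EF FE]] : souslin E by apply: borel_souslin bE => U; exact: (@open_bigcup_closed R).
have [||tau bigtau] := @souslin_capacity _ F (fun E => (c%:E < coded_content a s E)%E).
- move=> G Ginc bigG; apply: contrapT => /forallNP nG.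
  suff le_c : (coded_content a s (\bigcup_i G i) <= c%:E)%E by move: bigG; rewrite ltNge le_c.
  rewrite /coded_content.
  rewrite (_ : [set p | _] = \bigcup_i [set p : unit * (nat -> T) | coded a (G i) p.2]).
    apply: content_nondecreasing => // [i p [x /Ginc Gx yx]|i]; first by exists x.
    by rewrite leNgt; apply/negP; exact: nG.
  apply/seteqP; split => [p [x [i _ Gx] yx]|p [i _ [x Gx yx]]]; first by exists i => //; exists x.
  by exists x => //; exists i.
- by rewrite -EF.
(* The closure is taken among codes, where [koenig] applies; its members decode into the closure of
   [dominated F tau m]. *)
pose K m := [set y | forall j, exists2 y', coded a (dominated F tau m) y' & trunc y' j = trunc y j].
exists (\bigcap_m K m), c => //; split.
- apply: tree_closed_bigcap => m y ay j; have [y' /(_ j)[y'' ? ?] y'y] := ay j.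
  by exists y'' => //; rewrite -y'y.
- move=> y Ky; have [x yx] := codes_exists (R := R) a y; exists x => //.
  apply: (FE tau) => m _; have [x' x'F yx'] := closure_coded (Ky m I).
  by rewrite (codes_unique yx yx').
- apply: (le_mass_lb (rate_gt0 s)) => V VK; rewrite -lee_fin.
  have [||m Vm] := fcover_koenig _ _ VK.
  + move=> m y ay j; have [y' /(_ j)[y'' ? ?] y'y] := ay j.
    by exists y'' => //; rewrite -y'y.
  + move=> m y Ky j; have [y' [x Fx yx] y'y] := Ky j; exists y' => //; exists x => //.
    exact: dominatedS Fx.
  apply: le_trans (ltW (bigtau m)) _.
  apply: le_trans (@content_le_seq _ unit R _ point_mass _ r0 0 setT V _ _ _ _) _ => //.
    move=> p [x Fx px]; split => //; have [_ /(_ p.2)[]] := Vm.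
      by move=> j; exists p.2 => //; exists x.
    by move=> v vV pv; exists (size v); rewrite pv.
  by rewrite /weight -sumEFin; apply: lee_sum => v _; rewrite point_massE in_setT mule1.
Qed.

Lemma exists_subset_of_dimension s E : 0 < s -> borel_set E ->
  ~ dyadic_null (@eucl_dist R D) s E ->
  exists H, [/\ H `<=` E, borel_set H, ~ dyadic_null (@eucl_dist R D) s H &
    forall t, s < t -> dyadic_null (@eucl_dist R D) t H].
Proof.
move=> s0 bE nE; have r0 := rate_gt0 s; have r1 := rate_lt1 s0.
have [a nEa] : exists a, ~ dyadic_null (@eucl_dist R D) s (E `&` window a).
  apply: contrapT => /forallNP h; apply: nE.
  apply: (@dyadic_null_sub _ _ _ _ _ (\bigcup_a (E `&` window a))); last first.
    by apply: dyadic_null_bigcup => a; apply: contrapT; exact: h.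
  move=> x Ex; exists (Num.bound (eucl_dist x 0)) => //; split => // i.
  rewrite -ler_norml; apply: le_trans (_ : eucl_dist x 0 <= _).
    by have := coord_le_eucl_dist x 0 i; rewrite mxE subr0.
  apply: le_trans (ltW (archi_boundP (eucl_dist_ge0 _ _))) _.
  by rewrite ler_nat.
have bEa : borel_set (E `&` window a) by apply: borelI => //; apply: borel_closed; exact: closed_window.
have [K [c c0 [cK KE cmass]]] := coded_window_borel s0 bEa (@subIsetr _ _ _) nEa.
have [Hs [HK Hc HS Hmass Hge]] := thin_subset r0 r1 cK cmass.
pose H' := \bigcap_j Hs j.
have cH' : tree_closed H' by exact: tree_closed_bigcap.
have H'E y : H' y -> coded a (E `&` window a) y by move=> /(_ 0%N I) /HK /KE.
pose H : set 'rV[R]_D := [set x | exists2 y, H' y & codes a y x].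
have HE : H `<=` E.
  by move=> x [y /H'E[x' [Ex' _] yx'] yx]; rewrite (codes_unique yx yx').
exists H; split => //.
(* By [koenig], a point that lies at each generation in a cube of some path of [H'] lies in all
   cubes of a single path. *)
- rewrite (_ : H = \bigcap_j \bigcup_(v in [set` [seq v <- all_nodes T j | `[< exists2 y, H' y & trunc y j = v >]]]) cube a v).
    apply: borel_bigcap => j; apply: borel_closed; apply: closed_bigcup; first exact: finite_seq.
    by move=> v _; exact: closed_cube.
  apply/seteqP; split => [x [y H'y yx] j _|x xH].
    exists (trunc y j); last exact: yx.
    by rewrite /= mem_filter mem_all_nodes size_mkseq eqxx andbT; apply/asboolP; exists y.
  have [|||y yE] := @koenig T (fun j => H' `&` [set y | cube a (trunc y j) x]).
  + by move=> j; exact: (tree_closed_trunc (P := fun v => cube a v x)).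
  + by move=> j y [H'y yx]; split => //; apply: cube_trunc yx.
  + move=> j; have [v /= + xv] := xH j I; rewrite mem_filter => /andP[/asboolP[y H'y yv] _].
    by exists y; split => //=; rewrite yv.
  + by exists y; [have [] := yE 0%N|move=> j; have [] := yE j].
- move=> nH; have c2 : 0 < c / 2 by rewrite divr_gt0.
  (* By compactness a null covering would yield a finite covering of [H'] of weight at most [c / 2],
     below its mass. *)
  have [V [_ Vw HV]] := dyadic_null_nodes a 0 s0 c2 nH.
  have [i H'i] : exists i, fcover 0 H' (flatten [seq V i' | i' <- iota 0 i]).
    pose G i := H' `&` [set y | forall i', (i' < i)%N -> forall m, trunc y m \notin V i'].
    apply: contrapT => /forallNP h.
    have [|||y yG] := @koenig T G.
    + move=> i; apply: tree_closedI => // y ay i' i'i m.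
      by have [y' /(_ i' i'i m) + <-] := ay m.
    + by move=> i y [H'y yV]; split => // i' i'i; apply: yV; exact: ltnW.
    + move=> i; apply: contrapT => nG; apply: (h i); split => // y H'y.
      apply: contrapT => ny; apply: nG; exists y; split => // i' i'i m; apply/negP => ym.
      apply: ny; exists (trunc y m); last by rewrite /cyl /= size_mkseq.
      by apply/flatten_mapP; exists i' => //; rewrite mem_iota.
    have [H'y _] := yG 0%N; have [x Ex yx] := H'E y H'y.
    have [|i [m ym]] := HV x y _ yx; first by exists y.
    by have [_ /(_ i (leqnn _) m)] := yG i.+1; rewrite ym.
  have : c <= c / 2.
    apply: le_trans Hge _; apply: le_trans (mass_le r0 H'i) _.
    rewrite -lee_fin /weight -sumEFin big_flatten /= big_map; apply: le_trans Vw.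
    rewrite -[in iota 0 i](subn0 i) -/(index_iota 0 i).
    by apply: nneseries_lim_ge => j _ _; apply: sume_ge0 => v _; rewrite lee_fin exprn_ge0// ltW.
  by rewrite leNgt => /negP; apply; rewrite ltr_pdivrMr// ltr_pMr// ltr1n.
- move=> t st; apply: (nodes_dyadic_null (a := a)); first exact: lt_trans st.
  move=> e e0; have q0 := rate_gt0 (t - s).
  have q1 : rate (t - s) < 1 by rewrite rate_lt1// subr_gt0.
  (* From generation [j] on, raising the exponent from [s] to [t] gains [rate (t - s) ^+ j], while
     the s-weight stays below 2 + 1. *)
  have [||j je] := @expr_small _ (rate (t - s)) (e / 3); rewrite ?divr_gt0//; first by rewrite ltW.
  have [V [jV HV] Vw] := mass_near r0 j (Hs j) ltr01.
  exists [set` V]; split; last first.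
    move=> x [y H'y yx]; have [v vV vy] := HV y (H'y j I); exists v => //.
    by have := yx (size v); rewrite vy.
  rewrite esum_mkcond; under eq_esum do rewrite mem_setE.
  apply: le_trans (esum_seq V _) _; first by move=> v; rewrite lee_fin exprn_ge0// rate_ge0.
  rewrite sumEFin lee_fin; apply: (@le_trans _ _ (\sum_(v <- V) rate (t - s) ^+ j * rate s ^+ size v)).
    rewrite big_seq [leRHS]big_seq; apply: ler_sum => v vV.
    rewrite -[in X in X ^+ _](subrK s t) rateD exprMn; apply: ler_wpM2r; first by rewrite exprn_ge0// ltW.
    by rewrite ler_wiXn2l ?jV// ltW.
  rewrite -mulr_sumr -/(weight (rate s) V).
  have Vw3 : weight (rate s) V <= 3.
    by apply: le_trans (ltW Vw) _; rewrite (_ : 3 = 2 + 1 :> R) ?lerD2r//; rewrite -natr1.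
  apply: (@le_trans _ _ (e / 3 * 3)); last by rewrite divfK.
  by apply: ler_pM => //; [rewrite exprn_ge0// ltW|exact: weight_ge0|exact: ltW].
Qed.

End subset_of_dimension.

(** * The decomposition *)

Section transport.
Context {R : realType} {k n : nat}.

Lemma borel_preimage (X Y : topologicalType) (f : X -> Y) (A : set Y) :
  continuous f -> borel_set A -> borel_set (f @^-1` A).
Proof.
move=> cf; pose P := [set A : set Y | borel_set (f @^-1` A)].
suff: <<s [set U : set Y | open U] >> `<=` P by exact.
apply: smallest_sub; first split.
- by rewrite /P /= preimage_set0; apply: borel_open; exact: open0.
- by move=> C; rewrite /P /= setTD preimage_setC; exact: borelC.
- by move=> C PC; rewrite /P /= preimage_bigcup; exact: borel_bigcup.
- by move=> U /= oU; apply: borel_open; apply: open_comp.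
Qed.

Definition concat (p : 'rV[R]_k * 'rV[R]_n) : 'rV[R]_(k + n) := row_mx p.1 p.2.

Definition uncat (x : 'rV[R]_(k + n)) : 'rV[R]_k * 'rV[R]_n := (lsubmx x, rsubmx x).

Lemma concatK : cancel concat uncat.
Proof. by case=> p q; rewrite /concat /uncat /= row_mxKl row_mxKr. Qed.

Lemma uncatK : cancel uncat concat.
Proof. by move=> x; rewrite /concat /uncat /= hsubmxK. Qed.

(** This isometry transports the subset theorem from R^(k+n) to the product. *)
Lemma eucl_dist_concat p q : eucl_dist (concat p) (concat q) = eucl_dist_prod p q.
Proof.
rewrite /eucl_dist_prod /eucl_dist !sqr_sqrtr; try by apply: sumr_ge0 => i _; exact: sqr_ge0.
rewrite big_split_ord; congr (Num.sqrt (_ + _)); apply: eq_bigr => i _;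
  by rewrite /concat ?row_mxEl ?row_mxEr.
Qed.

Lemma continuous_concat : continuous concat.
Proof.
move=> p; apply/cvg_ballP => e e0; apply: filterS (nbhsx_ballx p e e0) => q [[_ pq1] [_ pq2]].
split => // i j; rewrite /concat !mxE; case: (fintype.split j) => l; [exact: pq1|exact: pq2].
Qed.

Lemma continuous_uncat : continuous uncat.
Proof.
move=> x A /nbhs_ballP[e /= e0 eA]; apply/nbhs_ballP; exists e => // y [_ xy]; apply: eA.
by split; split => // i j; rewrite !mxE; exact: xy.
Qed.

Lemma dyadic_null_preimage (T1 T2 : Type) (dist1 : T1 -> T1 -> R) (dist2 : T2 -> T2 -> R)
    (h : T1 -> T2) s (E : set T2) : (forall x y, dist1 x y <= dist2 (h x) (h y)) ->
  dyadic_null dist2 s E -> dyadic_null dist1 s (h @^-1` E).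
Proof.
move=> hd nE e /nE[U [c [[EU Uc] ce]]]; exists (fun i => h @^-1` U i), c; split => //; split.
  by move=> x /EU[i _ Ux]; exists i.
move=> i; have [c0 Ui] := Uc i; split => // -[x Ux].
have [|m [dm mc]] := Ui; first by exists (h x).
by exists m; split => // y z Uy Uz; exact: le_trans (hd _ _) (dm _ _ Uy Uz).
Qed.

Lemma exists_subset_of_dimension_prod s (B : set ('rV[R]_k * 'rV[R]_n)) : 0 < s -> borel_set B ->
  ~ dyadic_null (@eucl_dist_prod R k n) s B ->
  exists H, [/\ H `<=` B, borel_set H, ~ dyadic_null (@eucl_dist_prod R k n) s H &
    forall t, s < t -> dyadic_null (@eucl_dist_prod R k n) t H].
Proof.
move=> s0 bB nB.
have [|H [HB bH nH tH]] := exists_subset_of_dimension s0 (borel_preimage continuous_uncat bB).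
  move=> nB'; apply: nB; rewrite (_ : B = concat @^-1` (uncat @^-1` B)).
    by apply: dyadic_null_preimage nB' => p q; rewrite eucl_dist_concat.
  by apply/seteqP; split => p; rewrite /= concatK.
exists (concat @^-1` H); split.
- by move=> p /HB; rewrite /= concatK.
- exact: borel_preimage continuous_concat bH.
- move=> nH'; apply: nH; rewrite (_ : H = uncat @^-1` (concat @^-1` H)).
    by apply: dyadic_null_preimage nH' => x y; rewrite -eucl_dist_concat !uncatK.
  by apply/seteqP; split => x; rewrite /= uncatK.
- by move=> t /tH; apply: dyadic_null_preimage => p q; rewrite eucl_dist_concat.
Qed.

End transport.

(** * Dimension bounds and assembly *)

Section main.
Context {R : realType}.

Lemma eucl_dist_prod_xx k n (p : 'rV[R]_k * 'rV[R]_n) : eucl_dist_prod p p = 0.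
Proof. by rewrite /eucl_dist_prod !eucl_dist_xx expr0n addr0 sqrtr0. Qed.

Lemma hausdorff_dim_le_null (T : Type) (dist : T -> T -> R) s (E : set T) :
  (forall x, dist x x = 0) -> 0 < s -> dyadic_null dist s E -> (hausdorff_dim dist E <= s%:E)%E.
Proof.
move=> dxx s0 nE; apply: ereal_inf_lbound; exists s => //; split; first exact: ltW.
exact: (hausdorff_measure0P dxx E s0).2.
Qed.

Lemma lebesgue_outer_bigcup0 k (A : nat -> set 'rV[R]_k.+1) :
  (forall i, lebesgue_outer (A i) = 0%E) -> lebesgue_outer (\bigcup_i A i) = 0%E.
Proof.
move=> A0; apply/eqP; rewrite eq_le lebesgue_outer_ge0 andbT.
by apply: le_trans (lebesgue_outer_sigma_subadditive _) _; rewrite eseries0.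
Qed.

Lemma lebesgue_outer_sub0 k (A B : set 'rV[R]_k.+1) : A `<=` B ->
  lebesgue_outer B = 0%E -> lebesgue_outer A = 0%E.
Proof.
move=> AB B0; apply/eqP; rewrite eq_le lebesgue_outer_ge0 andbT -B0.
exact: le_lebesgue_outer.
Qed.

Section fixed_borel_set.
Variables (k n : nat) (B : set ('rV[R]_k.+1 * 'rV[R]_n)).
Hypothesis B_borel : borel_set B.
Local Notation dim_slice := (fun t => hausdorff_dim (@eucl_dist R n) (xsection B t)).
Local Notation d := (lebesgue_ess_sup dim_slice).

Lemma ess_sup_ge0 : (0 <= d)%E.
Proof.
rewrite /lebesgue_ess_sup /ereal_sup_or0; case: eqVneq => // /set0P[_ [q [q0 qB] _]].
by apply: (@le_trans _ _ q%:E); [rewrite lee_fin|apply: ereal_sup_ubound; exists q].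
Qed.

Lemma ess_sup_lt q : 0 <= q -> (d < q%:E)%E -> lebesgue_outer [set t | (q%:E < dim_slice t)%E] = 0%E.
Proof.
move=> q0 dq; apply/eqP; rewrite eq_le lebesgue_outer_ge0 andbT leNgt; apply/negP => pos.
move: dq; rewrite ltNge => /negP; apply.
have mem : [set q%:E | q in [set q : R | (0 <= q)%R /\ (0 < lebesgue_outer [set t | q%:E < dim_slice t])%E]] q%:E.
  by exists q.
rewrite /lebesgue_ess_sup /ereal_sup_or0 ifF; first exact: ereal_sup_ubound.
by apply/negbTE/set0P; exists q%:E.
Qed.

(** Nullity at [s] passes to almost every slice at all exponents above s - (k + 1). The projection
    makes this difference nonnegative, which also settles an empty set of exponents [q]. *)
Lemma dim_ge_ess_sup : hausdorff_dim (@eucl_dist R k.+1) (fst @` B) = k.+1%:R%:E ->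
  (k.+1%:R%:E + d <= hausdorff_dim (@eucl_dist_prod R k.+1 n) B)%E.
Proof.
move=> dim_proj; apply: hausdorff_dim_ge => [p|s s0 nB]; first exact: eucl_dist_prod_xx.
have ks : k.+1%:R <= s.
  rewrite -lee_fin -dim_proj; apply: hausdorff_dim_le_null => //; first exact: eucl_dist_xx.
  exact: dyadic_null_fst.
suff ds : (d <= (s - k.+1%:R)%:E)%E.
  by apply: le_trans (leeD2l _ ds) _; rewrite -EFinD lee_fin addrC subrK.
rewrite /lebesgue_ess_sup /ereal_sup_or0; case: ifP => _; first by rewrite lee_fin subr_ge0.
apply: ge_ereal_sup => _ [q [q0 qpos] <-]; rewrite lee_fin leNgt; apply/negP => sq.
move: qpos; rewrite ltNge => /negP; apply.
pose q' := (q + (s - k.+1%:R)) / 2.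
have [q'q sq'] : q' < q /\ s - k.+1%:R < q' by rewrite /q'; split; lra.
have q'0 : 0 < q' by apply: le_lt_trans sq'; rewrite subr_ge0.
have [|Z Z0 ZB] := dyadic_null_slices (q := q') (B := B) q'0.
  by apply: dyadic_null_le nB; rewrite addrC -lerBlDr ltW.
rewrite -Z0; apply: le_lebesgue_outer => t /= qt; apply: contrapT => /ZB nt.
have := lt_le_trans qt (hausdorff_dim_le_null (@eucl_dist_xx R n) q'0 nt).
by rewrite lte_fin ltNge ltW.
Qed.

Lemma graph_null_part (e : R) : 0 < e -> (d < e%:E)%E ->
  exists N : set ('rV[R]_k.+1 * 'rV[R]_n), [/\ borel_set N,
    dyadic_null (@eucl_dist_prod R k.+1 n) (k.+1%:R + e) N &
    forall f : 'rV[R]_k.+1 -> 'rV[R]_n, eucl_lipschitz f ->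
      lebesgue_outer [set t | B (t, f t) /\ ~ N (t, f t)] = 0%E].
Proof.
move=> e0 de; have d0 := ess_sup_ge0.
have dfin : d \is a fin_num by rewrite ge0_fin_numE// (lt_le_trans de)// leey.
pose d' := fine d; have d'E : d = d'%:E by rewrite /d' fineK.
have d'0 : 0 <= d' by rewrite fine_ge0.
have d'e : d' < e by rewrite -lte_fin -d'E.
(* Outside a null set slices have dimension at most [q], hence are null at [s]; the gap from [s] to
   [e] is left for the decomposition. *)
pose q := d' + (e - d') / 3; pose s := d' + (e - d') / 3 * 2.
have [q0 dq qs se] : [/\ 0 <= q, d' < q, q < s & s < e] by rewrite /q /s; split; lra.
have s0 : 0 < s by apply: le_lt_trans qs.
(* The first factor stops at [a], strictly inside the half-open root cell, which reaches to a +
   1. *)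
pose W a : set ('rV[R]_k.+1 * 'rV[R]_n) :=
  (fst @^-1` box (const_mx (- a%:R)) (const_mx a%:R)) `&` (snd @^-1` window a).
have bBW a : borel_set (B `&` W a).
  apply: borelI => //; apply: borel_closed; apply: closedI; apply: preimage_closed => [p _|].
  - exact: continuous_fst.
  - exact: closed_box.
  - exact: continuous_snd.
  - exact: closed_window.
have /choice[N NP] a : exists N : set ('rV[R]_k.+1 * 'rV[R]_n), [/\ borel_set N,
    dyadic_null (@eucl_dist_prod R k.+1 n) (k.+1%:R + e) N &
    forall f : 'rV[R]_k.+1 -> 'rV[R]_n, eucl_lipschitz f ->
      lebesgue_outer [set t | (B `&` W a) (t, f t) /\ ~ N (t, f t)] = 0%E].
  apply: (@graph_null_decomposition R k n a s e (B `&` W a) [set t | (q%:E < dim_slice t)%E]) => //.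
  - move=> p [_ [p1 p2]]; split => // i; have /andP[p1a p1b] := p1 i; rewrite !mxE in p1a p1b.
    rewrite !mxE /= side0 mulr0 addr0; apply/andP; split.
      by apply: le_trans p1a; rewrite lerN2 ler_nat.
    rewrite (_ : - _ + _ = a.+1%:R); last by ring.
    by apply: le_lt_trans p1b _; rewrite ltr_nat.
  - by apply: ess_sup_lt; rewrite // d'E lte_fin.
  - move=> t /negP; rewrite -leNgt => tq.
    apply: (@dyadic_null_sub _ _ _ _ _ (xsection B t)).
      by move=> x /xsectionP[Bx _]; exact/xsectionP.
    apply: hausdorff_dim_lt; first exact: eucl_dist_xx.
    by apply: le_lt_trans tq _; rewrite lte_fin.
exists (\bigcup_a N a); split.
- by apply: borel_bigcup => a; have [] := NP a.
- by apply: dyadic_null_bigcup => a; have [] := NP a.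
- move=> f fL; apply: lebesgue_outer_sub0 (lebesgue_outer_bigcup0 (A := fun a =>
    [set t | (B `&` W a) (t, f t) /\ ~ N a (t, f t)]) _); last first.
    by move=> a; have [_ _] := NP a; exact.
  move=> t [Bt nN].
  pose a := (Num.bound (eucl_dist t 0) + Num.bound (eucl_dist (f t) 0))%N.
  exists a => //; split; last by move=> Nt; apply: nN; exists a.
  split => //; split => i /=.
    rewrite !mxE -ler_norml; apply: (@le_trans _ _ (eucl_dist t 0)).
      by have := coord_le_eucl_dist t 0 i; rewrite mxE subr0.
    apply: le_trans (ltW (archi_boundP (eucl_dist_ge0 _ _))) _.
    by rewrite ler_nat leq_addr.
  rewrite -ler_norml; apply: (@le_trans _ _ (eucl_dist (f t) 0)).
    by have := coord_le_eucl_dist (f t) 0 i; rewrite mxE subr0.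
  apply: le_trans (ltW (archi_boundP (eucl_dist_ge0 _ _))) _.
  by rewrite ler_nat leqW// leq_addl.
Qed.

(* Subsets of rational dimensions increasing to [v] are glued, as [B] may have dimension exactly [v] while being
   null for the [v]-dimensional Hausdorff measure. *)
Lemma exists_subset_of_full_dimension (v : R) : 0 < v ->
  (v%:E <= hausdorff_dim (@eucl_dist_prod R k.+1 n) B)%E ->
  exists H, [/\ H `<=` B, borel_set H,
    (v%:E <= hausdorff_dim (@eucl_dist_prod R k.+1 n) H)%E &
    forall s, v < s -> dyadic_null (@eucl_dist_prod R k.+1 n) s H].
Proof.
move=> v0 vB; pose q i : R := ratr (odflt 0 (unpickle i : option rat)).
have /choice[H HP] i : exists H, 0 < q i < v -> [/\ H `<=` B, borel_set H,
    ~ dyadic_null (@eucl_dist_prod R k.+1 n) (q i) H &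
    forall t, q i < t -> dyadic_null (@eucl_dist_prod R k.+1 n) t H].
  have [/andP[q0 qv]|] := boolP (0 < q i < v); last by exists set0.
  have [|H h] := @exists_subset_of_dimension_prod R _ _ (q i) B q0 B_borel; last by exists H.
  move=> /(hausdorff_dim_le_null (@eucl_dist_prod_xx _ _) q0) /(le_trans vB).
  by rewrite lee_fin leNgt qv.
pose H' i := if 0 < q i < v then H i else set0.
exists (\bigcup_i H' i); split.
- by move=> p [i _]; rewrite /H'; case: ifP => // /HP[HB _ _ _] /HB.
- apply: borel_bigcup => i; rewrite /H'; case: ifP => [/HP[]//|_].
  by apply: borel_open; exact: open0.
- apply: hausdorff_dim_ge => [p|s s0 nH]; first exact: eucl_dist_prod_xx.
  rewrite lee_fin leNgt; apply/negP => sv.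
  have [x] := rat_in_itvoo sv; rewrite in_itv /= => /andP[sx xv].
  have qE : q (pickle x) = ratr x by rewrite /q pickleK.
  have qi : 0 < q (pickle x) < v by rewrite qE xv (lt_trans s0).
  have [_ _ + _] := HP _ qi; apply; rewrite qE; apply: dyadic_null_le (ltW sx) _.
  by apply: dyadic_null_sub nH => p Hp; exists (pickle x); rewrite // /H' qi.
- move=> s vs; apply: dyadic_null_bigcup => i; rewrite /H'; case: ifP => [qi|_].
    have [_ _ _] := HP i qi; apply; apply: lt_trans vs; by case/andP: qi.
  exact: dyadic_null0.
Qed.

End fixed_borel_set.
End main.

Local Open Scope ereal_scope.

Theorem corollary2p13 (R : realType) (n k : nat)
    (n_ge1 : (1 <= n)%N) (k_ge1 : (1 <= k)%N)
    (B : set ('rV[R]_k * 'rV[R]_n)) (B_borel : borel_set B)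
    (dim_proj : hausdorff_dim (@eucl_dist R k) (fst @` B) = k%:R%:E) :
  exists G : set ('rV[R]_k * 'rV[R]_n),
    [/\ borel_set G,
        G `<=` B,
        (forall f : 'rV[R]_k -> 'rV[R]_n, eucl_lipschitz f ->
          lebesgue_outer [set t | G (t, f t)] = 0) &
        hausdorff_dim (@eucl_dist_prod R k n) (B `\` G) =
          k%:R%:E +
          lebesgue_ess_sup
            (fun t => hausdorff_dim (@eucl_dist R n) (xsection B t))].
Proof.
case: k k_ge1 => // k _ in B B_borel dim_proj *.
have dimB := dim_ge_ess_sup dim_proj; have d_ge0 := @ess_sup_ge0 R k n B.
have part := graph_null_part B_borel.
move: (lebesgue_ess_sup _) dimB d_ge0 part => d dimB d_ge0 part.
case: d dimB d_ge0 part => [d||] dimB d_ge0 part //; last first.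
  (* An infinite essential supremum makes the dimension of [B] infinite, so the empty set serves as
     G. *)
  exists set0; split => //; first by apply: borel_open; exact: open0.
    by move=> f _; exact: lebesgue_outer0.
  by rewrite setD0; move: dimB; rewrite addey// leye_eq => /eqP ->.
have {}d_ge0 : (0 <= d)%R by rewrite -lee_fin.
have e_gt i : (0 < d + i.+1%:R^-1)%R by rewrite ltr_wpDl.
have /choice[N NP] i : exists N : set ('rV[R]_k.+1 * 'rV[R]_n), [/\ borel_set N,
    dyadic_null (@eucl_dist_prod R k.+1 n) (k.+1%:R + (d + i.+1%:R^-1)) N &
    forall f : 'rV[R]_k.+1 -> 'rV[R]_n, eucl_lipschitz f ->
      lebesgue_outer [set t | B (t, f t) /\ ~ N (t, f t)] = 0].
  by apply: part => //; rewrite lte_fin ltrDl.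
have kd_gt0 : (0 < k.+1%:R + d)%R by rewrite ltr_pwDl.
have [|H [HB bH dimH nullH]] := @exists_subset_of_full_dimension R k n B B_borel _ kd_gt0.
  by rewrite EFinD.
pose M := \bigcap_i N i `|` H.
have bM : borel_set M by apply: borelU => //; apply: borel_bigcap => i; have [] := NP i.
exists (B `\` M); split.
- exact: borelD.
- exact: subDsetl.
- move=> f f_lip; apply: lebesgue_outer_sub0 (lebesgue_outer_bigcup0
    (A := fun i => [set t | B (t, f t) /\ ~ N i (t, f t)]) _); last first.
    by move=> i; have [_ _] := NP i; exact.
  move=> t [Bt nM]; have /existsNP[i nNi] : ~ forall i, N i (t, f t).
    by move=> Nt; apply: nM; left => i _.
  by exists i => //; split => // Ni; apply: nNi.
(* What is left of [B] is its part in [M]: the [N i] and [H] bound its dimension from above, the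
   inclusion of [H] from below. *)
- rewrite setDD -EFinD; apply/eqP; rewrite eq_le; apply/andP; split.
    apply: hausdorff_dim_le => [p||s s0]; first exact: eucl_dist_prod_xx.
      by rewrite lee_fin ltW.
    rewrite lte_fin => kds.
    apply: (@dyadic_null_sub _ _ _ _ _ M); first exact: subIsetr.
    apply: dyadic_nullU; last exact: nullH.
    have [i] := ltr_add_invr kds; rewrite -addrA => ids.
    have [_ nNi _] := NP i; apply: dyadic_null_le (ltW ids) _.
    by apply: dyadic_null_sub nNi => p; exact.
  apply: le_trans dimH _; apply: le_hausdorff_dim; first exact: eucl_dist_prod_xx.
  by move=> p Hp; split; [exact: HB|right].
Qed.
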